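(* Let $K,d\ge1$ and $n_1,\dots,n_K\ge1$ be integers, and set $n:=\sum_{k=1}^Kn_k$. For $k=1,\dots,K$ let $\Sigma_k$ be a symmetric positive definite $d\times d$ real matrix with eigenvalues $\lambda_{k1},\dots,\lambda_{kd}$, and let $\mathfrak W_{k,n}\sim\mathcal W_d(n_k,n_k^{-1}\Sigma_k)$, with $\mathfrak W_{1,n},\dots,\mathfrak W_{K,n}$ independent. Let $\mathsf W_n=\sum_{k=1}^K\mathfrak W_{k,n}$ and $W_n:=\mathrm{tr}(\mathsf W_n)$. Let $$\mu:=\sum_{k=1}^K\mathrm{tr}(\Sigma_k),\qquad \nu:=\frac{\left(\sum_{k=1}^K\mathrm{tr}(\Sigma_k)\right)^2}{\sum_{k=1}^Kn_k^{-1}\mathrm{tr}(\Sigma_k^2)},$$ and let $U_n\sim\mathcal G_{\nu/2,\,2\mu/\nu}$. For $r=1,2$, set $$\Delta_n^{(r)}:=\max_{1\le k\le K,\ 1\le l\le d}\left\{\left|\frac{\lambda_{kl}/n_k}{\mu/\nu}-1\right|\left(\frac{\lambda_{kl}}{n_k}\right)^r\right\}.$$ Then $$d_1(W_n,U_n)\le4\Delta_n^{(1)},\qquad d_2(W_n,U_n)\le8\Delta_n^{(2)}+2\mu e_{\nu/2}\Delta_n^{(1)}.$$ If $\nu>2$, then $$d_{\mathrm{Kol}}(W_n,U_n)\le2\left(\frac{\nu\Delta_n^{(1)}}{\mu\sqrt{2\pi(\nu/2-1)}\,r_{\nu/2}}\right)^{1/2}.$$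
   Context: $\mathcal W_d(m,\Psi)$ denotes the $d$-dimensional Wishart distribution with $m$ degrees of freedom and scale matrix $\Psi$, i.e. the law of $\sum_{i=1}^mZ_iZ_i'$ with $Z_1,\dots,Z_m$ i.i.d. $N_d(0,\Psi)$. For $a,b>0$, $\mathcal G_{a,b}$ denotes the Gamma distribution with shape $a$ and scale $b$, with density $p_{a,b}(x)=\frac{1}{\Gamma(a)b^a}x^{a-1}e^{-x/b}\mathbf 1_{\{x>0\}}$. For $\alpha>1$, $r_\alpha:=\exp\left(\frac1{12\alpha-11}\right)$. Distances. $\mathcal Z_1$ is the class of continuously differentiable $h:(0,\infty)\to\mathbb R$ with $\|h'\|_\infty\le1$; $\mathcal Z_2$ is the class of twice continuously differentiable $h:(0,\infty)\to\mathbb R$ with $\|h''\|_\infty\le1$. For (almost surely) positive random variables $X,Y$ with finite moments of order $j\in\{1,2\}$, $d_j(X,Y):=\sup_{h\in\mathcal Z_j}|\mathbb E[h(X)]-\mathbb E[h(Y)]|$. Also $d_{\mathrm{Kol}}(X,Y):=\sup_{z\in\mathbb R}|\mathbb P[X\le z]-\mathbb P[Y\le z]|$. The constant $e_a$, $a>0$. Write $P_{a,1}(x)=\int_0^xp_{a,1}(u)\,du$, $\overline P_{a,1}(x)=\int_x^\infty p_{a,1}(u)\,du$, $\underline{\mathrm P}^1_{a,1}(x)=\int_0^xP_{a,1}(u)\,du$, $\overline{\mathrm P}^1_{a,1}(x)=\int_x^\infty\overline P_{a,1}(u)\,du$, $\underline M_{a,1}(y)=\frac{P_{a,1}(y)}{y\,p_{a,1}(y)}$,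 $\overline M_{a,1}(y)=\frac{\overline P_{a,1}(y)}{y\,p_{a,1}(y)}$ for $x,y>0$, and $$C_{a,1}^2(z)=\overline M_{a,1}''(z)\int_0^z\underline{\mathrm P}^1_{a,1}(x)\,dx+\underline M_{a,1}''(z)\int_z^\infty\overline{\mathrm P}^1_{a,1}(x)\,dx,\qquad z>0.$$ Then $e_a:=\sup_{z>0}C_{a,1}^2(z)$, which is finite. *)

(* Defs.v *)
From HB Require Import structures.
From mathcomp Require Import all_boot all_order all_algebra.
From mathcomp Require Import all_classical all_reals all_analysis.
Set Implicit Arguments.
Unset Strict Implicit.
Unset Printing Implicit Defensive.
Import Order.TTheory GRing.Theory Num.Theory.
Import numFieldNormedType.Exports.

Local Open Scope classical_set_scope.
Local Open Scope ring_scope.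

(* The sigma-algebra on 'M[R]_(m, n) is the product one, generated by the
   coordinate maps; it coincides with the Borel sigma-algebra. *)
Fact mx_display : measure_display. Proof. exact: default_measure_display. Qed.

Section matrix_measurable.
Context {R : realType} (m n : nat).

Definition mx_cylinders : set (set 'M[R]_(m, n)) :=
  [set (fun M : 'M[R]_(m, n) => M ij.1 ij.2) @^-1` B |
     ij in [set: 'I_m * 'I_n] & B in (measurable : set (set R))].

Let mx_measurable0 : <<s mx_cylinders >> set0.
Proof. exact: sigma_algebra0. Qed.

Let mx_measurableC A : <<s mx_cylinders >> A -> <<s mx_cylinders >> (~` A).
Proof. exact: sigma_algebraC. Qed.

Let mx_measurable_bigcup (F : (set 'M[R]_(m, n))^nat) :
  (forall i, <<s mx_cylinders >> (F i)) ->
  <<s mx_cylinders >> (\bigcup_i F i).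
Proof. exact: sigma_algebra_bigcup. Qed.

HB.instance Definition _ := @isMeasurable.Build mx_display 'M[R]_(m, n)
  <<s mx_cylinders >> mx_measurable0 mx_measurableC mx_measurable_bigcup.

End matrix_measurable.

Definition mutual_independence (R : realType) (d d' : measure_display)
    (T : measurableType d) (S : measurableType d') (P : probability T R)
    (I : finType) (X : I -> {RV P >-> S}) : Prop :=
  forall (J : {set I}) (A : I -> set S),
    (forall i, i \in J -> measurable (A i)) ->
    P (\bigcap_(i in [set` J]) (X i @^-1` A i)) =
    (\prod_(i in J) P (X i @^-1` A i))%E.
Arguments mutual_independence {R d d' T S} P {I} X.

Definition posdefmx (R : realType) (d : nat) (S : 'M[R]_d) : Prop :=
  S^T = S /\ forall v : 'cV[R]_d, v != 0 -> 0 < (v^T *m S *m v) 0 0.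

(* [normal_prob m 0] is, by convention of the library, the uniform law on
   [0, 1]; here the degenerate case is the Dirac mass at the mean. *)
Definition normal_law (R : realType) (m s : R) (A : set R) : \bar R :=
  if s == 0 then \d_m A else normal_prob m s A.

(* Z ~ N_d(0, Psi): every linear form t'Z is N(0, t' Psi t). *)
Definition centered_gaussian (R : realType) (dT : measure_display)
    (T : measurableType dT) (P : probability T R) (d : nat)
    (Psi : 'M[R]_d) (Z : {RV P >-> 'cV[R]_d}) : Prop :=
  forall (t : 'cV[R]_d) (A : set R), measurable A ->
    P [set w | A ((t^T *m Z w) 0 0)] =
    normal_law 0 (Num.sqrt ((t^T *m Psi *m t) 0 0)) A.
Arguments centered_gaussian {R dT T} P {d} Psi Z.

Definition wishart (R : realType) (d m : nat) (Psi : 'M[R]_d)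
    (Q : set 'M[R]_d -> \bar R) : Prop :=
  exists (dT : measure_display) (T : measurableType dT) (P : probability T R)
      (Z : 'I_m -> {RV P >-> 'cV[R]_d}),
    [/\ mutual_independence P Z,
        (forall i, centered_gaussian P Psi (Z i)) &
        forall A : set 'M[R]_d, measurable A ->
          Q A = P [set w | A (\sum_(i < m)
                     (Z i w *m (Z i w)^T))]].

Section gamma.
Context {R : realType}.
Local Notation mu := (@lebesgue_measure R).

Definition Gamma_fun (a : R) : R :=
  \int[mu]_(x in `]0, +oo[) (x `^ (a - 1) * expR (- x)).

Definition gamma_pdf (a b x : R) : R :=
  if 0 < x then (Gamma_fun a * b `^ a)^-1 * x `^ (a - 1) * expR (- x / b)
  else 0.

Definition gamma_prob (a b : R) (A : set R) : \bar R :=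
  (\int[mu]_(x in A) (gamma_pdf a b x)%:E)%E.

(* [gamma_low], [gamma_up] are the lower and upper tails of the Gamma law with
   scale 1; [gamma_low1], [gamma_up1] are their iterated integrals. *)
Definition gamma_low (a x : R) : R := \int[mu]_(u in `[0, x]) gamma_pdf a 1 u.

Definition gamma_up (a x : R) : R :=
  \int[mu]_(u in `[x, +oo[) gamma_pdf a 1 u.

Definition gamma_low1 (a x : R) : R := \int[mu]_(u in `[0, x]) gamma_low a u.

Definition gamma_up1 (a x : R) : R := \int[mu]_(u in `[x, +oo[) gamma_up a u.

Definition M_low (a y : R) : R := gamma_low a y / (y * gamma_pdf a 1 y).

Definition M_up (a y : R) : R := gamma_up a y / (y * gamma_pdf a 1 y).

Definition C2 (a z : R) : R :=
  derive1n 2 (M_up a) z * (\int[mu]_(x in `[0, z]) gamma_low1 a x) +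
  derive1n 2 (M_low a) z * (\int[mu]_(x in `[z, +oo[) gamma_up1 a x).

(* Extended-real supremum, so that no junk value enters if boundedness is not
   known; it is finite for a > 0. *)
Definition e_const (a : R) : \bar R :=
  ereal_sup [set (C2 a z)%:E | z in `]0, +oo[].

Definition r_const (alpha : R) : R := expR ((12 * alpha - 11)^-1).

End gamma.

(* Functions on (0, +oo) are represented by total functions on R of which only
   the restriction to (0, +oo) matters. *)
Definition Z1_class (R : realType) : set (R -> R) :=
  [set h : R -> R | forall x : R, 0 < x ->
     [/\ derivable h x 1, {for x, continuous (derive1 h)} & `|derive1 h x| <= 1]].

Definition Z2_class (R : realType) : set (R -> R) :=
  [set h : R -> R | forall x : R, 0 < x ->
     [/\ derivable h x 1, derivable (derive1 h) x 1,
         {for x, continuous (derive1n 2 h)} & `|derive1n 2 h x| <= 1]].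

Section distances.
Context {R : realType} {d1 d2 : measure_display}.
Context {T1 : measurableType d1} {T2 : measurableType d2}.
Variables (P : probability T1 R) (Q : probability T2 R).

(* E[h(X)] for X almost surely positive and h defined on (0, +oo). *)
Definition expect_pos (d : measure_display) (T : measurableType d)
    (P : probability T R) (h : R -> R) (X : T -> R) : \bar R :=
  'E_P[(h \o X) \_ (X @^-1` `]0, +oo[)].

Definition dist_class (F : set (R -> R)) (X : T1 -> R) (Y : T2 -> R) : \bar R :=
  ereal_sup [set `|expect_pos P h X - expect_pos Q h Y|%E | h in F].

Definition dist1 := dist_class (@Z1_class R).

Definition dist2 := dist_class (@Z2_class R).

Definition dist_Kol (X : T1 -> R) (Y : T2 -> R) : \bar R :=
  ereal_sup [set `|P [set w | (X w <= z)%R] - Q [set w | (Y w <= z)%R]|%E |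
             z in [set: R]].

End distances.

(* Main.v *)
(** In units of [2 mu / nu] the trace has the Laplace transform
    [prod_i (1 + beta_i t) ^ (- alpha_i)], where [i = (k, l)], [alpha_i = n_k / 2] and
    [beta_i = (lambda_kl / n_k) / (mu / nu)]; for a Gaussian vector this follows by adding the
    squared coordinates to the exponent one at a time, each step being a rank-one update of the
    covariance.  Differentiating the transform, uniqueness of Laplace transforms yields the
    size-bias identity
      [E (X F(X)) = sum_i alpha_i beta_i E int_0^oo e^(-u) F(X + beta_i u) du].
    With [a = nu / 2] one has [sum_i alpha_i beta_i = sum_i alpha_i beta_i ^ 2 = a], so
    taking [F = f] and [F = f'] and integrating by parts twice in [u] gives
      [E (X f'(X) + (a - X) f(X)) =
         sum_i alpha_i beta_i (1 - beta_i) beta_i E int_0^oo e^(-u) f''(X + beta_i u) du].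
    For [f] the solution of the Stein equation of the Gamma law with test function [h], the right
    side is at most [max_i |beta_i - 1| beta_i * E (X |f''(X)|)] and [|x f''| <= 2 |h'|]; a further
    smoothing step, [|x f'''| <= 2 |h''|] and [|f''| <= C2 |h''|] give the second order bound.  The
    last two rest on explicit formulas for the iterated tails of the Gamma law.
    For the Kolmogorov distance the indicator is replaced by a C^1 spline of width [e] and the
    first order bound is applied to it; the error of the replacement is controlled by the maximum
    of the Gamma density, which Robbins' form of Stirling's formula bounds, and [e] is optimised. *)

(* No Gamma variable is constructed: the trace is known only through its Laplace transform, and the
   normalisation of the Gamma density is read off from the given [U], whose law has total mass 1.
   This fact, [mass1], gives [Gamma_fun] its positivity and the tails their formulas, and it passes
   from [a] to [a + 1], as the Stirling bound requires. In the Stein bounds the solution is written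
   through integrals of h' (then of h'') against the tails; the constants in |f| <= 1, |x f''| <= 2
   and |x f'''| <= 2 come from exact bilinear identities between lower and upper iterated tails. The
   discrepancy is bounded by reading the size-bias identity backwards: the weighted sum of the terms
   E|g(X + beta_i u)| collapses to E(X |g(X)|), where a bound on x g(x) suffices although g may blow
   up at 0. An infinite [e_const] is a case of its own, since its product with a vanishing Delta is
   0. *)
From HB Require Import structures.
Require Import Defs.
From mathcomp Require Import all_boot all_order all_algebra.
From mathcomp Require Import all_classical all_reals all_analysis.
From mathcomp Require Import measurable_realfun ring lra.
Set Implicit Arguments.
Unset Strict Implicit.
Unset Printing Implicit Defensive.
Import Order.TTheory GRing.Theory Num.Theory.
Import numFieldNormedType.Exports.
Local Open Scope classical_set_scope.
Local Open Scope ring_scope.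

(** * Integrals that depend only on a weighted law *)

Section weighted_law.
Context {R : realType} {d : measure_display} {S : measurableType d}.
Local Open Scope ereal_scope.
Import HBNNSimple.

Lemma ge0_integral_weighted_nnsfun {d0} {T : measurableType d0}
    (m : {measure set T -> \bar R}) (w : T -> R) (X : T -> S)
    (h : {nnsfun S >-> R}) :
  measurable_fun setT w -> (forall x, 0 <= w x)%R -> measurable_fun setT X ->
  \int[m]_x ((w x)%:E * (h (X x))%:E) =
  \sum_(k \in range h)
    k%:E * \int[m]_(x in X @^-1` (h @^-1` [set k])) (w x)%:E.
Proof.
move=> mw w0 mX.
have mA k : measurable (X @^-1` (h @^-1` [set k])).
  by rewrite -[X in measurable X]setTI; exact: mX.
pose wA k : T -> \bar R := (EFin \o w) \_ (X @^-1` (h @^-1` [set k])).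
have mwA k : measurable_fun setT (wA k).
  apply/(measurable_restrictT (EFin \o w) (mA k)).1; apply: measurable_funTS.
  exact/measurable_EFinP.
have wA0 k x : 0 <= wA k x.
  by apply: erestrict_ge0 => y _; rewrite lee_fin.
transitivity (\int[m]_x (\sum_(k \in range h) k%:E * wA k x)).
  apply: eq_integral => x _.
  have -> : (h (X x))%:E = \sum_(k \in range h)
      (k * \1_(h @^-1` [set k]) (X x))%:E.
    by rewrite fsumEFin//; congr EFin; rewrite [LHS]fimfunE.
  rewrite ge0_mule_fsumr; last first.
    by move=> k; exact: nnfun_muleindic_ge0.
  apply: eq_fsbigr => k _.
  rewrite EFinM muleCA; congr (_ * _).
  rewrite /wA patchE indicE; case: ifPn => /=.
    by rewrite inE => Hk; rewrite mem_set// mule1.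
  by rewrite notin_setE => Hk; rewrite memNset// mule0.
rewrite ge0_integral_fsum//; last 2 first.
  by move=> k; exact: measurable_funeM.
  move=> k x _; have [k0|k0] := leP 0%R k.
    by rewrite mule_ge0.
  rewrite /wA patchE ifF ?mule0//; apply/negbTE; rewrite notin_setE/= => hk.
  by move: k0; rewrite ltNge -hk fun_ge0.
apply: eq_fsbigr => k; rewrite inE => -[y _ <-].
by rewrite ge0_integralZl_EFin// ?fun_ge0// -?integral_mkcond.
Qed.

(** Both integrals are limits of integrals of simple functions approximating [phi], and on a simple
    function they only see the weighted masses of its level sets. The two maps may live on different
    spaces, and a weight need not be a function of [X]: this covers equality in law, densities, and
    the integration of one factor out of an independent product. *)
Lemma eq_weighted_law {d1 d2} {T1 : measurableType d1} {T2 : measurableType d2}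
    (m1 : {measure set T1 -> \bar R})
    (m2 : {measure set T2 -> \bar R}) (w1 : T1 -> R) (w2 : T2 -> R)
    (X1 : T1 -> S) (X2 : T2 -> S) :
  measurable_fun setT w1 -> measurable_fun setT w2 ->
  (forall x, 0 <= w1 x)%R -> (forall x, 0 <= w2 x)%R ->
  measurable_fun setT X1 -> measurable_fun setT X2 ->
  (forall A, measurable A ->
     \int[m1]_(x in X1 @^-1` A) (w1 x)%:E = \int[m2]_(x in X2 @^-1` A) (w2 x)%:E) ->
  forall phi : S -> \bar R, measurable_fun setT phi -> (forall y, 0 <= phi y) ->
  \int[m1]_x ((w1 x)%:E * phi (X1 x)) = \int[m2]_x ((w2 x)%:E * phi (X2 x)).
Proof.
move=> mw1 mw2 w10 w20 mX1 mX2 H phi mphi phi0.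
pose g := nnsfun_approx measurableT mphi.
have L d0 (T : measurableType d0) (m : {measure set T -> \bar R})
      (w : T -> R) (X : T -> S) :
    measurable_fun setT w -> (forall x, 0 <= w x)%R -> measurable_fun setT X ->
    \int[m]_x ((w x)%:E * phi (X x)) =
    limn (fun n => \int[m]_x ((w x)%:E * (g n (X x))%:E)).
  move=> mw w0 mX; rewrite -monotone_convergence//; last 3 first.
  - move=> n; apply: emeasurable_funM; first exact/measurable_EFinP.
    by apply/measurable_EFinP; exact: measurableT_comp.
  - by move=> n x _; rewrite mule_ge0// lee_fin//; exact: fun_ge0.
  - move=> x _ a b ab; rewrite lee_pmul// ?lee_fin ?fun_ge0//.
    exact/lefP/nd_nnsfun_approx.
  apply: eq_integral => x _; apply/esym/cvg_lim => //.
  apply: cvgeZl => //.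
  by apply: (cvg_nnsfun_approx measurableT) => //; move=> *; exact: phi0.
rewrite !L//; congr (limn _); apply/funext => n.
rewrite !ge0_integral_weighted_nnsfun//.
apply: eq_fsbigr => k _; congr (_ * _); apply: H.
by rewrite -[X in measurable X]setTI; exact: measurable_funP.
Qed.

Lemma eq_law {d1 d2} {T1 : measurableType d1} {T2 : measurableType d2}
    (m1 : {measure set T1 -> \bar R}) (m2 : {measure set T2 -> \bar R})
    (X1 : T1 -> S) (X2 : T2 -> S) :
  measurable_fun setT X1 -> measurable_fun setT X2 ->
  (forall A, measurable A -> m1 (X1 @^-1` A) = m2 (X2 @^-1` A)) ->
  forall phi : S -> \bar R, measurable_fun setT phi -> (forall y, 0 <= phi y) ->
  \int[m1]_x phi (X1 x) = \int[m2]_x phi (X2 x).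
Proof.
move=> mX1 mX2 H phi mphi phi0.
have := @eq_weighted_law _ _ T1 T2 m1 m2 (cst 1%R) (cst 1%R) X1 X2.
move=> /(_ _ _ _ _ _ _ _ _ mphi phi0).
under eq_integral do rewrite mul1e.
move=> E; transitivity (\int[m2]_x ((cst 1%R x)%:E * phi (X2 x))); last first.
  by apply: eq_integral => x _; rewrite mul1e.
apply: E => //.
move=> A mA; have mX1A : measurable (X1 @^-1` A).
  by rewrite -[X in measurable X]setTI; exact: mX1.
have mX2A : measurable (X2 @^-1` A).
  by rewrite -[X in measurable X]setTI; exact: mX2.
have -> : \int[m1]_(x in X1 @^-1` A) (cst 1%R x)%:E = 1 * m1 (X1 @^-1` A).
  by rewrite -(integral_cst m1 mX1A 1%E); apply: eq_integral.
have -> : \int[m2]_(x in X2 @^-1` A) (cst 1%R x)%:E = 1 * m2 (X2 @^-1` A).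
  by rewrite -(integral_cst m2 mX2A 1%E); apply: eq_integral.
by rewrite H.
Qed.

End weighted_law.

(** * The fundamental theorem of calculus on half-lines *)

Section FTC_exhaustion.
Context {R : realType}.
Notation leb := (@lebesgue_measure R).
Variables (f F : R -> R) (D : set R) (u v : nat -> R) (la lb : R).
Hypothesis uv : forall n, u n < v n.
Hypothesis u_ni : nonincreasing_seq u.
Hypothesis v_nd : nondecreasing_seq v.
Hypothesis DE : D = \bigcup_n `[u n, v n]%classic.
Hypothesis dF : forall x, D x -> is_derive x 1 F (f x).
Hypothesis cf : forall x, D x -> {for x, continuous f}.
Hypothesis Fu : F (u n) @[n --> \oo] --> la.
Hypothesis Fv : F (v n) @[n --> \oo] --> lb.

Let DI n : `[u n, v n] `<=` D.
Proof. by move=> x ux; rewrite DE; exists n. Qed.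

Let cfn n : {within `[u n, v n], continuous f}.
Proof.
apply: continuous_in_subspaceT => x; rewrite inE => xuv; apply: cf; exact: (DI xuv).
Qed.

Let mfn n : measurable_fun `[u n, v n] f.
Proof. by apply: subspace_continuous_measurable_fun => //. Qed.

Let mD : measurable D.
Proof. by rewrite DE; apply: bigcupT_measurable => n. Qed.

Let ndD : nondecreasing_seq (fun n => `[u n, v n]%classic).
Proof.
move=> m n mn; apply/subsetPset; apply: subset_itv; rewrite bnd_simp.
  exact: u_ni.
exact: v_nd.
Qed.

Let FTCn n : (\int[leb]_(x in `[u n, v n]) (f x)%:E = (F (v n) - F (u n))%:E)%E.
Proof.
have cF x : D x -> {for x, continuous F}.
  by move=> Dx; apply: differentiable_continuous; apply/derivable1_diffP;
    have [] := dF Dx.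
have cFn : {within `[u n, v n], continuous F}.
  by apply: continuous_in_subspaceT => x; rewrite inE => xuv; apply/cF/(DI xuv).
rewrite (@continuous_FTC2 _ f F)//.
- by split => [x xuv||]; [have [] := dF (DI (subset_itv_oo_cc xuv))|
    have /continuous_within_itvP := cFn; move=> /(_ (uv n))[]..].
- move=> x xuv; rewrite derive1E.
  by have [_ ->] := dF (DI (subset_itv_oo_cc xuv)).
Qed.

Let lim_FTC : (F (v n) - F (u n))%:E @[n --> \oo] --> (lb - la)%:E.
Proof. by apply: cvg_EFin; [exact: nearW|apply: cvgB]. Qed.

Lemma ge0_FTC_exhaustion : (forall x, D x -> 0 <= f x) ->
  (\int[leb]_(x in D) (f x)%:E = (lb - la)%:E)%E.
Proof.
move=> f0; apply/(cvg_unique _ _ lim_FTC) => //=.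
under eq_cvg do rewrite -FTCn.
rewrite DE; apply: ge0_nondecreasing_set_cvg_integral => //.
- by move=> n; apply/measurable_EFinP; exact: mfn.
- by move=> n x /DI Dx; rewrite lee_fin f0.
Qed.

(** The monotone argument is applied to the positive and the negative part; integrability excludes a
    difference of infinities in the limit. *)
Lemma FTC_exhaustion : leb.-integrable D (EFin \o f) ->
  (\int[leb]_(x in D) (f x)%:E = (lb - la)%:E)%E.
Proof.
move=> fi; apply/(cvg_unique _ _ lim_FTC) => //=.
under eq_cvg do rewrite -FTCn integralE.
rewrite integralE; apply: cvgeB.
- apply: fin_num_adde_defl; rewrite fin_numN.
  by apply: integrable_neg_fin_num => //; exact: mD.
- rewrite DE; apply: ge0_nondecreasing_set_cvg_integral => //.
  by move=> n; apply: measurable_funepos; apply/measurable_EFinP; exact: mfn.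
- rewrite DE; apply: ge0_nondecreasing_set_cvg_integral => //.
  by move=> n; apply: measurable_funeneg; apply/measurable_EFinP; exact: mfn.
Qed.

End FTC_exhaustion.

Section FTC_corollaries.
Context {R : realType}.
Notation leb := (@lebesgue_measure R).
Implicit Types f F : R -> R.

Let invn_ni (c : R) : 0 < c -> nonincreasing_seq (fun n => c / n.+1%:R).
Proof.
by move=> c0 m n mn; rewrite ler_pM2l// lef_pV2 ?posrE// ler_nat ltnS.
Qed.

Let invn_cvg (c : R) : c / n.+1%:R @[n --> \oo] --> 0.
Proof.
rewrite -[X in _ --> X](mulr0 c); apply: cvgM; first exact: cvg_cst.
exact: cvg_harmonic.
Qed.

Let invn_right F (la c : R) : 0 < c -> F x @[x --> (0:R)^'+] --> la ->
  F (c / n.+1%:R) @[n --> \oo] --> la.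
Proof.
by move=> c0 /cvg_at_rightP; apply; split => [n|]; [rewrite divr_gt0|exact: invn_cvg].
Qed.

Let addn_cvgy (c : R) : c + n%:R @[n --> \oo] --> +oo%R.
Proof.
apply/cvgryPge => r; near=> n; rewrite -lerBlDl; near: n; exact: nbhs_infty_ger.
Unshelve. all: by end_near. Qed.

Let addn_pinfty F (lb c : R) : F x @[x --> +oo%R] --> lb ->
  F (c + n%:R) @[n --> \oo] --> lb.
Proof. by move=> /cvg_pinftyP; apply; exact: addn_cvgy. Qed.

Let bigcup_itv0y :
  `]0, +oo[%classic = \bigcup_n `[1 / n.+1%:R, 1 + n.+1%:R : R]%classic.
Proof.
apply/seteqP; split => [x|x [n _]] /=; rewrite in_itv/= ?andbT.
  move=> x0; pose n := maxn (Num.truncn x^-1) (Num.truncn x); exists n => //.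
  rewrite /= in_itv/=; apply/andP; split.
    rewrite ler_pdivrMr// -ler_pdivrMl// mulr1 ltW//.
    apply: (lt_le_trans (truncnS_gt _)).
    by rewrite ler_nat ltnS leq_maxl.
  rewrite ltW//; apply: (lt_le_trans (truncnS_gt _)).
  by rewrite (@le_trans _ _ n.+1%:R)// ?ler_nat ?ltnS ?leq_maxr// lerDr.
by rewrite !in_itv/= andbT => /andP[H _]; apply: lt_le_trans H; rewrite divr_gt0.
Qed.

Let bigcup_itv0x (x : R) : 0 < x ->
  `]0, x]%classic = \bigcup_n `[x / 2 / n.+1%:R, x]%classic.
Proof.
move=> x0; apply/seteqP; split => [y|y [n _]] /=; rewrite in_itv/=.
  move=> /andP[y0 yx]; exists (Num.truncn (x / y)) => //=; rewrite in_itv/= yx andbT.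
  rewrite ler_pdivrMr//; apply: (@le_trans _ _ x); first lra.
  by rewrite -ler_pdivrMl// mulrC ltW// truncnS_gt.
by rewrite !in_itv/= => /andP[H ->]; rewrite andbT; apply: lt_le_trans H; rewrite !divr_gt0.
Qed.

Let bigcup_itvxy (x : R) :
  `[x, +oo[%classic = \bigcup_n `[x, x + n.+1%:R]%classic.
Proof.
apply/seteqP; split => [y|y [n _]] /=; rewrite in_itv/= ?andbT.
  move=> xy; exists (Num.truncn (y - x)) => //=; rewrite in_itv/= xy/=.
  by rewrite -lerBlDl ltW// truncnS_gt.
by rewrite !in_itv/= andbT => /andP[].
Qed.

Let bigcup_T : [set: R] = \bigcup_n `[- n.+1%:R, n.+1%:R]%classic.
Proof.
apply/seteqP; split => // y _.
exists (Num.truncn `|y|) => //=; rewrite in_itv/= -ler_norml ltW// truncnS_gt//.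
Qed.

Section itv0y.
Variables (f F : R -> R) (la lb : R).
Hypothesis dF : forall x : R, 0 < x -> is_derive x 1 F (f x).
Hypothesis cf : forall x : R, 0 < x -> {for x, continuous f}.
Hypothesis F0 : F x @[x --> (0:R)^'+] --> la.
Hypothesis Fy : F x @[x --> +oo%R] --> lb.

Let S : (forall x : R, 0 < x -> 0 <= f x) \/ leb.-integrable `]0, +oo[ (EFin \o f) ->
  (\int[leb]_(x in `]0%R, +oo[) (f x)%:E = (lb - la)%:E)%E.
Proof.
have H0 := invn_right ltr01 F0.
have H1 : F (1 + n.+1%:R) @[n --> \oo] --> lb.
  by have := addn_pinfty 1 Fy; rewrite -cvg_shiftS.
have u1 n : 1 / n.+1%:R < 1 + n.+1%:R :> R.
  rewrite (@le_lt_trans _ _ 1)// ?ltrDl//.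
  by rewrite ler_pdivrMr// mul1r ler1n.
have v1 : nondecreasing_seq (fun n => 1 + n.+1%:R : R).
  by move=> m n mn; rewrite lerD2l ler_nat ltnS.
have D0 x : (`]0, +oo[%classic : set R) x -> 0 < x.
  by rewrite /= in_itv/= andbT.
move=> [f0|fi].
- apply: (ge0_FTC_exhaustion u1 (invn_ni ltr01) v1 bigcup_itv0y _ _ H0 H1) => x /D0.
  + exact: dF.
  + exact: cf.
  + exact: f0.
- apply: (FTC_exhaustion u1 (invn_ni ltr01) v1 bigcup_itv0y _ _ H0 H1) => // x /D0.
  + exact: dF.
  + exact: cf.
Qed.

Lemma ge0_FTC_itv0y : (forall x : R, 0 < x -> 0 <= f x) ->
  (\int[leb]_(x in `]0%R, +oo[) (f x)%:E = (lb - la)%:E)%E.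
Proof. by move=> f0; apply: S; left. Qed.

Lemma FTC_itv0y : leb.-integrable `]0, +oo[ (EFin \o f) ->
  (\int[leb]_(x in `]0%R, +oo[) (f x)%:E = (lb - la)%:E)%E.
Proof. by move=> f0; apply: S; right. Qed.
End itv0y.

Section itv0x.
Variables (f F : R -> R) (la y : R).
Hypothesis y0 : 0 < y.
Hypothesis dF : forall x : R, 0 < x -> is_derive x 1 F (f x).
Hypothesis cf : forall x : R, 0 < x -> {for x, continuous f}.
Hypothesis F0 : F x @[x --> (0:R)^'+] --> la.

Lemma ge0_FTC_itv0x : (forall x : R, 0 < x -> 0 <= f x) ->
  (\int[leb]_(x in `]0%R, y]) (f x)%:E = (F y - la)%:E)%E.
Proof.
move=> f0.
have y20 : 0 < y / 2 by rewrite divr_gt0.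
have H0 := invn_right y20 F0.
have u1 n : y / 2 / n.+1%:R < y :> R.
  rewrite (@le_lt_trans _ _ (y / 2))//; last lra.
  by rewrite ler_pdivrMr// ler_peMr// ?ler1n// ltW.
have D0 x : (`]0, y]%classic : set R) x -> 0 < x.
  by rewrite /= in_itv/= => /andP[].
apply: (ge0_FTC_exhaustion u1 (invn_ni y20) _ (bigcup_itv0x y0) _ _ H0 (cvg_cst _)) => // x /D0.
- exact: dF.
- exact: cf.
- exact: f0.
Qed.
End itv0x.

Section itvxy.
Variables (f F : R -> R) (y lb : R).
Hypothesis dF : forall x, y <= x -> is_derive x 1 F (f x).
Hypothesis cf : forall x, y <= x -> {for x, continuous f}.
Hypothesis Fy : F x @[x --> +oo%R] --> lb.

Let S : (forall x, y <= x -> 0 <= f x) \/ leb.-integrable `[y, +oo[ (EFin \o f) ->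
  (\int[leb]_(x in `[y, +oo[) (f x)%:E = (lb - F y)%:E)%E.
Proof.
have H1 : F (y + n.+1%:R) @[n --> \oo] --> lb.
  by have := addn_pinfty y Fy; rewrite -cvg_shiftS.
have u1 n : y < y + n.+1%:R by rewrite ltrDl.
have v1 : nondecreasing_seq (fun n => y + n.+1%:R : R).
  by move=> m n mn; rewrite lerD2l ler_nat ltnS.
have u0 : nonincreasing_seq (fun=> y : R) by [].
have D0 x : (`[y, +oo[%classic : set R) x -> y <= x.
  by rewrite /= in_itv/= andbT.
move=> [f0|fi].
- apply: (ge0_FTC_exhaustion u1 u0 v1 (bigcup_itvxy y) _ _ (cvg_cst _) H1) => x /D0.
  + exact: dF.
  + exact: cf.
  + exact: f0.
- apply: (FTC_exhaustion u1 u0 v1 (bigcup_itvxy y) _ _ (cvg_cst _) H1) => // x /D0.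
  + exact: dF.
  + exact: cf.
Qed.

Lemma ge0_FTC_itvxy : (forall x, y <= x -> 0 <= f x) ->
  (\int[leb]_(x in `[y, +oo[) (f x)%:E = (lb - F y)%:E)%E.
Proof. by move=> f0; apply: S; left. Qed.

End itvxy.

Lemma FTC_T f F (la lb : R) :
  (forall x : R, is_derive x 1 F (f x)) -> continuous f ->
  F (- n.+1%:R) @[n --> \oo] --> la -> F n.+1%:R @[n --> \oo] --> lb ->
  leb.-integrable setT (EFin \o f) ->
  (\int[leb]_x (f x)%:E = (lb - la)%:E)%E.
Proof.
move=> dF cf H0 H1 fi.
have u1 n : - n.+1%:R < n.+1%:R :> R by rewrite gtrN.
have v1 : nondecreasing_seq (fun n => n.+1%:R : R).
  by move=> m n mn; rewrite ler_nat ltnS.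
have u0 : nonincreasing_seq (fun n => - n.+1%:R : R).
  by move=> m n mn; rewrite lerN2 ler_nat ltnS.
apply: (FTC_exhaustion u1 u0 v1 bigcup_T _ _ H0 H1) => // x _; exact: cf.
Qed.

End FTC_corollaries.

(** * Uniqueness of Laplace transforms *)

Section laplace_uniqueness.
Context {R : realType}.
Implicit Types x y z t : R.

Lemma ler_bernoulli (t : R) n : t <= 1 -> 1 - n%:R * t <= (1 - t) ^+ n.
Proof.
move=> t1; elim: n => [|n IH]; first by rewrite mul0r subr0 expr0.
rewrite exprS; have [nt1|nt1] := leP (n%:R * t) 1; last first.
  have t0 : 0 < t by rewrite ltNge; apply/negP => t0; move: nt1;
    rewrite ltNge (le_trans (mulr_ge0_le0 _ t0))//.
  rewrite (@le_trans _ _ 0)//; last by rewrite mulr_ge0// ?exprn_ge0// subr_ge0.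
  rewrite subr_le0 -natr1 mulrDl mul1r; lra.
apply: (@le_trans _ _ ((1 - t) * (1 - n%:R * t))); last first.
  by rewrite ler_wpM2l// subr_ge0.
rewrite -natr1 -subr_ge0.
rewrite (_ : _ - _ = n%:R * t ^+ 2); last by ring.
by rewrite mulr_ge0// sqr_ge0.
Qed.

(** Quadratic decay is the right strength: in [laplace_cut_ge] it has to beat a factor of order
    n. *)
Lemma expRN_le (t : R) : 0 <= t -> expR (- t) <= (1 + t / 2) ^- 2.
Proof.
move=> t0; rewrite expRN lef_pV2 ?posrE ?expR_gt0 ?exprn_gt0//; last lra.
have -> : expR t = expR (t / 2) ^+ 2.
  by rewrite -expRM_natl; congr expR; field.
have H := expR_ge1Dx (t / 2).
by rewrite lerXn2r// ?nnegrE; lra.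
Qed.

(* [laplace_cut z n x = (1 - e^(-n x))^N] with [N] about [n e^(n z)]: a
   polynomial in [e^(-x)] which tends to the indicator of [x > z] on x >= 0. *)
Definition laplace_cut_exponent z n : nat :=
  (Num.truncn (n%:R * expR (n%:R * z))).+1.

Definition laplace_cut_poly z n : {poly R} :=
  (1 - 'X^n) ^+ laplace_cut_exponent z n.

Let cutE z n x : (laplace_cut_poly z n).[expR (- x)] =
  (1 - expR (- (n%:R * x))) ^+ laplace_cut_exponent z n.
Proof.
by rewrite /laplace_cut_poly !hornerE/= -expRM_natl mulrN.
Qed.

Lemma laplace_cut_itv z n x : 0 <= x ->
  0 <= (laplace_cut_poly z n).[expR (- x)] <= 1.
Proof.
move=> x0; rewrite cutE.
have H : 0 <= 1 - expR (- (n%:R * x)) <= 1.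
  rewrite subr_ge0 -expR0 ler_expR oppr_le0 mulr_ge0//= lerBlDr lerDl.
  exact: expR_ge0.
by move/andP: H => [H0 H1]; rewrite exprn_ge0// exprn_ile1.
Qed.

(** With v = e^(-n x), (1 - v)^N <= e^(-N v), and N v is at least n e^(n (z - x)) >= n. *)
Lemma laplace_cut_le z n x : 0 <= x -> x <= z ->
  (laplace_cut_poly z n).[expR (- x)] <= expR (- n%:R).
Proof.
move=> x0 xz; rewrite cutE; set N := laplace_cut_exponent z n.
have H : 0 <= 1 - expR (- (n%:R * x)).
  by rewrite subr_ge0 -[leRHS]expR0 ler_expR oppr_le0 mulr_ge0.
apply: (@le_trans _ _ (expR (- expR (- (n%:R * x))) ^+ N)).
  by rewrite lerXn2r ?nnegrE ?expR_ge0//; exact: expR_ge1Dx.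
rewrite -expRM_natl ler_expR mulrN lerN2.
apply: (@le_trans _ _ (n%:R * expR (n%:R * z) * expR (- (n%:R * x)))).
  rewrite -mulrA -expRD ler_peMr//.
  by rewrite -expR0 ler_expR -mulrN -mulrDr mulr_ge0// subr_ge0.
by rewrite ler_wpM2r ?expR_ge0// /N ltW// truncnS_gt.
Qed.

(** By Bernoulli the defect is at most N e^(-n x), and N <= (n + 1) e^(n z), so that a decay in n (x
    - z) remains. *)
Lemma laplace_cut_ge z n x : 0 <= z -> z < x ->
  1 - (n.+1%:R * (1 + n%:R * (x - z) / 2) ^- 2) <=
  (laplace_cut_poly z n).[expR (- x)].
Proof.
move=> z0 zx; rewrite cutE; set N := laplace_cut_exponent z n.
have x0 : 0 <= x by lra.
have t1 : expR (- (n%:R * x)) <= 1.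
  by rewrite -[leRHS]expR0 ler_expR oppr_le0 mulr_ge0.
apply: le_trans (ler_bernoulli _ t1); rewrite lerD2l lerN2.
apply: (@le_trans _ _ (n.+1%:R * expR (n%:R * z) * expR (- (n%:R * x)))).
  rewrite ler_wpM2r ?expR_ge0// /N /laplace_cut_exponent -natr1 -[in leRHS]natr1.
  rewrite mulrDl mul1r; apply: lerD.
    by rewrite truncn_le// mulr_ge0// expR_ge0.
  by rewrite -[leLHS]expR0 ler_expR mulr_ge0.
rewrite -mulrA ler_wpM2l// -expRD -mulrN -mulrDr -[z - x]opprB mulrN.
by apply: expRN_le; rewrite mulr_ge0// subr_ge0 ltW.
Qed.

Lemma laplace_cut_cvg z x : 0 <= z -> 0 <= x ->
  (laplace_cut_poly z n).[expR (- x)] @[n --> \oo] --> (\1_`]z, +oo[ x : R).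
Proof.
move=> z0 x0; rewrite indicE; have [xz|zx] := leP x z.
  rewrite memNset/=; last by rewrite in_itv/= andbT; apply/negP; rewrite -leNgt.
  apply: (@squeeze_cvgr _ _ _ _ (cst 0) (fun n => (harmonic n : R))).
  - apply: nearW => n; have /andP[-> _]/= := laplace_cut_itv z n x0.
    apply: (le_trans (laplace_cut_le n x0 xz)).
    rewrite expRN lef_pV2 ?posrE ?expR_gt0// -natr1 addrC; exact: expR_ge1Dx.
  - exact: cvg_cst.
  - exact: cvg_harmonic.
rewrite mem_set/=; last by rewrite in_itv/= zx.
(* This [k] satisfies k (n + 1) <= 1 + n (x - z) / 2, which bounds the defect by a multiple of the
   harmonic sequence. *)
pose k : R := Num.min 1 ((x - z) / 2).
have k0 : 0 < k by rewrite lt_min ltr01 divr_gt0// subr_gt0.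
apply: (@squeeze_cvgr _ _ _ _ (fun n => 1 - k ^- 2 * harmonic n) (cst 1)).
- apply: nearW => n; have /andP[_ ->] := laplace_cut_itv z n x0.
  rewrite andbT; apply: le_trans (laplace_cut_ge n z0 zx).
  rewrite lerD2l lerN2 /harmonic/=.
  have H : k * n.+1%:R <= 1 + n%:R * (x - z) / 2.
    rewrite -natr1 mulrDr mulr1 addrC; apply: lerD; first by rewrite ge_min lexx.
    by rewrite mulrC -mulrA ler_wpM2l// ge_min lexx orbT.
  have H2 : 0 < k * n.+1%:R by rewrite mulr_gt0.
  apply: (@le_trans _ _ (n.+1%:R * (k * n.+1%:R) ^- 2)).
    rewrite ler_wpM2l// lef_pV2 ?posrE ?exprn_gt0//; last exact: lt_le_trans H.
    by rewrite lerXn2r ?nnegrE// ltW// (lt_le_trans H2).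
  have E (N : R) : N != 0 -> N * (k * N) ^- 2 = k ^- 2 * N^-1.
    by move=> N0; field; rewrite N0 gt_eqF.
  by rewrite E// pnatr_eq0.
- rewrite -[X in _ --> X]subr0 -[X in _ --> _ - X](mulr0 (k ^- 2)).
  apply: cvgB; first exact: cvg_cst.
  by apply: cvgM; [exact: cvg_cst|exact: cvg_harmonic].
- exact: cvg_cst.
Qed.

Local Notation mR := (measurableTypeR R).
Variables m1 m2 : {finite_measure set mR -> \bar R}.
Local Notation D := (`[0, +oo[%classic : set mR).

Let mexpk (i : nat) : measurable_fun D (fun x : mR => expR (- x) ^+ i).
Proof.
apply: measurable_funX; apply: measurable_funTS.
by apply: measurableT_comp => //; exact: oppr_measurable.
Qed.

Let intexpk (m : {finite_measure set mR -> \bar R}) (i : nat) :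
  m.-integrable D (fun x => (expR (- x) ^+ i)%:E).
Proof.
apply: measurable_bounded_integrable => //.
  by rewrite ltey_eq fin_num_measure.
exists 1; split => // M M1 x; rewrite /= in_itv/= andbT => x0.
rewrite ger0_norm ?exprn_ge0 ?expR_ge0//; apply: (le_trans _ (ltW M1)).
by rewrite exprn_ile1 ?expR_ge0// -expR0 ler_expR oppr_le0.
Qed.

Let int_horner (m : {finite_measure set mR -> \bar R}) (p : {poly R}) :
  (\int[m]_(x in D) (p.[expR (- x)])%:E =
   \sum_(i < size p) (p`_i)%:E * \int[m]_(x in D) (expR (- x) ^+ i)%:E)%E.
Proof.
transitivity (\int[m]_(x in D) (\sum_(i < size p) (p`_i)%:E * (expR (- x) ^+ i)%:E)%E)%E.
  apply: eq_integral => x _; rewrite horner_coef -sumEFin.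
  by apply: eq_bigr => i _; rewrite EFinM.
rewrite integral_sum//; last first.
  by move=> i; apply: integrableZl => //; exact: intexpk.
by apply: eq_bigr => i _; rewrite integralZl//; exact: intexpk.
Qed.

Hypothesis m1N : m1 `]-oo, 0[%classic = 0%E.
Hypothesis m2N : m2 `]-oo, 0[%classic = 0%E.
Hypothesis m12 : forall k : nat,
  (\int[m1]_(x in D) (expR (- x) ^+ k)%:E = \int[m2]_(x in D) (expR (- x) ^+ k)%:E)%E.

(** Dominated convergence with the constant 1. Each term is a linear combination of integrals of
    e^(-k x), and the limit is the mass of a ray. *)
Let int_cut (m : {finite_measure set mR -> \bar R}) z : 0 <= z ->
  (\int[m]_(x in D) ((laplace_cut_poly z n).[expR (- x)])%:E)%E @[n --> \oo] -->
  m `]z, +oo[%classic.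
Proof.
move=> z0.
have -> : m `]z, +oo[%classic = (\int[m]_(x in D) (\1_`]z, +oo[ x)%:E)%E.
  rewrite integral_indic// setIidl// => x /=; rewrite !in_itv/= !andbT => zx.
  by rewrite (le_trans z0)// ltW.
apply: (@dominated_cvg _ _ _ m D _ _ _ (cst 1%E)) => //.
- move=> n; apply/measurable_EFinP.
  apply: (eq_measurable_fun (fun x : mR => \sum_(i < size (laplace_cut_poly z n))
     (laplace_cut_poly z n)`_i * expR (- x) ^+ i)) => [x _|].
    by rewrite horner_coef.
  by apply: measurable_sum => i; apply: measurable_funM => //; exact: mexpk.
- move=> x; rewrite /= in_itv/= andbT => x0; apply: cvg_EFin; first exact: nearW.
  exact: laplace_cut_cvg.
- exact: (finite_measure_integrable_cst m 1).
- move=> n x; rewrite /= in_itv/= andbT => x0.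
  have /andP[H0 H1] := laplace_cut_itv z n x0.
  by rewrite lee_fin ger0_norm.
Qed.

Let eq_ray_ge0 z : 0 <= z -> m1 `]z, +oo[%classic = m2 `]z, +oo[%classic.
Proof.
move=> z0; rewrite -(cvg_lim _ (@int_cut m1 z z0))// -(cvg_lim _ (@int_cut m2 z z0))//.
by congr (limn _); apply/funext => n; rewrite !int_horner; apply: eq_bigr => i _; rewrite m12.
Qed.

Let eq_D : m1 D = m2 D.
Proof.
have := m12 0; under eq_integral do rewrite expr0.
under [RHS]eq_integral do rewrite expr0.
by rewrite !integral_cst// !mul1e.
Qed.

Let ray_lt0 (m : {finite_measure set mR -> \bar R}) z :
  m `]-oo, 0[%classic = 0%E -> z < 0 -> m `]z, +oo[%classic = m D.
Proof.
move=> mN z0; have -> : `]z, +oo[%classic = `]z, 0[%classic `|` D :> set R.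
  apply/seteqP; split => x /=; rewrite !in_itv/= ?andbT.
    by move=> ->/=; have [_|_] := leP 0 x; [right|left].
  by move=> [/andP[]//|]; exact: lt_le_trans.
rewrite measureU//; last first.
  rewrite -subset0 => x [] /=; rewrite !in_itv/= andbT => /andP[_ H].
  by rewrite leNgt H.
transitivity (0 + m D)%E; last by rewrite add0e.
congr (_ + _)%E.
apply/eqP; rewrite eq_le measure_ge0 andbT -mN.
by apply: le_measure; rewrite ?inE//; apply: subset_itvr; rewrite bnd_simp.
Qed.

(** Open rays form a generating class closed under intersection. For z >= 0 their masses are limits
    of integrals of polynomials in e^(-x), on which the two measures agree; for z < 0 they reduce to
    the mass of [0, +oo[. *)
Lemma laplace_unique (A : set mR) : measurable A -> m1 A = m2 A.
Proof.
apply: (@measure_unique _ _ mR (@RGenOInfty.G R) (fun n => `]- n%:R, +oo[%classic)).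
- exact: RGenOInfty.measurableE.
- move=> _ _ [x ->] [y ->]; exists (Num.max x y).
  apply/seteqP; split => t /=; rewrite !in_itv/= !andbT gt_max.
    by move=> [-> ->].
  by move=> /andP[].
- by move=> i; exists (- i%:R).
- apply/seteqP; split => // x _; exists (Num.truncn (`|x|)).+1 => //=.
  rewrite in_itv/= andbT ltrNl; apply: le_lt_trans (truncnS_gt _).
  by rewrite -normrN ler_norm.
- move=> _ [x ->]; have [x0|x0] := leP 0 x; first exact: eq_ray_ge0.
  transitivity (m1 D); first exact: ray_lt0.
  by transitivity (m2 D); [exact: eq_D|symmetry; exact: ray_lt0].
- by move=> k; rewrite ltey_eq fin_num_measure.
Qed.

End laplace_uniqueness.

(** * Derivatives of real functions, computed by the tactic [rderive] *)

Section real_derivatives.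
Context {R : realType}.
Implicit Types (f g : R -> R) (x a b c : R).

Lemma rderive_eq f x a b : is_derive x 1 f a -> a = b -> is_derive x 1 f b.
Proof. by move=> h <-. Qed.

Lemma rderive_cst c x : is_derive x 1 (fun=> c) 0.
Proof. exact: is_derive_cst. Qed.

Lemma rderive_id x : is_derive x 1 (fun y : R => y) 1.
Proof. exact: is_derive_id. Qed.

Lemma rderiveD f g x a b : is_derive x 1 f a -> is_derive x 1 g b ->
  is_derive x 1 (fun y => f y + g y) (a + b).
Proof. by move=> df dg; exact: is_deriveD. Qed.

Lemma rderiveB f g x a b : is_derive x 1 f a -> is_derive x 1 g b ->
  is_derive x 1 (fun y => f y - g y) (a - b).
Proof. by move=> df dg; exact: is_deriveB. Qed.

Lemma rderiveN f x a : is_derive x 1 f a -> is_derive x 1 (fun y => - f y) (- a).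
Proof. by move=> df; exact: is_deriveN. Qed.

Lemma rderiveM f g x a b : is_derive x 1 f a -> is_derive x 1 g b ->
  is_derive x 1 (fun y => f y * g y) (a * g x + f x * b).
Proof.
move=> df dg; apply: rderive_eq (is_deriveM df dg) _.
by rewrite addrC; congr (_ + _); exact: mulrC.
Qed.

Lemma rderiveX f x a n : is_derive x 1 f a ->
  is_derive x 1 (fun y => f y ^+ n) (n%:R * f x ^+ n.-1 * a).
Proof. move=> df; rewrite (_ : (fun y => f y ^+ n) = f ^+ n); last first.
  by apply/funext => y; rewrite fctE.
exact: is_deriveX. Qed.

Lemma rderive_comp f g x a b : is_derive x 1 f a -> is_derive (f x) 1 g b ->
  is_derive x 1 (fun y => g (f y)) (b * a).
Proof.
by move=> df dg; exact: (@is_derive1_comp _ g f x b a).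
Qed.

Lemma rderiveV f x a : f x != 0 -> is_derive x 1 f a ->
  is_derive x 1 (fun y => (f y)^-1) (- a / f x ^+ 2).
Proof.
move=> fx0 df; apply: rderive_eq (is_deriveV fx0 df) _.
by rewrite /GRing.scale/= mulNr mulrC mulNr.
Qed.

Lemma rderive_expR f x a : is_derive x 1 f a ->
  is_derive x 1 (fun y => expR (f y)) (expR (f x) * a).
Proof. by move=> df; apply: (rderive_comp df); exact: is_derive_expR. Qed.

Lemma rderive_sin f x a : is_derive x 1 f a ->
  is_derive x 1 (fun y => sin (f y)) (cos (f x) * a).
Proof. by move=> df; apply: (rderive_comp df); exact: is_derive_sin. Qed.

Lemma rderive_cos f x a : is_derive x 1 f a ->
  is_derive x 1 (fun y => cos (f y)) (- sin (f x) * a).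
Proof. by move=> df; apply: (rderive_comp df); exact: is_derive_cos. Qed.

Lemma rderive_ln f x a : 0 < f x -> is_derive x 1 f a ->
  is_derive x 1 (fun y => ln (f y)) ((f x)^-1 * a).
Proof. by move=> fx0 df; apply: (rderive_comp df); exact: is_derive1_ln. Qed.

Lemma rderive_continuous f x a : is_derive x 1 f a -> {for x, continuous f}.
Proof.
by move=> [df _]; apply: differentiable_continuous; exact/derivable1_diffP.
Qed.

Lemma rderive1E f x a : is_derive x 1 f a -> f^`()%classic x = a.
Proof. by move=> [_ <-]; rewrite derive1E. Qed.

Lemma near_rderive f g x a : (\forall y \near x, f y = g y) ->
  is_derive x 1 f a -> is_derive x 1 g a.
Proof. by move=> fg; apply: near_eq_is_derive => //; rewrite oner_neq0. Qed.

Lemma near_gt0 (x : R) : 0 < x -> \forall y \near x, 0 < y.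
Proof. exact: lt_nbhsr. Qed.

End real_derivatives.

(** [eassumption] precedes the structural rules, so that derivatives recorded in the context serve
    for functions that should stay folded. The goals left are the side conditions and the equality
    between the computed derivative and the announced one. *)
Ltac rderive_step := first
  [ notypeclasses refine (rderive_cst _ _) | notypeclasses refine (rderive_id _)
  | eassumption
  | notypeclasses refine (rderiveD _ _) | notypeclasses refine (rderiveB _ _)
  | notypeclasses refine (rderiveN _) | notypeclasses refine (rderiveM _ _)
  | notypeclasses refine (rderiveX _ _) | notypeclasses refine (rderive_expR _)
  | notypeclasses refine (rderive_sin _) | notypeclasses refine (rderive_cos _)
  | notypeclasses refine (rderive_ln _ _) | notypeclasses refine (rderiveV _ _) ].
Ltac rderive := notypeclasses refine (rderive_eq _ _); [repeat rderive_step|rewrite /=].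

(** * Integrals of bounded functions *)

Section bounded_integrals.
Context {R : realType} {d : measure_display} {T : measurableType d}.

Lemma bounded_integrable (m : {finite_measure set T -> \bar R}) (f : T -> R) (M : R) :
  measurable_fun setT f -> (forall x, `|f x| <= M) ->
  m.-integrable setT (fun x => (f x)%:E).
Proof.
move=> mf fM; apply: measurable_bounded_integrable => //.
  by rewrite ltey_eq fin_num_measure.
exists M; split; first exact: num_real.
by move=> N MN x _; apply: (le_trans (fM x)); exact: ltW.
Qed.

Arguments bounded_integrable {m f}.

Lemma bounded_Fubini {d'} {S : measurableType d'} (P : probability T R)
    (Q : probability S R) (f : T -> S -> R) (M : R) :
  measurable_fun setT (fun z : T * S => f z.1 z.2) ->
  (forall x y, `|f x y| <= M) ->
  \int[P]_x (\int[Q]_y f x y) = \int[Q]_y (\int[P]_x f x y).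
Proof.
move=> mf fM.
have mfx x : measurable_fun setT (f x).
  exact: (measurableT_comp mf (pair1_measurable x)).
have mfy y : measurable_fun setT (f ^~ y).
  exact: (measurableT_comp mf (pair2_measurable y)).
have M0 : 0 <= M by rewrite (le_trans _ (fM point point)).
have fi : (P \x Q)%E.-integrable setT (EFin \o (fun z : T * S => f z.1 z.2)).
  apply/integrable12ltyP; first exact/measurable_EFinP.
  apply: (@le_lt_trans _ _ (\int[P]_x (cst M%:E x))%E); last first.
    by rewrite integral_cst//= probability_setT mule1 ltry.
  apply: ge0_le_integral => //.
  - by move=> x _; exact: integral_ge0.
  - apply: (measurable_fun_fubini_tonelli_F (fun z : T * S => `|(f z.1 z.2)%:E|%E)) => //.
    by apply: measurableT_comp => //; exact/measurable_EFinP.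
  - move=> x _; apply: (@le_trans _ _ (\int[Q]_y (cst M%:E y))%E); last first.
      by rewrite integral_cst//= probability_setT mule1.
    apply: ge0_le_integral => //.
    + by apply: measurableT_comp => //; apply/measurable_EFinP; exact: mfx.
    + by move=> y _; rewrite /= lee_fin.
have H1 x : (\int[Q]_y (f x y)%:E)%E = (\int[Q]_y f x y)%:E.
  rewrite /Rintegral fineK//; apply: integrable_fin_num => //.
  apply: (@measurable_bounded_integrable _ _ _ Q) => //.
    by rewrite ltey_eq fin_num_measure.
  exists M; split; first exact: num_real.
  by move=> N MN y _; apply: (le_trans (fM x y)); exact: ltW.
have H2 y : (\int[P]_x (f x y)%:E)%E = (\int[P]_x f x y)%:E.
  rewrite /Rintegral fineK//; apply: integrable_fin_num => //.
  by apply: (bounded_integrable M).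
have := Fubini fi; rewrite /=.
under eq_integral do rewrite H1.
under [in X in _ = X -> _]eq_integral do rewrite H2.
by move=> /(congr1 fine).
Qed.

End bounded_integrals.

(** * Laplace transform of the trace of a Wishart matrix *)

Section normal_integrals.
Context {R : realType}.
Notation leb := (@lebesgue_measure R).
Local Notation mR := (measurableTypeR R).

Lemma ge0_integral_density {d} {T : measurableType d}
    (m : {measure set T -> \bar R}) (X : T -> mR) (p : R -> R) :
  measurable_fun setT X -> measurable_fun setT (p : mR -> mR) -> (forall x, 0 <= p x) ->
  (forall A : set mR, measurable A -> m (X @^-1` A) = \int[leb]_(x in A) (p x)%:E)%E ->
  forall phi : mR -> \bar R, measurable_fun setT phi -> (forall y, 0 <= phi y)%E ->
  (\int[m]_x phi (X x) = \int[leb]_x ((p x)%:E * phi x))%E.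
Proof.
move=> mX mp p0 H phi mphi phi0.
rewrite -(@eq_weighted_law _ _ mR _ _ T mR m leb (cst 1) p X id)//.
  by apply: eq_integral => x _; rewrite mul1e.
move=> A mA; rewrite -H//.
have mXA : measurable (X @^-1` A) by rewrite -[X in measurable X]setTI; exact: mX.
by rewrite -[RHS]mul1e -(integral_cst m mXA 1%E).
Qed.

Lemma ge0_integral_normal_prob (s : R) (phi : mR -> \bar R) :
  measurable_fun setT phi -> (forall y, 0 <= phi y)%E ->
  (\int[normal_prob 0 s]_x phi x = \int[leb]_x ((normal_pdf 0 s x)%:E * phi x))%E.
Proof.
move=> mphi phi0.
apply: (@ge0_integral_density _ mR (normal_prob 0 s) id) => //.
  exact: measurable_normal_pdf.
exact: normal_pdf_ge0.
Qed.

(** Completing the square: the standard density times the exponential is a constant times the normal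
    density of variance 1 / (1 + k) and mean - b / (1 + k). *)
Lemma integral_normal_quadratic (k b : R) : 0 <= k ->
  (\int[normal_prob 0 1]_x (expR (- (k * x ^+ 2) / 2 - b * x))%:E =
   ((Num.sqrt (1 + k))^-1 * expR (b ^+ 2 / (2 * (1 + k))))%:E)%E.
Proof.
move=> k0; rewrite ge0_integral_normal_prob; last 2 first.
- apply/measurable_EFinP; apply: measurableT_comp => //.
  apply: measurable_funB; last exact: measurable_funM.
  apply: measurable_funM => //; apply: measurableT_comp => //.
  by apply: measurable_funM => //; exact: measurable_funX.
- by move=> y; rewrite lee_fin expR_ge0.
have k1 : 0 < 1 + k by lra.
have s0 : 0 < Num.sqrt (1 + k) by rewrite sqrtr_gt0.
pose s := (Num.sqrt (1 + k))^-1; pose m := - b / (1 + k).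
have sN0 : s != 0 by rewrite gt_eqF// invr_gt0.
have s2 : s ^+ 2 = (1 + k)^-1 by rewrite exprVn sqr_sqrtr// ltW.
transitivity (\int[leb]_x ((s * expR (b ^+ 2 / (2 * (1 + k))))%:E * (normal_pdf m s x)%:E))%E.
  apply: eq_integral => x _; rewrite -!EFinM; congr EFin.
  rewrite !normal_pdfE ?oner_neq0// /normal_fun /normal_peak s2.
  have -> : Num.sqrt (1 ^+ 2 * pi *+ 2) = Num.sqrt ((1 + k)^-1 * pi *+ 2) * (s^-1) :> R.
    rewrite invrK -sqrtrM; last by rewrite mulrn_wge0// mulr_ge0 ?pi_ge0// invr_ge0 ltW.
    by congr Num.sqrt; rewrite expr1n mul1r mulrnAl mulrAC mulVf ?gt_eqF// mul1r.
  rewrite -mulrA -expRD invfM invrK [RHS]mulrACA [RHS]mulrC -mulrA -expRD.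
  rewrite mulrA [LHS]mulrC [_ ^-1 * s]mulrC; congr (expR _ * _).
  by rewrite /m !expr1n -(mulr_natl 1) -(mulr_natl (_^-1)); field; rewrite gt_eqF.
rewrite ge0_integralZl_EFin//; last 3 first.
- by move=> x _; rewrite lee_fin normal_pdf_ge0.
- by apply/measurable_EFinP; exact: measurable_normal_pdf.
- by rewrite mulr_ge0 ?expR_ge0// invr_ge0 ltW.
by rewrite integral_normal_pdf mule1.
Qed.

Variable s : R.
Hypothesis s0 : s != 0.
Local Notation p := (normal_pdf 0 s).

Let pE x : p x = normal_peak s * expR (- (x ^+ 2 * (s ^+ 2 *+ 2)^-1)).
Proof. by rewrite normal_pdfE// /normal_fun subr0 mulNr. Qed.

Let s2 : 0 < s ^+ 2 *+ 2.
Proof. by rewrite pmulrn_lgt0// exprn_even_gt0. Qed.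

Let dp (x : R) : is_derive x 1 (p : R -> R) (- x / s ^+ 2 * p x).
Proof.
rewrite (_ : p = fun x => normal_peak s * expR (- (x ^+ 2 * (s ^+ 2 *+ 2)^-1))); last first.
  by apply/funext => y; rewrite pE.
by rderive; rewrite -(mulr_natl (s ^+ 2)); field; rewrite s0.
Qed.

Let mp : measurable_fun setT (p : mR -> mR).
Proof. exact: measurable_normal_pdf. Qed.

Let p0 x : 0 <= p x. Proof. exact: normal_pdf_ge0. Qed.

(* [|x| p(x)] is dominated by a multiple of the normal density of variance
   [2 s^2]. *)
Let int_xp : leb.-integrable setT (fun x => (`|x| * p x)%:E).
Proof.
pose q := normal_pdf 0 (Num.sqrt 2 * s) : R -> R.
have r0 : Num.sqrt 2 * s != 0.
  by rewrite mulf_neq0// gt_eqF// sqrtr_gt0.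
pose C : R := (1 + s ^+ 2) * normal_peak s * 4 / normal_peak (Num.sqrt 2 * s).
apply: (@le_integrable _ _ _ leb setT _ _ (fun x => C%:E * (q x)%:E)%E) => //.
- apply/measurable_EFinP; apply: measurable_funM => //; exact: normr_measurable.
- move=> x _; rewrite -EFinM !abse_EFin lee_fin ger0_norm; last first.
    by rewrite mulr_ge0.
  apply: le_trans (ler_norm _); rewrite pE /q normal_pdfE// /normal_fun subr0.
  have CE (Q E : R) : Q != 0 ->
      (1 + s ^+ 2) * normal_peak s * 4 / Q * (Q * E) =
      normal_peak s * ((1 + s ^+ 2) * 4 * E) by move=> Q0; field.
  rewrite /C CE ?gt_eqF ?normal_peak_gt0// mulrCA.
  rewrite ler_wpM2l ?normal_peak_ge0// exprMn sqr_sqrtr//.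
  have -> : expR (- (x ^+ 2 / (s ^+ 2 *+ 2))) =
      expR (- x ^+ 2 / (2 * s ^+ 2 *+ 2)) * expR (- (x ^+ 2 / (s ^+ 2 * 4))).
    by rewrite -expRD; congr expR; rewrite -(mulr_natl (s ^+ 2)) -(mulr_natl (2 * s ^+ 2)); field; rewrite s0.
  rewrite mulrCA [leRHS]mulrC ler_wpM2l ?expR_ge0//.
  rewrite expRN ler_pdivrMr ?expR_gt0//.
  have ss : 0 < s ^+ 2 by rewrite exprn_even_gt0.
  (* Bounding the remaining exponential below by 1 + x^2 / (4 s^2) leaves a polynomial inequality in
     |x|. *)
  apply: (@le_trans _ _ ((1 + s ^+ 2) * 4 * (1 + x ^+ 2 / (s ^+ 2 * 4)))); last first.
    by rewrite ler_wpM2l ?expR_ge1Dx//; nra.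
  have -> : (1 + s ^+ 2) * 4 * (1 + x ^+ 2 / (s ^+ 2 * 4)) =
    4 + 4 * s ^+ 2 + x ^+ 2 / s ^+ 2 + x ^+ 2.
    by field; rewrite s0.
  have h : 0 <= x ^+ 2 / s ^+ 2 by rewrite mulr_ge0 ?sqr_ge0// invr_ge0 ltW.
  have := sqr_ge0 (`|x| - 1); rewrite sqrrB real_normK ?num_real//.
  move: (`|x|) h => y h; nra.
- apply: integrableZl => //; exact: integrable_normal_pdf.
Qed.

Let bint (f : R -> R) : measurable_fun setT (f : mR -> mR) -> (forall x, `|f x| <= 1) ->
  leb.-integrable setT (fun x => (f x * p x)%:E).
Proof.
move=> mf f1; apply: (@le_integrable _ _ _ leb setT _ _ (fun x => (p x)%:E)) => //.
- by apply/measurable_EFinP; exact: measurable_funM.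
- by move=> x _; rewrite !abse_EFin lee_fin normrM ler_piMl.
- exact: integrable_normal_pdf.
Qed.

Let phi (t : R) := \int[leb]_x (cos (t * x) * p x).

Let norm_cos (x : R) : `|cos x| <= 1.
Proof. by rewrite ler_norml cos_geN1 cos_le1. Qed.

Let norm_sin (x : R) : `|sin x| <= 1.
Proof. by rewrite ler_norml sin_geN1 sin_le1. Qed.

Let mcos (t : R) : measurable_fun setT (fun x : mR => cos (t * x) : mR).
Proof.
by apply: continuous_measurable_fun => x; apply: rderive_continuous; rderive.
Qed.

Let msin (t : R) : measurable_fun setT (fun x : mR => sin (t * x) : mR).
Proof.
by apply: continuous_measurable_fun => x; apply: rderive_continuous; rderive.
Qed.

(** Differentiation under the integral gives minus the integral of x sin(t x) p(x), and integration
    by parts with p' = - x p / s^2 turns it into - s^2 t phi(t). *)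
Let dphi (t : R) : is_derive t 1 phi (- (s ^+ 2 * t) * phi t).
Proof.
pose f (t x : R) := cos (t * x) * p x.
have df (t' x : R) : is_derive t' 1 (f ^~ x) (- sin (t' * x) * x * p x).
  by rewrite /f; rderive; ring.
have It : `]t - 1, t + 1[%classic t by rewrite /= in_itv/=; lra.
have fi t' : `]t - 1, t + 1[%classic t' -> leb.-integrable setT (EFin \o f t').
  by move=> _; apply: bint.
have df1 t' (y : mR) : `]t - 1, t + 1[%classic t' -> setT y -> derivable (f ^~ y) t' 1.
  by move=> _ _; have [] := df t' y.
have G0 (x : mR) : 0 <= `|x| * p x by rewrite mulr_ge0.
have Gub t' (y : mR) : `]t - 1, t + 1[%classic t' -> setT y ->
    `|partial1of2 f t' y| <= `|y| * p y.
  move=> _ _; rewrite /partial1of2 (rderive1E (df t' y)).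
  rewrite !normrM normrN (ger0_norm (p0 y)) ler_wpM2r//.
  by rewrite ler_piMl.
have D := derivable_under_integral measurableT It fi df1 G0 int_xp Gub.
have E := differentiation_under_integral measurableT It fi df1 G0 int_xp Gub.
apply: DeriveDef; first exact: D.
rewrite -derive1E E.
have -> : \int[leb]_y (partial1of2 f)^~ y t = \int[leb]_y (- (sin (t * y) * y * p y)).
  by apply: eq_Rintegral => y _; rewrite /partial1of2 (rderive1E (df t y)); ring.
have sxi : leb.-integrable setT (fun x => (sin (t * x) * x * p x)%:E).
  apply: (@le_integrable _ _ _ leb setT _ _ (fun x => (`|x| * p x)%:E)) => //.
    by apply/measurable_EFinP; apply: measurable_funM => //; apply: measurable_funM => //; exact: msin.
  move=> x _; rewrite !abse_EFin lee_fin !normrM normr_id.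
  by rewrite ler_wpM2r// ler_piMl.
(* The integrand is the derivative of sin(t x) p(x), which vanishes at both ends of the line. *)
have FT : (\int[leb]_x (t * (cos (t * x) * p x) - (s ^+ 2)^-1 * (sin (t * x) * x * p x))%:E
   = (0 - 0)%:E)%E.
  have plim (u : R^nat) : (forall n, `|u n| = n.+1%:R) -> sin (t * u n) * p (u n) @[n --> \oo] --> 0.
    move=> un; apply/norm_cvg0P.
    apply: (@squeeze_cvgr _ _ _ _ (cst 0) (fun n => normal_peak s * (s ^+ 2 *+ 2) * harmonic n)).
    - apply: nearW => n; rewrite normr_ge0/= normrM.
      apply: (@le_trans _ _ (p (u n))).
        by rewrite (ger0_norm (p0 _)) ler_piMl.
      rewrite pE -mulrA ler_wpM2l ?normal_peak_ge0//.
      rewrite expRN -[leRHS]invrK lef_pV2 ?posrE ?expR_gt0//; last first.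
        by rewrite invr_gt0 mulr_gt0// invr_gt0.
      apply: le_trans (expR_ge1Dx _).
      rewrite /harmonic/= invfM invrK -[u n ^+ 2]real_normK ?num_real// un.
      rewrite mulrC.
      have : n.+1%:R <= n.+1%:R ^+ 2 :> R by rewrite expr2 ler_peMr// ler1n.
      have : 0 < (s ^+ 2 *+ 2)^-1 by rewrite invr_gt0.
      move: (n.+1%:R : R) ((s ^+ 2 *+ 2)^-1) => N r r0 NN; nra.
    - exact: cvg_cst.
    - rewrite -[X in _ --> X](mulr0 (normal_peak s * (s ^+ 2 *+ 2))).
      by apply: cvgM; [exact: cvg_cst|exact: cvg_harmonic].
  apply: (@FTC_T _ _ (fun x => sin (t * x) * p x)).
  - by move=> x; have dpx := dp x; rderive; field; rewrite s0.
  - move=> x; have dpx := dp x; apply: (@rderive_continuous _ _ _ _); rderive; reflexivity.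
  - by apply: plim => n; rewrite normrN normr_nat.
  - by apply: plim => n; rewrite normr_nat.
  - apply: (@eq_integrable _ _ _ leb setT measurableT
      ((fun x => (t%:E * (cos (t * x) * p x)%:E)) \- (fun x => ((s ^+ 2)^-1)%:E * (sin (t * x) * x * p x)%:E))%E).
      by move=> x _; rewrite /= EFinB !EFinM.
    by apply: integrableB => //; apply: integrableZl => //; exact: bint.
move: FT => /(congr1 fine)/=; rewrite -/(Rintegral _ _ _) subr0.
rewrite RintegralB//; last 2 first.
- by apply: (integrableZl measurableT t (bint (mcos t) (fun x => norm_cos (t * x)))).
- by apply: (integrableZl measurableT (s ^+ 2)^-1 sxi).
rewrite RintegralZl//; last exact: bint.
rewrite RintegralZl// -/(phi t) => FT.
under eq_Rintegral do rewrite -mulN1r.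
rewrite RintegralZl//.
have ss : s ^+ 2 != 0 by rewrite expf_neq0.
move/eqP : FT; rewrite subr_eq0 => /eqP FT.
by rewrite mulN1r mulNr -mulrA FT mulVKf.
Qed.

(** The differential equation makes phi(t) exp(s^2 t^2 / 2) constant, and phi(0) = 1. *)
Lemma cos_normal (t : R) : \int[normal_prob 0 s]_x cos (t * x) = expR (- (s ^+ 2 * t ^+ 2) / 2).
Proof.
have phiE : phi t = expR (- (s ^+ 2 * t ^+ 2) / 2).
  have H (x : R) : is_derive x 1 (fun t : R => phi t * expR (s ^+ 2 * t ^+ 2 / 2)) 0.
    by have dx := dphi x; rderive; field.
  have := is_derive_0_is_cst t 0 H.
  rewrite expr0n/= mulr0 mul0r expR0 mulr1.
  have -> : phi 0 = 1.
    rewrite /phi; under eq_Rintegral do rewrite mul0r cos0 mul1r.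
    by rewrite /Rintegral integral_normal_pdf.
  have e0 : expR (s ^+ 2 * t ^+ 2 / 2) != 0 by rewrite gt_eqF// expR_gt0.
  by move=> E; apply: (mulIf e0); rewrite E mulNr expRN mulVf.
have mc : measurable_fun setT (fun x : mR => cos (t * x) : mR) := mcos t.
have ci : (normal_prob 0 s).-integrable setT (fun x : mR => (cos (t * x))%:E).
  by apply: (@bounded_integrable _ _ _ (normal_prob 0 s) (fun x => cos (t * x)) 1).
(* The passage from [normal_prob] to its density is stated for nonnegative integrands, hence the
   detour through 1 + cos. *)
have H : (\int[normal_prob 0 s]_x (1 + cos (t * x))%:E = (1 + phi t)%:E)%E.
  rewrite ge0_integral_normal_prob; last 2 first.
  - by apply/measurable_EFinP; exact: measurable_funD.
  - by move=> y; rewrite lee_fin -lerBlDl sub0r cos_geN1.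
  transitivity (\int[leb]_x ((p x)%:E + (cos (t * x) * p x)%:E))%E.
    by apply: eq_integral => x _; rewrite -EFinM -EFinD mulrDr mulr1 mulrC.
  rewrite integralD//; [|exact: integrable_normal_pdf|exact: bint].
  rewrite integral_normal_pdf EFinD; congr (_ + _)%E.
  by rewrite /phi /Rintegral fineK//; apply: integrable_fin_num => //; exact: bint.
rewrite -phiE; move: H => /(congr1 fine)/=; rewrite -/(Rintegral _ _ _).
rewrite RintegralD//; last exact: (finite_measure_integrable_cst (normal_prob 0 s) 1).
rewrite Rintegral_cst// [X in _ * X + _](_ : _ = 1); last first.
  by rewrite [LHS](_ : _ = fine 1%E)//; congr fine; exact: integral_normal_pdf.
rewrite mulr1.
by move=> /addrI.
Qed.

End normal_integrals.

(** * Rank-one updates of a covariance matrix *)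

Section rank_one.
Variable F : comNzRingType.

(** Matrix determinant lemma: the block matrix [B] has determinant det(1 + u v), [A] and [C] have
    determinant 1, and the product [D] is block triangular with corner 1 + v u. *)
Lemma det_rank_one n (u : 'cV[F]_n) (v : 'rV[F]_n) :
  \det (1%:M + u *m v) = 1 + (v *m u) 0 0.
Proof.
pose A : 'M[F]_(n + 1) := block_mx 1%:M 0 v 1%:M.
pose B : 'M[F]_(n + 1) := block_mx (1%:M + u *m v) u 0 1%:M.
pose C : 'M[F]_(n + 1) := block_mx 1%:M 0 (- v) 1%:M.
pose D : 'M[F]_(n + 1) := block_mx 1%:M u 0 (1%:M + v *m u).
have E : A *m B *m C = D.
  rewrite /A /B /C /D !mulmx_block !mul1mx !mul0mx !mulmx1 !mulmx0 !addr0 !add0r.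
  rewrite !mulmxN addrK; congr block_mx; last by rewrite addrC.
  by rewrite mulmxDr mulmx1 mulmxDl mul1mx mulmxA [v *m u *m v + v]addrC subrr.
have := congr1 determinant E; rewrite !det_mulmx !det_lblock !det_ublock !det1.
by rewrite !mul1r !mulr1 => ->; rewrite det_mx11 !mxE.
Qed.

End rank_one.

(** Projection on the first [m] coordinates: it lets 1 + s I_m Psi account for the squares of these
    coordinates only. *)
Definition partial_id_mx (F : pzRingType) d m : 'M[F]_d :=
  \matrix_(i, j) ((i == j) && (i < m)%N)%:R.

Definition quad_form (F : pzRingType) d (A : 'M[F]_d) (t : 'cV[F]_d) : F :=
  (t^T *m A *m t) 0 0.

Section rank_one_update.
Variables (F : fieldType) (d m : nat) (l : 'I_d) (Psi A : 'M[F]_d) (s : F).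
Hypothesis lm : l = m :> nat.
Hypothesis A_sym : A^T = A.
Let G m := 1%:M + s *: (partial_id_mx F d m *m Psi).
Hypothesis AG : A *m G m = Psi.
Let e : 'cV[F]_d := delta_mx l 0.
Let k := s * A l l.
Hypothesis k1 : 1 + k != 0.

Let tr_shift (t : 'cV[F]_d) (c : F) : (t + c *: e)^T = t^T + c *: e^T.
Proof. by apply/matrixP => i j; rewrite !mxE. Qed.

(** Sherman-Morrison formula for [Psi] times the inverse of [G m.+1]. The matrix [A] is specified by
    the equation [A *m G m = Psi], so that no inverse has to be formed. *)
Definition rank_one_update : 'M[F]_d := A - (s / (1 + k)) *: ((A *m e) *m (e^T *m A)).

Let eAe : e^T *m A *m e = (A l l)%:M.
Proof. by rewrite [LHS]mx11_scalar; congr _%:M; rewrite trmx_delta -rowE -colE !mxE. Qed.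

(** Going from [m] to [m.+1] adds s e e^T Psi, and [Psi = A *m G m] lets [G m] be factored out on
    the right. *)
Let GS : G m.+1 = (1%:M + (s *: e) *m (e^T *m A)) *m G m.
Proof.
rewrite mulmxDl mul1mx -!mulmxA AG /G -addrA; congr (_ + _).
rewrite -scalemxAl -scalerDr mulmxA -mulmxDl; congr (_ *: (_ *m _)).
apply/matrixP => i j; rewrite !mxE big_ord1 !mxE -natrM -natrD; congr (_%:R).
rewrite eqxx/= !andbT mulnb ltnS leq_eqVlt -lm.
have [->|il] := eqVneq i l.
  by rewrite ltnn eqxx/= andbF eq_sym; case: eqP.
by rewrite (negbTE (il : i != l :> nat))/= addn0.
Qed.

Lemma det_rank_one_update : \det (G m.+1) = (1 + k) * \det (G m).
Proof.
rewrite GS det_mulmx det_rank_one -scalemxAr eAe; congr ((1 + _) * _).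
by rewrite !mxE eqxx mulr1n.
Qed.

Lemma rank_one_updateE : rank_one_update *m G m.+1 = Psi.
Proof.
rewrite GS mulmxA; rewrite (_ : rank_one_update *m _ = A) ?AG//.
rewrite /rank_one_update; set r := e^T *m A; set c := A *m e.
rewrite mulmxDr mulmx1 -addrA -[RHS]addr0; congr (_ + _).
have h1 : A *m (s *: e *m r) = s *: (c *m r).
  by rewrite -scalemxAl -scalemxAr mulmxA.
have h2 : (c *m r) *m (s *: e *m r) = k *: (c *m r).
  by rewrite -scalemxAl -scalemxAr mulmxA -(mulmxA c r e) eAe mul_mx_scalar -scalemxAl scalerA.
rewrite mulmxBl h1 -[X in _ + (_ - X)]scalemxAl h2 scalerA -scalerBl -scaleNr -scalerDl.
rewrite (_ : _ + _ = 0) ?scale0r//.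
by move: k1; rewrite /k => ?; field.
Qed.

Lemma rank_one_update_sym : rank_one_update^T = rank_one_update.
Proof.
by rewrite /rank_one_update linearB/= linearZ/= !trmx_mul trmxK A_sym.
Qed.

Lemma quad_form_shift (t : 'cV[F]_d) (c : F) :
  quad_form A (t + c *: e) =
  quad_form A t + 2 * c * (t^T *m A *m e) 0 0 + c ^+ 2 * A l l.
Proof.
have eAt : (e^T *m A *m t) 0 0 = (t^T *m A *m e) 0 0.
  by rewrite -[in LHS](trmxK (e^T *m A *m t)) mxE !trmx_mul A_sym trmxK mulmxA.
rewrite /quad_form tr_shift !mulmxDl !mulmxDr -!scalemxAl -!scalemxAr.
rewrite eAe [in LHS]mxE [in X in X + _ = _]mxE [in X in _ + X = _]mxE.
have sc1 a (M : 'M[F]_1) : (a *: M) 0 0 = a * M 0 0 by rewrite mxE.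
have sc2 : ((A l l)%:M : 'M[F]_1) 0 0 = A l l by rewrite mxE eqxx mulr1n.
by rewrite !sc1 eAt sc2; ring.
Qed.

Lemma quad_form_rank_one_update (t : 'cV[F]_d) :
  quad_form rank_one_update t = quad_form A t - s / (1 + k) * (t^T *m A *m e) 0 0 ^+ 2.
Proof.
have eAt : (e^T *m A *m t) 0 0 = (t^T *m A *m e) 0 0.
  by rewrite -[in LHS](trmxK (e^T *m A *m t)) mxE !trmx_mul A_sym trmxK mulmxA.
rewrite /quad_form /rank_one_update mulmxBr mulmxBl mxE [in X in _ + X]mxE.
congr (_ - _); rewrite -scalemxAr -scalemxAl mxE; congr (_ * _).
rewrite !mulmxA -[_ *m e^T *m A *m t]mulmxA -(mulmxA _ e^T) mulmxA -(mulmxA _ e^T).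
by rewrite [in LHS]mxE big_ord1 mulmxA eAt expr2.
Qed.

End rank_one_update.

Lemma Rintegral_cst_probability {R : realType} {dT : measure_display}
  {T : measurableType dT} (P : probability T R) (r : R) : \int[P]_x r = r.
Proof. by rewrite /Rintegral integral_cst//= probability_setT mule1. Qed.

(** * Laplace transform of the squared norm of a Gaussian vector *)

Section gaussian_vector_laplace.
Context {R : realType} {dT : measure_display} {T : measurableType dT}.
Variables (P : probability T R) (d : nat) (Psi : 'M[R]_d) (Z : T -> 'cV[R]_d).
Hypothesis mZ : forall i, measurable_fun setT (fun w => Z w i 0).
Hypothesis Psi_sym : Psi^T = Psi.
Hypothesis cosZ : forall t : 'cV[R]_d,
  \int[P]_w cos ((t^T *m Z w) 0 0) = expR (- (t^T *m Psi *m t) 0 0 / 2).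
Variable s : R.
Hypothesis s0 : 0 <= s.

Definition gauss_partial_sum m (z : 'cV[R]_d) : R := \sum_(l < d | (l < m)%N) z l 0 ^+ 2.

Let expect m (t : 'cV[R]_d) :=
  \int[P]_w (expR (- (s * gauss_partial_sum m (Z w) / 2)) * cos ((t^T *m Z w) 0 0)).

Let G m := 1%:M + s *: (partial_id_mx R d m *m Psi).

Let mdot (t : 'cV[R]_d) : measurable_fun setT (fun w => (t^T *m Z w) 0 0 : R).
Proof.
rewrite (_ : (fun w => _) = (fun w => \sum_j t j 0 * Z w j 0)); last first.
  by apply/funext => w; rewrite mxE; apply: eq_bigr => j _; rewrite mxE.
by apply: measurable_sum => j; apply: measurable_funM.
Qed.

Let mq m : measurable_fun setT (fun w => gauss_partial_sum m (Z w)).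
Proof.
rewrite /gauss_partial_sum; under eq_fun do rewrite big_mkcond/=.
apply: measurable_sum => j; case: (j < m)%N => //.
by apply: measurable_funX.
Qed.

Let mexpq m : measurable_fun setT (fun w => expR (- (s * gauss_partial_sum m (Z w) / 2))).
Proof.
apply: measurableT_comp => //; apply: measurableT_comp => //.
apply: measurable_funM => //; apply: measurable_funM => //; exact: mq.
Qed.

Let expq_itv m w : 0 <= expR (- (s * gauss_partial_sum m (Z w) / 2)) <= 1.
Proof.
rewrite expR_ge0/= -[leRHS]expR0 ler_expR oppr_le0 divr_ge0// mulr_ge0//.
by apply: sumr_ge0 => i _; exact: sqr_ge0.
Qed.

Let norm_cos (x : R) : `|cos x| <= 1.
Proof. by rewrite ler_norml cos_geN1 cos_le1. Qed.

Let norm_expcos m w (x : R) :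
  `|expR (- (s * gauss_partial_sum m (Z w) / 2)) * cos x| <= 1.
Proof.
rewrite normrM; have /andP[h0 h1] := expq_itv m w.
by rewrite (ger0_norm h0) mulr_ile1.
Qed.

Let mcosdot (t : 'cV[R]_d) : measurable_fun setT (fun w => cos ((t^T *m Z w) 0 0)).
Proof.
by apply: measurableT_comp => //; apply: continuous_measurable_fun; exact: continuous_cos.
Qed.

Let expect_int m (t : 'cV[R]_d) : P.-integrable setT
  (fun w => (expR (- (s * gauss_partial_sum m (Z w) / 2)) * cos ((t^T *m Z w) 0 0))%:E).
Proof.
apply: (@bounded_integrable _ _ _ P (fun w => expR (- (s * gauss_partial_sum m (Z w) / 2)) * cos ((t^T *m Z w) 0 0)) 1) => //.
exact: measurable_funM.
Qed.

Let cos_gauss (y : R) : \int[normal_prob 0 1]_x cos (y * x) = expR (- y ^+ 2 / 2).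
Proof. by rewrite cos_normal ?oner_neq0// expr1n mul1r. Qed.

Let coscos (a b : R) : cos a * cos b = (cos (a + b) + cos (a - b)) / 2.
Proof. by rewrite cosD cosB; field. Qed.

Let dot_shift (t : 'cV[R]_d) (c : R) l w :
  ((t + c *: delta_mx l 0)^T *m Z w) 0 0 = (t^T *m Z w) 0 0 + c * Z w l 0.
Proof.
have -> : (t + c *: delta_mx l 0)^T = t^T + c *: 'e_l.
  by apply/matrixP => i j; rewrite !mxE andbC.
by rewrite mulmxDl mxE; congr (_ + _); rewrite -scalemxAl mxE -rowE mxE.
Qed.

(* Averaging [cos (sqrt s * y * x)] over a standard normal [x] produces the
   factor [exp (- s y^2 / 2)]. *)
Let expectS m (l : 'I_d) t : l = m :> nat ->
  expect m.+1 t = \int[normal_prob 0 1]_x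
    ((expect m (t + (Num.sqrt s * x) *: delta_mx l 0) +
      expect m (t + (- Num.sqrt s * x) *: delta_mx l 0)) / 2).
Proof.
move=> lm.
have qS z : gauss_partial_sum m.+1 z = gauss_partial_sum m z + z l 0 ^+ 2.
  rewrite /gauss_partial_sum (bigD1 l)/=; last by rewrite lm.
  rewrite addrC; congr (_ + _); apply: eq_bigl => j.
  rewrite ltnS leq_eqVlt -lm; have [->|jl] := eqVneq j l; first by rewrite ltnn !andbF.
  by rewrite andbT (negbTE (jl : j != l :> nat)).
pose E w := expR (- (s * gauss_partial_sum m (Z w) / 2)).
pose g (c : R) w x := E w * cos (((t + (c * x) *: delta_mx l 0)^T *m Z w) 0 0).
have mg c : measurable_fun setT (fun z : T * measurableTypeR R => g c z.1 z.2).
  apply: measurable_funM.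
    by apply: (measurableT_comp (mexpq m)); exact: measurable_fst.
  apply: measurableT_comp; first by apply: continuous_measurable_fun; exact: continuous_cos.
  under eq_fun do rewrite dot_shift.
  apply: measurable_funD.
    by apply: (measurableT_comp (mdot t)); exact: measurable_fst.
  apply: measurable_funM.
    by apply: measurable_funM => //; exact: measurable_snd.
  by apply: (measurableT_comp (mZ l)); exact: measurable_fst.
pose f w x := (g (Num.sqrt s) w x + g (- Num.sqrt s) w x) / 2.
(* A product of two cosines is the mean of the cosines of the two shifted linear forms; this keeps
   the computation real. *)
have fE w x : f w x = E w * cos ((t^T *m Z w) 0 0) * cos (Num.sqrt s * Z w l 0 * x).
  rewrite /f /g !dot_shift -[RHS]mulrA coscos [RHS]mulrA [in RHS]mulrDr.
  by congr ((_ * cos _ + _ * cos _) / 2); ring.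
transitivity (\int[P]_w \int[normal_prob 0 1]_x f w x).
  rewrite /expect; apply: eq_Rintegral => w _.
  under [RHS]eq_Rintegral do rewrite fE.
  rewrite RintegralZl//; last first.
    apply: (@bounded_integrable _ _ _ (normal_prob 0 1) (fun x => cos (Num.sqrt s * Z w l 0 * x)) 1) => //.
    apply: measurableT_comp; first by apply: continuous_measurable_fun; exact: continuous_cos.
    exact: measurable_funM.
  rewrite cos_gauss [RHS]mulrAC; congr (_ * _).
  rewrite qS /E -expRD exprMn sqr_sqrtr//; congr expR; by field.
transitivity (\int[normal_prob 0 1]_x \int[P]_w f w x).
  apply: (@bounded_Fubini _ _ _ _ _ P (normal_prob 0 1) f 1).
    by apply: measurable_funM => //; apply: measurable_funD; exact: mg.
  by move=> w x; rewrite fE normrM mulr_ile1 ?normr_ge0 ?norm_cos//; exact: norm_expcos.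
apply: eq_Rintegral => x _; rewrite /f.
have gi c : P.-integrable setT (fun w => (g c w x)%:E).
  exact: expect_int.
rewrite RintegralZr//; last exact: (integrableD measurableT (gi _) (gi _)).
by rewrite RintegralD//; exact: gi.
Qed.

Let expect0 t : expect 0 t = expR (- quad_form Psi t / 2).
Proof.
rewrite /expect -cosZ; apply: eq_Rintegral => w _.
by rewrite /gauss_partial_sum big_pred0_eq mulr0 mul0r oppr0 expR0 mul1r.
Qed.

(** Induction on the number of squares in the exponent. Carrying the cosine factor for every [t]
    makes it close: up to the determinant the expectation remains a Gaussian transform, whose
    covariance [A] is [Psi] after m rank-one updates. *)
Lemma gauss_partial_laplace m : (m <= d)%N -> exists A : 'M[R]_d,
  [/\ A^T = A, A *m G m = Psi, 0 < \det (G m) &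
      forall t, expect m t = (Num.sqrt (\det (G m)))^-1 * expR (- quad_form A t / 2)].
Proof.
elim: m => [_|m IH md].
  have -> : G 0 = 1%:M.
    rewrite /G (_ : partial_id_mx _ _ _ = 0) ?mul0mx ?scaler0 ?addr0//.
    by apply/matrixP => i j; rewrite !mxE andbF.
  exists Psi; rewrite mulmx1 det1; split => // t.
  by rewrite expect0 sqrtr1 invr1 mul1r.
have [A [As AG dG HA]] := IH (ltnW md).
pose l := Ordinal md; have lm : l = m :> nat by [].
have D0 : 0 < (Num.sqrt (\det (G m)))^-1 by rewrite invr_gt0 sqrtr_gt0.
(* Positivity of [A] is obtained from probability: the expectation at [t] is at most the one at 0,
   and both are known in closed form. *)
have qA t : 0 <= quad_form A t.
  have : expect m t <= expect m 0.
    rewrite /expect; apply: le_Rintegral => //; [exact: expect_int|exact: expect_int|].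
    move=> w _; have -> : ((0 : 'cV[R]_d)^T *m Z w) 0 0 = 0 by rewrite trmx0 mul0mx mxE.
    rewrite cos0 mulr1.
    by have /andP[h0 _] := expq_itv m w; rewrite ler_piMr// cos_le1.
  rewrite !HA ler_pM2l// ler_expR {2}/quad_form mulmx0 mxE oppr0 mul0r.
  by rewrite pmulr_lle0// oppr_le0.
pose k := s * A l l.
have k0 : 0 <= k.
  rewrite mulr_ge0//; have := qA (delta_mx l 0).
  by rewrite /quad_form trmx_delta -rowE -colE !mxE.
have k1 : 1 + k != 0 by rewrite gt_eqF// ltr_wpDr.
exists (rank_one_update l A s); split.
- exact: rank_one_update_sym.
- exact: rank_one_updateE.
- by rewrite (det_rank_one_update lm AG) mulr_gt0// ltr_wpDr.
move=> t; rewrite (expectS _ lm) (quad_form_rank_one_update l s As t).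
rewrite (det_rank_one_update lm AG) sqrtrM; last by rewrite ltW// ltr_wpDr.
set b := (t^T *m A *m _) 0 0.
(* A shift by c x along e_l, with c^2 = s, produces the exponent of [integral_normal_quadratic]. The
   outcome involves c b through its square only, hence is the same for both signs of c. *)
have S x (c : R) : c ^+ 2 = s ->
   expect m (t + (c * x) *: delta_mx l 0) =
   (Num.sqrt (\det (G m)))^-1 * expR (- quad_form A t / 2) *
   expR (- (k * x ^+ 2) / 2 - (c * b) * x).
  move=> cs; rewrite HA quad_form_shift// -/b -[RHS]mulrA -expRD; congr (_ * expR _).
  by rewrite /k -cs; field.
set C := (Num.sqrt (\det (G m)))^-1 * expR (- quad_form A t / 2) in S.
have Hc (c : R) : c ^+ 2 = s ->
    \int[normal_prob 0 1]_x expR (- (k * x ^+ 2) / 2 - (c * b) * x) =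
    (Num.sqrt (1 + k))^-1 * expR (s * b ^+ 2 / (2 * (1 + k))).
  move=> cs; rewrite /Rintegral integral_normal_quadratic//=.
  by rewrite exprMn cs.
have Ic (c : R) : c ^+ 2 = s -> (normal_prob 0 1).-integrable setT
    (fun x => (expR (- (k * x ^+ 2) / 2 - (c * b) * x))%:E).
  move=> cs; apply/integrableP; split.
    apply/measurable_EFinP; apply: measurableT_comp => //.
    apply: measurable_funB; last exact: measurable_funM.
    apply: measurable_funM => //; apply: measurableT_comp => //.
    by apply: measurable_funM => //; exact: measurable_funX.
  under eq_integral do rewrite abse_EFin ger0_norm ?expR_ge0//.
  by rewrite integral_normal_quadratic// ltry.
have s1 : Num.sqrt s ^+ 2 = s by rewrite sqr_sqrtr.
have s2 : (- Num.sqrt s) ^+ 2 = s by rewrite sqrrN.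
under eq_Rintegral do rewrite !S//.
under eq_Rintegral do rewrite -mulrDr -mulrA.
have Isum := integrableD measurableT (Ic _ s1) (Ic _ s2).
rewrite RintegralZl//; last exact: (integrableZr measurableT 2^-1 Isum).
rewrite RintegralZr// RintegralD//; [|exact: Ic|exact: Ic].
rewrite !Hc// -mulr2n -[X in C * (X / 2)]mulr_natr mulfK ?pnatr_eq0//.
rewrite /C mulrACA -expRD; congr (_ * expR _).
  by rewrite [RHS]invfM mulrC.
by rewrite -/k; field; rewrite k1.
Qed.

Lemma gaussian_vector_laplace :
  0 < \det (1%:M + s *: Psi) /\
  \int[P]_w expR (- (s * (\sum_i Z w i 0 ^+ 2) / 2)) = (Num.sqrt (\det (1%:M + s *: Psi)))^-1.
Proof.
have [A [_ _ dG /(_ 0)]] := gauss_partial_laplace (leqnn d).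
have -> : G d = 1%:M + s *: Psi.
  rewrite /G (_ : partial_id_mx _ _ _ = 1%:M) ?mul1mx//.
  by apply/matrixP => i j; rewrite !mxE ltn_ord andbT.
rewrite /quad_form mulmx0 mxE oppr0 mul0r expR0 mulr1 => <-.
move: dG; have -> : G d = 1%:M + s *: Psi.
  rewrite /G (_ : partial_id_mx _ _ _ = 1%:M) ?mul1mx//.
  by apply/matrixP => i j; rewrite !mxE ltn_ord andbT.
move=> dG; split => //; rewrite /expect; apply: eq_Rintegral => w _.
rewrite trmx0 mul0mx mxE cos0 mulr1 /gauss_partial_sum.
by under [in RHS]eq_bigl do rewrite ltn_ord.
Qed.

End gaussian_vector_laplace.

(** * Eigenvalues through the characteristic polynomial *)

Section eigenvalues.
Variable F : fieldType.

Lemma horner_char_poly n (A : 'M[F]_n) x : (char_poly A).[x] = \det (x%:M - A).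
Proof.
rewrite /char_poly -[_.[x]]/(horner_eval x _) -det_map_mx; congr (\det _).
apply/matrixP => i j; rewrite !mxE /= /horner_eval !hornerE/=.
by rewrite !(hornerMn, hornerE).
Qed.

Variables (n : nat) (A : 'M[F]_n) (lam : 'I_n -> F).
Hypothesis charA : char_poly A = \prod_(l < n) ('X - (lam l)%:P).

(** Factoring out - s leads to the characteristic polynomial at - 1 / s, whence the separate case s
    = 0. *)
Lemma det_1D_eigenvalues s : \det (1%:M + s *: A) = \prod_(l < n) (1 + s * lam l).
Proof.
have [->|s0] := eqVneq s 0.
  rewrite scale0r addr0 det1 big1// => i _; by rewrite mul0r addr0.
have -> : 1%:M + s *: A = (- s) *: ((- s^-1)%:M - A).
  rewrite scalerBr !scaleNr opprK; congr (_ + _).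
  by rewrite scale_scalar_mx mulrN mulfV// raddfN/= opprK.
rewrite detZ -horner_char_poly charA horner_prod -[in X in X * _](card_ord n).
rewrite -prodr_const -big_split/=; apply: eq_bigr => l _.
by rewrite !hornerE; field.
Qed.

Lemma trace_eigenvalues : (0 < n)%N -> \tr A = \sum_(l < n) lam l.
Proof.
move=> n0; apply: oppr_inj; rewrite -char_poly_trace// charA.
pose s := [seq lam l | l <- enum 'I_n].
have sz : size s = n by rewrite size_map size_enum_ord.
have -> : \prod_(l < n) ('X - (lam l)%:P) = \prod_(z <- s) ('X - z%:P).
  by rewrite big_map big_enum.
rewrite -[in LHS]sz coefPn_prod_XsubC; last by rewrite sz -lt0n.
by rewrite big_map big_enum.
Qed.

Lemma eigenvalues_root l : root (char_poly A) (lam l).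
Proof.
by rewrite charA rootE horner_prod (bigD1 l)//= !hornerE subrr mul0r.
Qed.

End eigenvalues.

(** The eigenvalues are given by the factorisation of [char_poly A], not by a diagonal form.
    Substituting X^2 is injective on polynomials, and det(X^2 - A^2) = det(X - A) det(X + A), where
    the second factor is, up to sign, the characteristic polynomial at - X. *)
Lemma char_poly_sqr (F : fieldType) n (A : 'M[F]_n) (lam : 'I_n -> F) :
  char_poly A = \prod_(l < n) ('X - (lam l)%:P) ->
  char_poly (A *m A) = \prod_(l < n) ('X - (lam l ^+ 2)%:P).
Proof.
move=> cA; apply/eqP; rewrite -subr_eq0.
rewrite -(@comp_poly_eq0 _ _ 'X^2) ?size_polyXn// linearB/= subr_eq0.
have E1 : char_poly (A *m A) \Po 'X^2 =
    \det ('X%:M - map_mx polyC A) * \det ('X%:M + map_mx polyC A).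
  rewrite -det_mulmx mulmxDr !mulmxBl -!scalar_mxM -scalar_mxC.
  rewrite addrA subrK -map_mxM /char_poly -[_ \Po _]/(comp_poly 'X^2 _) -det_map_mx.
  congr (\det _); apply/matrixP => i j; rewrite !mxE /= linearB/= comp_polyC; congr (_ - _).
  by rewrite linearMn/= comp_polyX expr2.
have E2 : \det ('X%:M + map_mx polyC A) = (-1) ^+ n * (char_poly A \Po (- 'X)).
  rewrite /char_poly -[_ \Po _]/(comp_poly (- 'X) _) -det_map_mx -detZ.
  congr (\det _); apply/matrixP => i j; rewrite !mxE /= linearB/= comp_polyC linearMn/= comp_polyX.
  by rewrite mulN1r opprB addrC mulNrn opprK.
rewrite E1 E2 -[\det ('X%:M - _)]/(char_poly A) cA !rmorph_prod/= mulrCA.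
have -> : (-1) ^+ n = \prod_(i < n) (-1 : {poly F}) by rewrite prodr_const card_ord.
rewrite -!big_split/=.
apply/eqP/eq_bigr => l _; rewrite !linearB/= !comp_polyX !comp_polyC rmorphXn/=; ring.
Qed.

Lemma trace_sqr_eigenvalues (F : fieldType) n (A : 'M[F]_n) (lam : 'I_n -> F) :
  (0 < n)%N -> char_poly A = \prod_(l < n) ('X - (lam l)%:P) ->
  \tr (A *m A) = \sum_(l < n) lam l ^+ 2.
Proof. by move=> n0 /char_poly_sqr/trace_eigenvalues ->. Qed.

(** For a left eigenvector v one has v S v^T = a |v|^2. *)
Lemma posdef_eigenvalue_gt0 (R : realType) d (S : 'M[R]_d) a :
  posdefmx S -> root (char_poly S) a -> 0 < a.
Proof.
move=> [_ pS]; rewrite -eigenvalue_root_char => /eigenvalueP[v vS v0].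
have vT0 : v^T != 0 by rewrite -(inj_eq (can_inj (@trmxK _ _ _))) trmxK trmx0.
have := pS v^T vT0; rewrite trmxK vS -scalemxAl mxE.
rewrite pmulr_lgt0// lt_neqAle eq_sym; apply/andP; split; last first.
  by rewrite mxE; apply: sumr_ge0 => i _; rewrite mxE -expr2 sqr_ge0.
apply: contra v0; rewrite mxE => /eqP H; apply/eqP/rowP => i; rewrite mxE.
have := H; under eq_bigr do rewrite mxE -expr2.
move/eqP; rewrite psumr_eq0 => [/allP/(_ i)|j _]; last exact: sqr_ge0.
by rewrite mem_index_enum => /(_ isT)/=; rewrite sqrf_eq0 => /eqP.
Qed.

(** * Expectation of a product of independent factors *)

Section independence.
Context {R : realType} {d d' : measure_display}.
Context {T : measurableType d} {S : measurableType d'}.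
Variable P : probability T R.

Lemma integral_preimage_indic (X : T -> S) (B : set S) (f : T -> R) :
  (\int[P]_(x in X @^-1` B) (f x)%:E = \int[P]_x (f x * \1_B (X x))%:E)%E.
Proof.
rewrite integral_mkcond; apply: eq_integral => x _; rewrite patchE indicE.
case: ifPn; first by rewrite inE => XB; rewrite mem_set// mulr1.
by rewrite notin_setE => XB; rewrite memNset// mulr0.
Qed.

(** The indicators in the definition of independence are replaced by the functions [phi i] one index
    at a time. The list [s] holds the indices already treated; the sets [A i] stay arbitrary at the
    others, which is what the induction exploits. *)
Lemma independent_prod (I : finType) (X : I -> {RV P >-> S}) (phi : I -> S -> R)
    (e : I -> R) :
  mutual_independence P X ->
  (forall i, measurable_fun setT (phi i)) -> (forall i x, 0 <= phi i x) ->
  (forall i, \int[P]_w (phi i (X i w))%:E = (e i)%:E)%E ->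
  (\int[P]_w (\prod_i phi i (X i w))%:E = (\prod_i e i)%:E)%E.
Proof.
move=> indep mphi phi0 He.
pose f (s : seq I) (A : I -> set S) i w : R :=
  if i \in s then phi i (X i w) else \1_(A i) (X i w).
pose q (s : seq I) (A : I -> set S) i : R :=
  if i \in s then e i else fine (P (X i @^-1` A i)).
have mXA (i : I) (B : set S) : measurable B -> measurable (X i @^-1` B).
  by move=> mB; rewrite -[X in measurable X]setTI; exact: measurable_funP.
have mf s A i : (forall j, measurable (A j)) -> measurable_fun setT (f s A i).
  move=> mA; rewrite /f; case: (i \in s); first exact: measurableT_comp.
  have mI : measurable_fun setT (\1_(A i) : S -> R) by exact: measurable_indic.
  by apply: (measurableT_comp mI).
have f0 s A i w : 0 <= f s A i w by rewrite /f; case: ifP.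
have e0 i : 0 <= e i.
  by rewrite -lee_fin -He; apply: integral_ge0 => w _; rewrite lee_fin.
have q0 s A i : 0 <= q s A i by rewrite /q; case: ifP => // _; exact: fine_ge0.
suff H s : forall A, (forall i, measurable (A i)) ->
    (\int[P]_w (\prod_i f s A i w)%:E = (\prod_i q s A i)%:E)%E.
  have := H (enum I) (fun=> setT) (fun=> measurableT).
  have -> : \prod_i q (enum I) (fun=> setT) i = \prod_i e i.
    by apply: eq_bigr => i _; rewrite /q mem_enum.
  move=> <-; apply: eq_integral => w _; congr EFin.
  by apply: eq_bigr => i _; rewrite /f mem_enum.
elim: s => [A mA|j s IH A mA].
  have := indep (finset.setTfor I) A (fun i _ => mA i).
  have -> : (\prod_(i in finset.setTfor I) P (X i @^-1` A i))%E = (\prod_i q [::] A i)%:E.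
    rewrite -prodEFin; under eq_bigl do rewrite finset.in_setT.
    by apply: eq_bigr => i _; rewrite /q in_nil fineK// fin_num_measure//; exact: mXA.
  move=> <-; set C := \bigcap_(i in _) _.
  have mC : measurable C by apply: fin_bigcap_measurable => // i _; exact: mXA.
  transitivity (\int[P]_w (\1_C w)%:E)%E; last by rewrite integral_indic// setIT.
  apply: eq_integral => w _; congr EFin; rewrite /f indicE.
  transitivity (\prod_i ((X i w \in A i)%:R : R)).
    by apply: eq_bigr => i _; rewrite indicE.
  rewrite -natr_prod; congr (_%:R).
  have [/set_mem wA|/negP wA] := boolP (w \in _).
    rewrite big1// => i _; apply/eqP; rewrite eqb1; apply/mem_set.
    by apply: (wA i); rewrite /= finset.in_setT.
  have [i wAi] : exists i, ~ A i (X i w).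
    by apply/existsNP => wA'; apply: wA; apply/mem_set => i _; exact: wA'.
  by rewrite (bigD1 i)//= memNset.
have [js|js] := boolP (j \in s).
  have E i : (i \in j :: s) = (i \in s) by rewrite inE; case: eqP => // ->.
  have -> : f (j :: s) A = f s A by apply/funext => i; rewrite /f E.
  have -> : q (j :: s) A = q s A by apply/funext => i; rewrite /q E.
  exact: IH.
pose w1 w := \prod_(i | i != j) f s A i w.
pose c := \prod_(i | i != j) q s A i.
have E i : i != j -> (i \in j :: s) = (i \in s) by rewrite inE => /negbTE ->.
rewrite (bigD1 j)//= {1}/q mem_head.
have -> : \prod_(i | i != j) q (j :: s) A i = c.
  by apply: eq_bigr => i /E ij; rewrite /q ij.
transitivity (\int[P]_w ((w1 w)%:E * (phi j (X j w))%:E))%E.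
  apply: eq_integral => w _; rewrite -EFinM (bigD1 j)//= {1}/f mem_head mulrC.
  by congr (_ * _)%:E; apply: eq_bigr => i /E ij; rewrite /f ij.
(* The product over i <> j acts as a weight on the law of [X j]; by the induction hypothesis with
   [B] as the set at j, this weighted law is the multiple [c] of the law of [X j]. *)
rewrite (@eq_weighted_law _ _ _ _ _ _ _ P P w1 (cst c) (X j) (X j) _ _ _ _ _ _ _
   (fun x => (phi j x)%:E))//.
- rewrite /= ge0_integralZl_EFin ?He//; first by rewrite -EFinM mulrC.
  + by move=> w _; rewrite lee_fin.
  + by apply/measurable_EFinP; exact: measurableT_comp.
  + by apply: prodr_ge0.
- rewrite /w1; under eq_fun do rewrite -big_filter.
  by apply: measurable_prod => i _; exact: mf.
- by move=> w; apply: prodr_ge0.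
- by move=> w; apply: prodr_ge0.
- move=> B mB; pose A' i := if i == j then B else A i.
  have mA' i : measurable (A' i) by rewrite /A'; case: eqP.
  rewrite integral_preimage_indic.
  transitivity (\int[P]_w (\prod_i f s A' i w)%:E)%E.
    apply: eq_integral => w _; congr EFin; rewrite [RHS](bigD1 j)//= mulrC.
    rewrite {1}/f (negbTE js) {1}/A' eqxx; congr (_ * _).
    by apply: eq_bigr => i ij; rewrite /f /A' (negbTE ij).
  rewrite IH// (bigD1 j)//= {1}/q (negbTE js) {1}/A' eqxx.
  have -> : \prod_(i | i != j) q s A' i = c.
    by apply: eq_bigr => i ij; rewrite /q /A' (negbTE ij).
  rewrite (_ : (fun x => (cst c x)%:E) = cst c%:E)// integral_cst; last exact: mXA.
  by rewrite mulrC EFinM fineK// fin_num_measure//; exact: mXA.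
- exact/measurable_EFinP.
- by move=> y; rewrite lee_fin.
Qed.

End independence.

Lemma measurable_mx_coord (R : realType) m n (i : 'I_m) (j : 'I_n) :
  measurable_fun setT (fun M : 'M[R]_(m, n) => M i j).
Proof.
by move=> _ B mB; rewrite setTI; apply: sub_sigma_algebra; exists (i, j) => //; exists B.
Qed.

Section wishart_laplace.
Context {R : realType}.

(** The linear form t'Z is N(0, q) with q = t' Psi t. For q = 0 this is the Dirac mass at 0, treated
    apart from the case with a density. *)
Lemma cos_centered_gaussian {dT : measure_display} {T : measurableType dT}
    (P : probability T R) d (Psi : 'M[R]_d) (Z : {RV P >-> 'cV[R]_d}) (t : 'cV[R]_d) :
  (forall t : 'cV[R]_d, 0 <= (t^T *m Psi *m t) 0 0) ->
  centered_gaussian P Psi Z ->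
  \int[P]_w cos ((t^T *m Z w) 0 0) = expR (- (t^T *m Psi *m t) 0 0 / 2).
Proof.
move=> psd /(_ t); set q := (t^T *m Psi *m t) 0 0; set s := Num.sqrt q => H.
have s2 : s ^+ 2 = q by rewrite sqr_sqrtr//; exact: psd.
have mX : measurable_fun setT (fun w => (t^T *m Z w) 0 0 : measurableTypeR R).
  rewrite (_ : (fun w => _) = (fun w => \sum_j t j 0 * Z w j 0)); last first.
    by apply/funext => w; rewrite mxE; apply: eq_bigr => j _; rewrite mxE.
  apply: measurable_sum => j; apply: measurable_funM => //.
  exact: (measurableT_comp (measurable_mx_coord j 0)).
have mcos : measurable_fun setT (fun x : measurableTypeR R => cos x).
  by apply: continuous_measurable_fun; exact: continuous_cos.
have m1cos : measurable_fun setT (fun x : measurableTypeR R => (1 + cos x)%:E).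
  by apply/measurable_EFinP; exact: measurable_funD.
have c0 (x : measurableTypeR R) : (0 <= (1 + cos x)%:E)%E.
  by rewrite lee_fin -lerBlDl sub0r cos_geN1.
have c1 (x : R) : `|cos x| <= 1 by rewrite ler_norml cos_geN1 cos_le1.
(* [eq_law] compares nonnegative integrands, hence 1 + cos. *)
suff E : (\int[P]_w (1 + cos ((t^T *m Z w) 0 0))%:E = (1 + expR (- q / 2))%:E)%E.
  move: E => /(congr1 fine)/=; rewrite -/(Rintegral _ _ _).
  rewrite RintegralD//; last 2 first.
  - exact: (finite_measure_integrable_cst P 1).
  - apply: (@bounded_integrable _ _ _ P (fun w => cos ((t^T *m Z w) 0 0)) 1) => //.
    exact: (measurableT_comp mcos).
  by rewrite Rintegral_cst_probability => /addrI.
have [s0|s0] := eqVneq s 0.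
  rewrite (@eq_law _ _ (measurableTypeR R) _ _ _ (measurableTypeR R) P (@dirac _ (measurableTypeR R) 0 R) _ id mX _ _ _ m1cos)//.
    rewrite integral_dirac//= diracT mul1e cos0; congr (1 + _)%:E.
    by rewrite -s2 s0 expr0n/= oppr0 mul0r expR0.
  by move=> A mA; rewrite [LHS]H// /normal_law s0 eqxx.
rewrite (@eq_law _ _ (measurableTypeR R) _ _ _ (measurableTypeR R) P (normal_prob 0 s) _ id mX _ _ _ m1cos)//; last first.
  by move=> A mA; rewrite [LHS]H// /normal_law (negbTE s0).
have ci : (normal_prob 0 s).-integrable setT (fun x => (cos x)%:E).
  exact: (@bounded_integrable _ _ _ (normal_prob 0 s) (fun x => cos x) 1).
have oi : (normal_prob 0 s).-integrable setT (fun x => (1 : R)%:E).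
  exact: (finite_measure_integrable_cst (normal_prob 0 s) 1).
have HN := cos_normal s0 1; rewrite expr1n mulr1 s2 in HN.
rewrite -[LHS]fineK; last by apply: integrable_fin_num => //; exact: (integrableD measurableT oi ci).
congr EFin; rewrite -/(Rintegral _ _ _) RintegralD// -HN.
rewrite (Rintegral_cst_probability (normal_prob 0 s)); congr (1 + _).
by apply: eq_Rintegral => x _; rewrite mul1r.
Qed.

Variables (d n : nat) (Psi : 'M[R]_d).
Hypothesis Psi_sym : Psi^T = Psi.
Hypothesis psd : forall t : 'cV[R]_d, 0 <= (t^T *m Psi *m t) 0 0.
Context {dT : measure_display} {T : measurableType dT}.
Variables (P : probability T R) (W : {RV P >-> 'M[R]_d}).
Hypothesis hW : wishart n Psi (distribution P W).

Let measurable_trace : measurable_fun setT (fun M : 'M[R]_d => \tr M : measurableTypeR R).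
Proof. by apply: measurable_sum => i; exact: measurable_mx_coord. Qed.

Lemma wishart_trace_measurable : measurable_fun setT (fun w => \tr (W w) : measurableTypeR R).
Proof. by apply: (measurableT_comp measurable_trace). Qed.

Let trace_sum (m : nat) (z : 'I_m -> 'cV[R]_d) :
  \tr (\sum_(i < m) z i *m (z i)^T) = \sum_(i < m) \sum_l z i l 0 ^+ 2.
Proof.
rewrite raddf_sum/=; apply: eq_bigr => i _; apply: eq_bigr => l _.
by rewrite mxE big_ord1 mxE expr2.
Qed.

(** [wishart] prescribes only a law, so the expectation is moved to the space that carries the
    Gaussian vectors, where the trace is a sum of independent squared norms. *)
Lemma wishart_trace_laplace s : 0 <= s ->
  (\int[P]_w (expR (- (s * \tr (W w) / 2)))%:E =
   ((Num.sqrt (\det (1%:M + s *: Psi)))^-1 ^+ n)%:E)%E.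
Proof.
move=> s0; have [d' [T' [P' [Z [indep gZ hQ]]]]] := hW.
have mZ i l : measurable_fun setT (fun w => Z i w l 0).
  exact: (measurableT_comp (measurable_mx_coord l 0)).
have L i : 0 < \det (1%:M + s *: Psi) /\
    \int[P']_w expR (- (s * (\sum_l Z i w l 0 ^+ 2) / 2)) =
    (Num.sqrt (\det (1%:M + s *: Psi)))^-1.
  apply: gaussian_vector_laplace => //.
  by move=> t; exact: cos_centered_gaussian.
have mexp : measurable_fun setT (fun x : measurableTypeR R => (expR (- (s * x / 2)))%:E).
  apply/measurable_EFinP; apply: measurableT_comp => //; apply: measurableT_comp => //.
  by apply: measurable_funM => //; exact: measurable_funM.
have msq i : measurable_fun setT (fun w => \sum_l Z i w l 0 ^+ 2).
  by apply: measurable_sum => l; exact: measurable_funX.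
rewrite (@eq_law _ _ (measurableTypeR R) _ _ _ _ P P' (fun w => \tr (W w))
  (fun w => \sum_(i < n) \sum_l Z i w l 0 ^+ 2) _ _ _ _ mexp)//.
- have <- : \prod_(i < n) (Num.sqrt (\det (1%:M + s *: Psi)))^-1 =
      (Num.sqrt (\det (1%:M + s *: Psi)))^-1 ^+ n.
    by rewrite prodr_const card_ord.
  rewrite -(independent_prod (phi := fun=> fun z : 'cV[R]_d => expR (- (s * (\sum_l z l 0 ^+ 2) / 2))) indep)//.
  + apply: eq_integral => w _; congr EFin; rewrite -expR_sum; congr expR.
    by rewrite sumrN mulr_sumr mulr_suml.
  + move=> _; apply: measurableT_comp => //; apply: measurableT_comp => //.
    apply: measurable_funM => //; apply: measurable_funM => //.
    by apply: measurable_sum => l; apply: measurable_funX; exact: measurable_mx_coord.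
  + move=> i; rewrite -(L i).2 /Rintegral fineK//; apply: integrable_fin_num => //.
    apply: (@bounded_integrable _ _ _ P' (fun w => expR (- (s * (\sum_l Z i w l 0 ^+ 2) / 2))) 1).
      apply: measurableT_comp => //; apply: measurableT_comp => //.
      by apply: measurable_funM => //; apply: measurable_funM.
    move=> w; rewrite ger0_norm ?expR_ge0// -[leRHS]expR0 ler_expR oppr_le0.
    by rewrite divr_ge0// mulr_ge0// sumr_ge0// => l _; exact: sqr_ge0.
- exact: wishart_trace_measurable.
- by apply: measurable_sum => i.
- move=> A mA; have mB : measurable ((fun M : 'M[R]_d => \tr M) @^-1` A).
    by rewrite -[X in measurable X]setTI; exact: measurable_trace.
  have := hQ _ mB; rewrite /distribution/= /pushforward => E.
  rewrite [LHS]E; congr (P' _); apply/seteqP; split => w /=; by rewrite trace_sum.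
Qed.

Lemma wishart_trace_ge0 : P [set w | \tr (W w) < 0] = 0%E.
Proof.
have [d' [T' [P' [Z [indep gZ hQ]]]]] := hW.
have mB : measurable ((fun M : 'M[R]_d => \tr M) @^-1` `]-oo, 0[%classic).
  by rewrite -[X in measurable X]setTI; exact: measurable_trace.
have -> : [set w | \tr (W w) < 0] = W @^-1` ((fun M : 'M[R]_d => \tr M) @^-1` `]-oo, 0[%classic).
  by apply/seteqP; split => w /=; rewrite in_itv.
rewrite -[LHS]/(distribution P W _) hQ// (_ : [set w | _] = set0) ?measure0//.
apply/seteqP; split => w //=; rewrite in_itv/= trace_sum ltNge; apply/negP/negPn.
by apply: sumr_ge0 => i _; apply: sumr_ge0 => l _; exact: sqr_ge0.
Qed.

End wishart_laplace.

(** * Size-bias identity for sums of independent Gamma variables *)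

Section weighted_law.
Context {R : realType} {d d' : measure_display}.
Context {T : measurableType d} {S : measurableType d'}.
Variables (m : {measure set T -> \bar R}) (X : T -> S) (w : T -> R).

(** The hypotheses are arguments of the definition so that the measure structure can be attached to
    it. *)
Definition weighted_law of measurable_fun setT X & measurable_fun setT w
  & (forall x, 0 <= w x) := fun A : set S => (\int[m]_(x in X @^-1` A) (w x)%:E)%E.

Hypotheses (mX : measurable_fun setT X) (mw : measurable_fun setT w)
  (w0 : forall x, 0 <= w x).
Local Notation nu := (weighted_law mX mw w0).

Let mXA A : measurable A -> measurable (X @^-1` A).
Proof. by move=> mA; rewrite -[X in measurable X]setTI; exact: mX. Qed.

Let nu0 : nu set0 = 0%E.
Proof. by rewrite /weighted_law preimage_set0 integral_set0. Qed.

Let nu_ge0 A : (0 <= nu A)%E.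
Proof. by apply: integral_ge0 => x _; rewrite lee_fin. Qed.

Let nu_sigma_additive : semi_sigma_additive nu.
Proof.
move=> F mF tF mUF; rewrite /weighted_law preimage_bigcup ge0_integral_bigcup//=.
- by apply: is_cvg_ereal_nneg_natsum => n _; exact: nu_ge0.
- by move=> k; exact: mXA.
- by apply/measurable_EFinP; exact: measurable_funTS.
- by move=> x _; rewrite lee_fin.
- apply/trivIsetP => /= i j _ _ ij; rewrite -preimage_setI.
  by move/trivIsetP : tF => /(_ _ _ _ _ ij) ->//; rewrite preimage_set0.
Qed.

HB.instance Definition _ := isMeasure.Build _ _ _ nu nu0 nu_ge0 nu_sigma_additive.

Lemma integral_weighted_law (phi : S -> \bar R) :
  measurable_fun setT phi -> (forall y, 0 <= phi y)%E ->
  (\int[nu]_y phi y = \int[m]_x ((w x)%:E * phi (X x)))%E.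
Proof.
move=> mphi phi0; apply/esym.
rewrite (@eq_weighted_law _ _ S _ _ _ _ m nu w (cst 1) X id)//.
  by apply: eq_integral => x _; rewrite mul1e.
move=> A mA; rewrite (_ : (fun x => (cst 1 x)%:E) = cst 1%E)//.
by rewrite integral_cst// mul1e.
Qed.

End weighted_law.

Section finite_measure_of.
Context {R : realType} {d : measure_display} {T : measurableType d}.
Variable m : {measure set T -> \bar R}.

(** A copy of [m] that remembers the proof of finiteness, to carry the finite measure structure. *)
Definition finite_measure_of of (m setT < +oo)%E : set T -> \bar R := m.

Hypothesis fm : (m setT < +oo)%E.
Local Notation M := (finite_measure_of fm).

HB.instance Definition _ := Measure.copy M m.

Let M_fin : fin_num_fun M.
Proof.
move=> A mA; rewrite ge0_fin_numE//; apply: le_lt_trans fm.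
by apply: le_measure; rewrite ?inE.
Qed.

HB.instance Definition _ := Measure_isFinite.Build _ _ _ M M_fin.

End finite_measure_of.

Section laplace_measures.
Context {R : realType}.
Local Notation mR := (measurableTypeR R).

(** Equality of the transforms at t = 0 makes [m2] finite as well; the integer values of t then
    conclude. *)
Lemma laplace_unique_ge0 (m1 m2 : {measure set mR -> \bar R}) :
  (m1 setT < +oo)%E -> m1 `]-oo, 0[%classic = 0%E -> m2 `]-oo, 0[%classic = 0%E ->
  (forall t : R, 0 <= t ->
    (\int[m1]_x (expR (- (t * x)))%:E = \int[m2]_x (expR (- (t * x)))%:E)%E) ->
  forall A : set mR, measurable A -> m1 A = m2 A.
Proof.
move=> f1 n1 n2 H.
have f2 : (m2 setT < +oo)%E.
  have := H 0 (lexx _); under eq_integral do rewrite mul0r oppr0 expR0.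
  under [X in _ = X -> _]eq_integral do rewrite mul0r oppr0 expR0.
  by rewrite !integral_cst// !mul1e => <-.
apply: (@laplace_unique _ (finite_measure_of f1) (finite_measure_of f2)) => // k.
have E (m : {measure set mR -> \bar R}) : m `]-oo, 0[%classic = 0%E ->
  (\int[m]_(x in `[0%R, +oo[) (expR (- x) ^+ k)%:E = \int[m]_x (expR (- (k%:R * x)))%:E)%E.
  move=> nm.
  have me : measurable_fun setT (fun x : mR => (expR (- (k%:R * x)))%:E).
    apply/measurable_EFinP; apply: measurableT_comp => //.
    by apply: measurableT_comp => //; exact: measurable_funM.
  rewrite -(setUv (`[0, +oo[%classic : set mR)) ge0_integral_setU//.
  - rewrite [X in (_ + X)%E](_ : _ = 0)%E ?adde0.
      by apply: eq_integral => x _; rewrite -expRM_natl mulrN.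
    rewrite setCitvr; apply: null_set_integral => //.
    exact: measurable_funTS.
  - exact: measurableC.
  - exact: measurable_funTS.
  - by rewrite /disj_set setICr.
by rewrite !E// H.
Qed.

End laplace_measures.

Lemma rderive_seq {R : realType} (f : R -> R) (x a : R) : is_derive x 1 f a ->
  (n.+1%:R * (f (x + n.+1%:R^-1) - f x)) @[n --> \oo] --> a.
Proof.
move=> [df fa].
have H : (h^-1 *: (f (h *: 1 + x) - f x)) @[h --> (0:R)^'] --> a.
  by rewrite -fa /derive; exact: df.
have /cvg_at_rightP/(_ (fun n => harmonic n)) : (h^-1 *: (f (h *: 1 + x) - f x)) @[h --> (0:R)^'+] --> a.
  by apply: cvg_dnbhs_at_right.
move=> /(_ (conj _ cvg_harmonic)) K.
have {}K := K (fun n => harmonic_gt0 n).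
apply: cvg_trans K; apply: near_eq_cvg; near=> n.
by rewrite /GRing.scale/= mulr1 invrK [harmonic n + x]addrC.
Unshelve. all: end_near. Qed.

Lemma cvgy0_le {R : realType} (f : R -> R) (M C : R) :
  (forall x : R, M <= x -> 0 < x -> `|f x| <= C / x) -> f x @[x --> +oo%R] --> (0 : R).
Proof.
move=> fC; apply/cvgrPdist_lt => e e0; near=> x; rewrite sub0r normrN.
have x0 : 0 < x by near: x; exact: nbhs_pinfty_gt.
have Mx : M <= x by near: x; apply: nbhs_pinfty_ge; exact: num_real.
apply: (le_lt_trans (fC x Mx x0)); rewrite ltr_pdivrMr// -ltr_pdivrMl//.
by near: x; apply: nbhs_pinfty_gt; exact: num_real.
Unshelve. all: end_near. Qed.

(** e^x is the power n + 1 of e^(x / (n + 1)), which exceeds x / (n + 1). *)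
Lemma exprn_expRN_le {R : realType} (n : nat) (x : R) : 0 < x ->
  x ^+ n * expR (- x) <= n.+1%:R ^+ n.+1 / x.
Proof.
move=> x0; rewrite ler_pdivlMr// -mulrA [_ * x]mulrC mulrA -exprSr expRN.
rewrite ler_pdivrMr ?expR_gt0// -[X in expR X](@divfK _ n.+1%:R)// expRM_natr -exprMn.
rewrite lerXn2r ?nnegrE ?mulr_ge0 ?expR_ge0 ?ltW//.
by rewrite -ltr_pdivrMl ?ltr0n// mulrC; apply: lt_le_trans (expR_ge1Dx _); rewrite ltrDr.
Qed.

Lemma cvgy0_expRN {R : realType} (k : R) : 0 < k ->
  expR (- (k * x)) @[x --> +oo%R] --> (0 : R).
Proof.
move=> k0; apply: (@cvgy0_le _ _ 0 k^-1) => x _ x0.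
have kx : 0 < k * x by rewrite mulr_gt0.
have := exprn_expRN_le 0 kx; rewrite expr0 mul1r expr1 mul1r invfM.
by rewrite ger0_norm ?expR_ge0.
Qed.

Section exponential_average.
Context {R : realType}.
Notation leb := (@lebesgue_measure R).
Local Notation mR := (measurableTypeR R).

Definition exp_law : set mR -> \bar R :=
  weighted_law leb (@measurable_id _ mR setT) (measurable_exponential_pdf (1 : R))
    (exponential_pdf_ge0 ler01).

HB.instance Definition _ := Measure.on exp_law.

Let exp_law_setT : exp_law setT = 1%E.
Proof. by rewrite /exp_law /weighted_law preimage_setT integral_exponential_pdf. Qed.

HB.instance Definition _ := Measure_isProbability.Build _ _ R exp_law exp_law_setT.

Local Notation E := exp_law.

Lemma ge0_integral_exponential (phi : mR -> \bar R) :
  measurable_fun setT phi -> (forall y, 0 <= phi y)%E ->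
  (\int[E]_u phi u = \int[leb]_(u in `]0%R, +oo[) ((expR (- u))%:E * phi u))%E.
Proof.
move=> mphi phi0.
rewrite /exp_law integral_weighted_law//.
have mf : measurable_fun setT (fun u : mR => (expR (- u))%:E * phi u)%E.
  apply: emeasurable_funM => //; apply/measurable_EFinP.
  by apply: measurableT_comp => //; exact: oppr_measurable.
rewrite integral_itv_obnd_cbnd; last exact: measurable_funTS.
rewrite [RHS]integral_mkcond; apply: eq_integral => x _.
rewrite /exponential_pdf !patchE; case: ifPn => _; last by rewrite mul0e.
by rewrite mul1r mulN1r.
Qed.

Lemma laplace_exponential (t : R) : 0 <= t ->
  (\int[E]_u (expR (- (t * u)))%:E = ((1 + t)^-1)%:E)%E.
Proof.
move=> t0; rewrite ge0_integral_exponential; last 2 first.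
- apply/measurable_EFinP; apply: measurableT_comp => //.
  by apply: measurableT_comp => //; exact: measurable_funM.
- by move=> y; rewrite lee_fin expR_ge0.
have t1 : 0 < 1 + t by lra.
transitivity (\int[leb]_(x in `]0%R, +oo[) (expR (- ((1 + t) * x)))%:E)%E.
  by apply: eq_integral => x _; rewrite -EFinM -expRD; congr (expR _)%:E; ring.
pose F x := - ((1 + t)^-1 * expR (- ((1 + t) * x))).
have dF (x : R) : 0 < x -> is_derive x 1 F (expR (- ((1 + t) * x))).
  by move=> _; rewrite /F; rderive; field; rewrite gt_eqF.
rewrite (ge0_FTC_itv0y (la := - (1 + t)^-1) (lb := 0) dF).
- by rewrite sub0r opprK.
- move=> x _; apply: rderive_continuous; rderive; reflexivity.
- apply: cvg_at_right_filter.
  have -> : - (1 + t)^-1 = F 0 by rewrite /F mulr0 oppr0 expR0 mulr1.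
  suff : {for (0 : R), continuous F} by [].
  apply: rderive_continuous; rewrite /F; rderive; reflexivity.
- rewrite -oppr0; apply: cvgN; rewrite -(mulr0 (1 + t)^-1); apply: cvgM; first exact: cvg_cst.
  exact: cvgy0_expRN.
- by move=> x _; exact: expR_ge0.
Qed.

End exponential_average.

Lemma rderive_sum {R : realType} (I : Type) (r : seq I) (f : I -> R -> R) (x : R) (a : I -> R) :
  (forall i, is_derive x 1 (f i) (a i)) ->
  is_derive x 1 (fun y => \sum_(i <- r) f i y) (\sum_(i <- r) a i).
Proof.
move=> df; elim: r => [|i r IH].
  by rewrite big_nil; under eq_fun do rewrite big_nil; exact: rderive_cst.
by rewrite big_cons; under eq_fun do rewrite big_cons; exact: rderiveD.
Qed.

Lemma exists_measure_sum {R : realType} {d : measure_display} {S : measurableType d}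
    (I : finType) (m : I -> {measure set S -> \bar R}) :
  exists M : {measure set S -> \bar R}, forall phi : S -> \bar R,
    measurable_fun setT phi -> (forall y, 0 <= phi y)%E ->
    (\int[M]_y phi y = \sum_i \int[m i]_y phi y)%E.
Proof.
have [i0 _|noI] := pickP (xpredT : pred I); last first.
  exists mzero => phi mphi phi0; rewrite integral_measure_zero big1// => i.
  by have := noI i.
exists (msum (fun n => m (nth i0 (enum I) n)) #|I|) => phi mphi phi0.
rewrite ge0_integral_measure_sum// cardT.
transitivity (\sum_(i <- enum I) \int[m i]_y phi y)%E; last by rewrite big_enum.
by rewrite (big_nth i0) big_mkord.
Qed.

Section bias.
Context {R : realType} {d : measure_display} {T : measurableType d}.
Local Notation mR := (measurableTypeR R).
Local Notation E := (@exp_law R).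
Variables (P : probability T R) (X : T -> mR).
Hypothesis mX : measurable_fun setT X.
Hypothesis X0 : forall w, 0 <= X w.
Variables (I : finType) (al be : I -> R).
Hypothesis al0 : forall i, 0 < al i.
Hypothesis be0 : forall i, 0 < be i.
(** The transform of a sum of independent Gamma variables of shapes [al i] and scales [be i], in
    exponential form so that its derivative is one chain rule. *)
Definition gamma_laplace (t : R) := expR (- \sum_i al i * ln (1 + be i * t)).
Hypothesis HL : forall t : R, 0 <= t ->
  (\int[P]_w (expR (- (t * X w)))%:E = (gamma_laplace t)%:E)%E.

Let den_gt0 i (t : R) : 0 <= t -> 0 < 1 + be i * t.
Proof. by move=> t0; rewrite ltr_wpDr// mulr_ge0// ltW. Qed.

Lemma gamma_laplace_derive (t : R) : 0 <= t ->
  is_derive t 1 gamma_laplace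
    (- (gamma_laplace t * \sum_i al i * be i / (1 + be i * t))).
Proof.
move=> t0; rewrite /gamma_laplace.
have H : is_derive t 1 (fun t : R => \sum_i al i * ln (1 + be i * t))
    (\sum_i al i * be i / (1 + be i * t)).
  apply: rderive_sum => i; have b0 := den_gt0 i t0.
  by rderive => //; field; rewrite gt_eqF.
by rderive; rewrite mulrN.
Qed.

Let mexp (t : R) : measurable_fun setT (fun w => expR (- (t * X w))).
Proof.
apply: measurableT_comp => //; apply: measurableT_comp => //.
exact: measurable_funM.
Qed.

Let integ (t : R) : 0 <= t -> P.-integrable setT (fun w => (expR (- (t * X w)))%:E).
Proof.
move=> t0; apply: (@bounded_integrable _ _ _ P _ 1) => // w.
by rewrite ger0_norm ?expR_ge0// -[leRHS]expR0 ler_expR oppr_le0 mulr_ge0.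
Qed.

Let q (t : R) (n : nat) w := n.+1%:R * (expR (- (t * X w)) - expR (- ((t + n.+1%:R^-1) * X w))).

Let int_q (t : R) n : 0 <= t ->
  (\int[P]_w (q t n w)%:E = (n.+1%:R * (gamma_laplace t - gamma_laplace (t + n.+1%:R^-1)))%:E)%E.
Proof.
move=> t0; have t1 : 0 <= t + n.+1%:R^-1 by rewrite addr_ge0.
under eq_integral do rewrite /q EFinM EFinB.
rewrite integralZl//=; last first.
  exact: (integrableB measurableT (integ t0) (integ t1)).
by rewrite (integralB measurableT (integ t0) (integ t1)) !HL.
Qed.

Let q_ge0 t n w : 0 <= q t n w.
Proof.
rewrite /q mulr_ge0// subr_ge0 ler_expR lerN2 mulrDl lerDl mulr_ge0//.
Qed.

Let q_le t n w : q t n w <= X w * expR (- (t * X w)).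
Proof.
rewrite /q mulrDl opprD expRD -[X in X - _]mulr1 -mulrBr mulrCA mulrC ler_wpM2r ?expR_ge0//.
rewrite -ler_pdivlMl ?ltr0n// lerBlDr addrC -lerBlDr.
exact: expR_ge1Dx.
Qed.

Let cvg_q (f : R -> R) (t a : R) : is_derive t 1 f (- a) ->
  n.+1%:R * (f t - f (t + n.+1%:R^-1)) @[n --> \oo] --> a.
Proof.
move=> /rderive_seq/cvgN; rewrite opprK; apply: cvg_trans; apply: near_eq_cvg.
by apply: nearW => n; rewrite -[- _ n]/(- (_ * _)) -mulrN opprB.
Qed.

(** Minus the derivative of the transform, found without prior integrability: the difference
    quotients [q] lie below X e^(-t X) and converge to it, so monotonicity of the integral gives one
    inequality and Fatou's lemma the other. At t = 0 this produces the mean. *)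
Lemma weighted_laplace (t : R) : 0 <= t ->
  (\int[P]_w (X w * expR (- (t * X w)))%:E =
   (gamma_laplace t * \sum_i al i * be i / (1 + be i * t))%:E)%E.
Proof.
move=> t0; set r := RHS.
have mXe : measurable_fun setT (fun w => X w * expR (- (t * X w))).
  exact: measurable_funM.
have mq n : measurable_fun setT (q t n).
  by apply: measurable_funM => //; apply: measurable_funB.
have Lq : (\int[P]_w (q t n w)%:E)%E @[n --> \oo] --> r.
  under eq_cvg do rewrite int_q//.
  by apply: cvg_EFin; [exact: nearW|apply: cvg_q; exact: gamma_laplace_derive].
apply/eqP; rewrite eq_le; apply/andP; split; last first.
  apply: (@cvge_to_le _ _ _ _ _ _ _ Lq); apply: nearW => n.
  apply: ge0_le_integral => //.
  - by move=> w _; rewrite lee_fin.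
  - exact/measurable_EFinP.
  - exact/measurable_EFinP.
  - by move=> w _; rewrite lee_fin.
have := @fatou _ _ _ P setT measurableT (fun n w => (q t n w)%:E).
rewrite (is_cvg_limn_einfE (cvgP _ Lq)) (cvg_lim _ Lq)// => H.
apply: le_trans (H _ _); last 2 first.
- by move=> n; apply/measurable_EFinP.
- by move=> n w _; rewrite lee_fin.
rewrite le_eqVlt; apply/orP; left; apply/eqP; apply: eq_integral => w _.
have Q : (q t n w)%:E @[n --> \oo] --> (X w * expR (- (t * X w)))%:E.
  apply: cvg_EFin; first exact: nearW.
  apply: (@cvg_q (fun t => expR (- (t * X w)))).
  rderive; ring.
by rewrite (is_cvg_limn_einfE (cvgP _ Q)) (cvg_lim _ Q).
Qed.

(** Both sides integrate [phi] against a measure on the half-line: the law of X weighted by X, and a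
    mixture of the laws of X + be_i u. The factor 1 / (1 + be_i t) in the derivative of the
    transform is the transform of be_i u, so the two Laplace transforms coincide. *)
Lemma ge0_bias_identity (phi : mR -> \bar R) : measurable_fun setT phi -> (forall y, 0 <= phi y)%E ->
  (\int[P]_w ((X w)%:E * phi (X w)) =
   \sum_i (al i * be i)%:E * \int[P]_w \int[E]_u phi (X w + be i * u)%R)%E.
Proof.
pose Y i (z : T * mR) : mR := X z.1 + be i * z.2.
have mY i : measurable_fun setT (Y i).
  apply: measurable_funD; first exact: measurableT_comp.
  by apply: measurable_funM => //; exact: measurable_snd.
have c0 i : 0 <= al i * be i by rewrite mulr_ge0// ltW.
pose m1 := weighted_law P mX mX X0.
pose m2 i := weighted_law (P \x E)%E (mY i) (measurable_cst (al i * be i)) (fun=> c0 i).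
have [M HM] := exists_measure_sum (fun i => m2 i : {measure set mR -> \bar R}).
have M2 i (psi : mR -> \bar R) : measurable_fun setT psi -> (forall y, 0 <= psi y)%E ->
    (\int[m2 i]_y psi y = (al i * be i)%:E * \int[P]_w \int[E]_u psi (X w + be i * u)%R)%E.
  move=> mpsi psi0; rewrite integral_weighted_law// ge0_integralZl_EFin//.
    by rewrite fubini_tonelli1//; exact: measurableT_comp.
  by apply: measurableT_comp.
move=> mphi phi0.
suff H : forall A, measurable A -> m1 A = M A.
  rewrite -(integral_weighted_law P mX mX X0 mphi phi0).
  rewrite (@eq_law _ _ mR _ _ mR mR m1 M id id _ _ H)// HM//.
  by apply: eq_bigr => i _; rewrite M2.
have mexpt (t : R) : measurable_fun setT (fun x : mR => (expR (- (t * x)))%:E).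
  apply/measurable_EFinP; apply: measurableT_comp => //.
  by apply: measurableT_comp => //; exact: measurable_funM.
have lap1 t : 0 <= t -> (\int[m1]_x (expR (- (t * x)))%:E =
    (gamma_laplace t * \sum_i al i * be i / (1 + be i * t))%:E)%E.
  move=> t0; rewrite integral_weighted_law//.
  by rewrite -weighted_laplace//; apply: eq_integral => w _; rewrite EFinM.
have lap2 t i : 0 <= t -> (\int[m2 i]_x (expR (- (t * x)))%:E =
    (gamma_laplace t * (al i * be i / (1 + be i * t)))%:E)%E.
  move=> t0; rewrite M2//.
  transitivity ((al i * be i)%:E * \int[P]_w ((expR (- (t * X w)))%:E * ((1 + t * be i)^-1)%:E))%E.
    congr (_ * _)%E; apply: eq_integral => w _.
    rewrite -laplace_exponential ?mulr_ge0//; last by rewrite ltW.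
    rewrite -ge0_integralZl_EFin ?expR_ge0//.
    apply: eq_integral => u _; rewrite -EFinM -expRD; congr (expR _)%:E; ring.
  rewrite ge0_integralZr//.
  - by rewrite HL// -!EFinM; congr EFin; rewrite [t * be i]mulrC; ring.
  - by apply/measurable_EFinP.
  - by rewrite lee_fin invr_ge0 addr_ge0// mulr_ge0// ltW.
apply: laplace_unique_ge0.
- have := lap1 0 (lexx _); under eq_integral do rewrite mul0r oppr0 expR0.
  by rewrite integral_cst// mul1e => ->; rewrite ltry.
- rewrite /m1 /= /weighted_law (_ : X @^-1` _ = set0) ?integral_set0//.
  by apply/seteqP; split => w //=; rewrite in_itv/= ltNge X0.
- have mI : measurable_fun setT (fun x : mR => (\1_(`]-oo, 0[%classic : set mR) x : R)%:E).
    by apply/measurable_EFinP; exact: measurable_indic.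
  transitivity (\int[M]_x (\1_(`]-oo, 0[%classic : set mR) x : R)%:E)%E.
    by rewrite integral_indic// setIT.
  rewrite HM//.
  rewrite big1// => i _; rewrite M2//.
  rewrite integral0_eq ?mule0// => w _; rewrite ge0_integral_exponential//.
  + apply: integral0_eq => u; rewrite /= in_itv/= andbT => u0.
    rewrite indicE memNset ?mule0// /= in_itv/=; apply/negP; rewrite -leNgt.
    by rewrite addr_ge0// mulr_ge0// ltW.
  + apply: (measurableT_comp mI); exact: measurable_funD.
- move=> t t0; rewrite lap1// HM//.
  rewrite mulr_sumr -sumEFin; apply: eq_bigr => i _.
  by rewrite lap2.
Qed.

End bias.

(** A nonnegative weight commutes with positive and negative parts, so an identity between integrals
    of nonnegative functions passes to integrable ones, integrability included. *)
Lemma integral_signed_transfer {R : realType} {d1 d2 : measure_display}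
    {T1 : measurableType d1} {T2 : measurableType d2} {dS : measure_display}
    {S : measurableType dS}
    (m1 : {measure set T1 -> \bar R}) (m2 : {measure set T2 -> \bar R})
    (D1 : set T1) (D2 : set T2)
    (w1 : T1 -> R) (w2 : T2 -> R) (X1 : T1 -> S) (X2 : T2 -> S) (phi : S -> R) :
  measurable D1 -> measurable D2 ->
  (forall x, 0 <= w1 x) -> (forall x, 0 <= w2 x) ->
  measurable_fun D2 (fun x => w2 x * phi (X2 x)) ->
  measurable_fun setT phi ->
  (forall psi : S -> R, measurable_fun setT psi -> (forall y, 0 <= psi y) ->
    (\int[m1]_(x in D1) (w1 x * psi (X1 x))%:E = \int[m2]_(x in D2) (w2 x * psi (X2 x))%:E)%E) ->
  m1.-integrable D1 (fun x => (w1 x * phi (X1 x))%:E) ->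
  m2.-integrable D2 (fun x => (w2 x * phi (X2 x))%:E) /\
  (\int[m1]_(x in D1) (w1 x * phi (X1 x))%:E = \int[m2]_(x in D2) (w2 x * phi (X2 x))%:E)%E.
Proof.
move=> mD1 mD2 w10 w20 mw2 mphi H int1.
have abs (w y : R) : 0 <= w -> `|w * y| = w * `|y| by move=> w0; rewrite normrM ger0_norm.
split.
  apply/integrableP; split; first exact/measurable_EFinP.
  have /integrableP[_] := int1.
  under eq_integral do rewrite abse_EFin abs//.
  under [X in _ -> (X < _)%E]eq_integral do rewrite abse_EFin abs//.
  by rewrite (H (fun y => `|phi y|))//; exact: measurableT_comp.
have P (w y : R) : 0 <= w -> Num.max (w * y) 0 = w * Num.max y 0.
  by move=> w0; rewrite maxr_pMr// mulr0.
have N (w y : R) : 0 <= w -> Num.max (- (w * y)) 0 = w * Num.max (- y) 0.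
  by move=> w0; rewrite maxr_pMr// mulr0 mulrN.
rewrite integralE [in RHS]integralE; congr (_ - _)%E.
  transitivity (\int[m1]_(x in D1) (w1 x * Num.max (phi (X1 x)) 0)%:E)%E.
    by apply: eq_integral => x _; rewrite funeposE -P// EFin_max.
  rewrite (H (fun y => Num.max (phi y) 0)).
  - by apply: eq_integral => x _; rewrite funeposE -P// EFin_max.
  - exact: measurable_maxr.
  - by move=> y; rewrite le_max lexx orbT.
transitivity (\int[m1]_(x in D1) (w1 x * Num.max (- phi (X1 x)) 0)%:E)%E.
  by apply: eq_integral => x _; rewrite funenegE -N// EFin_max.
rewrite (H (fun y => Num.max (- phi y) 0)).
- by apply: eq_integral => x _; rewrite funenegE -N// EFin_max.
- by apply: measurable_maxr => //; exact: measurableT_comp.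
- by move=> y; rewrite le_max lexx orbT.
Qed.

Section signed.
Context {R : realType}.
Notation leb := (@lebesgue_measure R).
Local Notation mR := (measurableTypeR R).
Local Notation E := (@exp_law R).

Lemma integral_exponential (phi : mR -> R) : measurable_fun setT phi ->
  E.-integrable setT (fun u => (phi u)%:E) ->
  leb.-integrable `]0%R, +oo[ (fun u => (expR (- u) * phi u)%:E) /\
  (\int[E]_u (phi u)%:E = \int[leb]_(u in `]0%R, +oo[) (expR (- u) * phi u)%:E)%E.
Proof.
move=> mphi ip.
have me : measurable_fun setT (fun u : mR => expR (- u)).
  by apply: measurableT_comp => //; exact: oppr_measurable.
have c1 (f : mR -> R) : (fun u => (f u)%:E) = (fun u => (cst 1 u * f u)%:E).
  by apply/funext => u; rewrite mul1r.
move: ip; rewrite c1 => ip.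
apply: (integral_signed_transfer (X2 := id) (w2 := fun u : mR => expR (- u)) _ _ _ _ _ _ _ ip) => //.
- by apply: measurable_funTS; exact: measurable_funM.
- move=> psi mpsi psi0; rewrite -(c1 psi).
  by rewrite ge0_integral_exponential//; exact/measurable_EFinP.
Qed.

End signed.

Section bias_signed.
Context {R : realType} {d : measure_display} {T : measurableType d}.
Notation leb := (@lebesgue_measure R).
Local Notation mR := (measurableTypeR R).
Local Notation E := (@exp_law R).
Variables (P : probability T R) (X : T -> mR).
Hypothesis mX : measurable_fun setT X.
Hypothesis X0 : forall w, 0 <= X w.
Variables (I : finType) (al be : I -> R).
Hypothesis al0 : forall i, 0 < al i.
Hypothesis be0 : forall i, 0 < be i.
Hypothesis HL : forall t : R, 0 <= t ->
  (\int[P]_w (expR (- (t * X w)))%:E = (gamma_laplace al be t)%:E)%E.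

(** The atom at 0 is at most the transform at every t >= 0, and a single factor of the transform
    already tends to 0. *)
Lemma gamma_null0 (i : I) : P (X @^-1` [set 0]) = 0%E.
Proof.
set p := P _.
have mX0 : measurable (X @^-1` [set 0]).
  by rewrite -[X in measurable X]setTI; exact: mX.
have pf : p \is a fin_num by rewrite fin_num_measure.
have H (y : R) : 0 < y -> (p <= ((al i * y)^-1)%:E)%E.
  (* For this [t] the factor of index i equals e^(- al i * y). *)
  move=> y0; pose t := (expR y - 1) / be i.
  have t0 : 0 <= t.
    rewrite divr_ge0//; last exact: ltW.
    by rewrite subr_ge0 -[leLHS]expR0 ler_expR ltW.
  apply: (@le_trans _ _ (gamma_laplace al be t)%:E).
    rewrite -HL//.
    have A : (\int[P]_(w in X @^-1` [set 0%R]) (expR (- (t * X w)))%:E = p)%E.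
      rewrite (eq_integral (cst 1%E)).
        by rewrite integral_cst// mul1e.
      by move=> w; rewrite inE/= => ->; rewrite mulr0 oppr0 expR0.
    rewrite -A; apply: ge0_subset_integral => //.
    apply/measurable_EFinP; apply: measurableT_comp => //.
    apply: measurableT_comp => //; exact: measurable_funM.
  rewrite lee_fin /gamma_laplace (bigD1 i)//= opprD expRD.
  have ay : 0 < al i * y by rewrite mulr_gt0.
  apply: (@le_trans _ _ (expR (- (al i * y)) * 1)).
    rewrite ler_pM ?expR_ge0//.
      rewrite /t mulrCA divff ?gt_eqF// mulr1 addrCA subrr addr0 expRK.
      exact: lexx.
    rewrite -[leRHS]expR0 ler_expR oppr_le0 sumr_ge0// => j _.
    rewrite mulr_ge0//; first exact: ltW.
    by rewrite ln_ge0// lerDl mulr_ge0// ltW.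
  rewrite mulr1 expRN lef_pV2 ?posrE ?expR_gt0//.
  by apply: le_trans (expR_ge1Dx _); rewrite lerDr.
have [//|p0] := eqVneq p 0%E.
have pg : 0 < fine p by rewrite fine_gt0// lt0e p0 measure_ge0/= ltey_eq pf.
(* The value y = 2 / (al i * p) turns the bound into p <= p / 2. *)
have := H (2 / (al i * fine p)) _.
rewrite -[p]fineK// lee_fin => H2.
move: (H2 (divr_gt0 (ltr0n _ 2) (mulr_gt0 (al0 i) pg))).
have -> : (al i * (2 / (al i * fine p)))^-1 = fine p / 2.
  by field; rewrite !gt_eqF.
by move=> h; exfalso; clear H2; lra.
Qed.

Let Y i (z : T * mR) : mR := X z.1 + be i * z.2.
Let Q := (P \x E)%E.

Let mY i : measurable_fun setT (Y i).
Proof.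
apply: measurable_funD; first exact: measurableT_comp.
by apply: measurable_funM => //; exact: measurable_snd.
Qed.

Let c_ge0 i : 0 <= al i * be i.
Proof. by rewrite mulr_ge0// ltW. Qed.

Let ge0_bias (phi : mR -> R) : measurable_fun setT phi -> (forall y, 0 <= phi y) ->
  (\int[P]_w (X w * phi (X w))%:E =
   \sum_i (al i * be i)%:E * \int[Q]_z (phi (Y i z))%:E)%E.
Proof.
move=> mphi phi0; under eq_integral do rewrite EFinM.
rewrite (ge0_bias_identity mX X0 al0 be0 HL (phi := fun x => (phi x)%:E)).
- apply: eq_bigr => i _; congr (_ * _)%E.
  rewrite (@fubini_tonelli1 _ _ _ _ _ P E (fun z => (phi (Y i z))%:E))//.
    by apply/measurable_EFinP; exact: measurableT_comp.
  by move=> z; rewrite lee_fin.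
- exact/measurable_EFinP.
- by move=> y; rewrite lee_fin.
Qed.

(** The identity for |phi| has a finite left side, and on the right nonnegative terms with positive
    coefficients: each of them is finite. *)
Lemma bias_integrable (phi : mR -> R) : measurable_fun setT phi ->
  P.-integrable setT (fun w => (X w * phi (X w))%:E) ->
  forall i, Q.-integrable setT (fun z => (phi (Y i z))%:E).
Proof.
move=> mphi /integrableP[_ fin] i; apply/integrableP; split.
  by apply/measurable_EFinP; exact: measurableT_comp.
have := ge0_bias (measurableT_comp (@normr_measurable R setT) mphi) (fun y => normr_ge0 _).
move: fin; under eq_integral do rewrite abse_EFin normrM ger0_norm//.
move=> fin E1; move: fin; rewrite E1 (bigD1 i)//= => /(le_lt_trans (leeDl _ _)) => H.
have {}H : ((al i * be i)%:E * \int[Q]_z `|(phi (Y i z))%:E| < +oo)%E.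
  apply: H; apply: sume_ge0 => j _; rewrite mule_ge0 ?lee_fin//.
  by apply: integral_ge0 => z _; rewrite lee_fin.
have c0 : 0 < al i * be i by rewrite mulr_gt0.
by move: H; rewrite -lte_pdivlMl// mulry gtr0_sg ?invr_gt0// mul1e.
Qed.

Let fin_bias (phi : mR -> R) : measurable_fun setT phi -> (forall y, 0 <= phi y) ->
  P.-integrable setT (fun w => (X w * phi (X w))%:E) ->
  \int[P]_w (X w * phi (X w)) = \sum_i al i * be i * \int[Q]_z phi (Y i z).
Proof.
move=> mphi phi0 ip; have iq := bias_integrable mphi ip.
rewrite {1}/Rintegral ge0_bias//.
have K i : ((al i * be i)%:E * \int[Q]_z (phi (Y i z))%:E =
    (al i * be i * \int[Q]_z phi (Y i z))%:E)%E.
  by rewrite [RHS]EFinM /Rintegral fineK//; exact: integrable_fin_num.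
by under eq_bigr do rewrite K; rewrite sumEFin.
Qed.

(** phi is the difference of the nonnegative functions |phi| + phi and |phi|. *)
Lemma bias_identity (phi : mR -> R) : measurable_fun setT phi ->
  P.-integrable setT (fun w => (X w * phi (X w))%:E) ->
  \int[P]_w (X w * phi (X w)) = \sum_i al i * be i * \int[Q]_z phi (Y i z).
Proof.
move=> mphi ip.
have mabs : measurable_fun setT (fun y => `|phi y|) by exact: measurableT_comp.
have iabs : P.-integrable setT (fun w => (X w * `|phi (X w)|)%:E).
  have := integrable_abse ip; apply: eq_integrable => // w _ /=.
  by rewrite normrM ger0_norm.
have isum : P.-integrable setT (fun w => (X w * (`|phi (X w)| + phi (X w)))%:E).
  have := integrableD measurableT iabs ip; apply: eq_integrable => // w _ /=.
  by rewrite -EFinD mulrDr.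
have msum : measurable_fun setT (fun y => `|phi y| + phi y) by exact: measurable_funD.
have sum0 y : 0 <= `|phi y| + phi y by have := ler_norm (- phi y); rewrite normrN; lra.
transitivity (\int[P]_w (X w * (`|phi (X w)| + phi (X w))) - \int[P]_w (X w * `|phi (X w)|)).
  rewrite -RintegralB//; apply: eq_Rintegral => w _; ring.
rewrite (fin_bias msum sum0 isum) (fin_bias mabs _ iabs)// -sumrB.
apply: eq_bigr => i _; rewrite -mulrBr -RintegralB//; last 2 first.
- exact: (bias_integrable msum isum).
- exact: (bias_integrable mabs iabs).
by congr (_ * _); apply: eq_Rintegral => z _; ring.
Qed.

End bias_signed.

(** * Smoothing by an independent exponential variable *)

Section smoothing.
Context {R : realType}.
Notation leb := (@lebesgue_measure R).
Local Notation mR := (measurableTypeR R).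
Local Notation E := (@exp_law R).

(** - e^(-u) g(x + b u) is a primitive of e^(-u) (g - b g')(x + b u). The two terms are kept
    together, so that integrability is asked of their difference only. *)
Lemma exp_law_ibp (b x : R) (g g' : R -> R) : 0 < b -> 0 < x ->
  measurable_fun setT (g : mR -> mR) -> measurable_fun setT (g' : mR -> mR) ->
  (forall y : R, 0 < y -> is_derive y 1 g (g' y)) ->
  (forall y : R, 0 < y -> {for y, continuous g'}) ->
  expR (- u) * g (x + b * u) @[u --> +oo%R] --> (0 : R) ->
  E.-integrable setT (fun u => (g (x + b * u) - b * g' (x + b * u))%:E) ->
  (\int[E]_u (g (x + b * u) - b * g' (x + b * u))%:E = (g x)%:E)%E.
Proof.
move=> b0 x0 mg mg' dg cg' gy ig.
pose k u := g (x + b * u) - b * g' (x + b * u).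
have maff : measurable_fun setT (fun u : mR => x + b * u : mR).
  by apply: measurable_funD => //; exact: measurable_funM.
have mk : measurable_fun setT (k : mR -> mR).
  apply: measurable_funB; first exact: (measurableT_comp mg).
  by apply: measurable_funM => //; exact: (measurableT_comp mg').
have [ik ->] := integral_exponential mk ig.
pose F u := - (expR (- u) * g (x + b * u)).
(* Since x > 0 there is room to the left of u = 0, and the primitive is differentiable at the
   endpoint itself. *)
have pos (u : R) : - (x / b) < u -> 0 < x + b * u.
  by move=> H; rewrite -ltrBlDl sub0r mulrC -ltr_pdivrMr// mulNr.
have dF (u : R) : - (x / b) < u -> is_derive u 1 F (expR (- u) * k u).
  move=> /pos u0; have H : is_derive u 1 (fun u => g (x + b * u)) (g' (x + b * u) * b).
    apply: (rderive_comp (f := fun u => x + b * u)); last exact: dg.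
    by rderive; ring.
  by rewrite /F; rderive; rewrite /k; ring.
have dF0 (u : R) : 0 < u -> is_derive u 1 F (expR (- u) * k u).
  by move=> u0; apply: dF; apply: lt_trans u0; rewrite oppr_lt0 divr_gt0.
rewrite (FTC_itv0y (la := - g x) (lb := 0) dF0)//.
- by rewrite sub0r opprK.
- move=> u u0; have xu : 0 < x + b * u by rewrite addr_gt0// mulr_gt0.
  have caff : {for u, continuous (fun u : R => x + b * u)}.
    by apply: rderive_continuous; rderive; reflexivity.
  apply: continuousM.
    by apply: rderive_continuous; rderive; reflexivity.
  apply: continuousB.
    apply: (continuous_comp caff); exact: (rderive_continuous (dg _ xu)).
  apply: continuousM; first exact: cvg_cst.
  by apply: (continuous_comp caff); exact: cg'.
- apply: cvg_at_right_filter.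
  have -> : - g x = F 0 by rewrite /F oppr0 expR0 mul1r mulr0 addr0.
  suff : {for (0 : R), continuous F} by [].
  by apply: rderive_continuous; apply: dF; rewrite oppr_lt0 divr_gt0.
- by rewrite -oppr0; apply: cvgN.
Qed.

Context {d : measure_display} {T : measurableType d}.
Variables (P : probability T R) (X : T -> mR).
Hypothesis mX : measurable_fun setT X.
Hypothesis X0 : forall w, 0 <= X w.
Hypothesis PX0 : P (X @^-1` [set 0]) = 0%E.
Local Notation Q := (P \x E)%E.
Local Notation Y b := (fun z : T * mR => X z.1 + b * z.2).

(** [exp_law_ibp] applies on almost every fibre, as g is differentiable at positive arguments and X
    = 0 is a null event. The integrability of g(X) is that of a partial integral of the integrable
    [k]. *)
Lemma exp_smoothing (b : R) (g g' : R -> R) : 0 < b ->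
  measurable_fun setT (g : mR -> mR) -> measurable_fun setT (g' : mR -> mR) ->
  (forall y : R, 0 < y -> is_derive y 1 g (g' y)) ->
  (forall y : R, 0 < y -> {for y, continuous g'}) ->
  (forall x : R, 0 < x -> expR (- u) * g (x + b * u) @[u --> +oo%R] --> (0 : R)) ->
  Q.-integrable setT (fun z => (g (Y b z))%:E) ->
  Q.-integrable setT (fun z => (g' (Y b z))%:E) ->
  P.-integrable setT (fun w => (g (X w))%:E) /\
  \int[Q]_z g (Y b z) = \int[P]_w g (X w) + b * \int[Q]_z g' (Y b z).
Proof.
move=> b0 mg mg' dg cg' gy ig ig'.
pose k z := g (Y b z) - b * g' (Y b z).
have ik : Q.-integrable setT (fun z => (k z)%:E).
  have := integrableB measurableT ig (integrableZl measurableT b ig').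
  by apply: eq_integrable => // z _; rewrite /= /k -EFinM -EFinB.
have mgX : measurable_fun setT (fun w => (g (X w))%:E).
  by apply/measurable_EFinP; exact: (measurableT_comp mg).
have ae : ae_eq P setT (fubini_F E (fun z => (k z)%:E)) (fun w => (g (X w))%:E).
  have N0 : {ae P, forall w, 0 < X w}.
    exists (X @^-1` [set 0]); split => //.
      by rewrite -[X in measurable X]setTI; exact: mX.
    move=> w /= /negP; rewrite -leNgt => Xw.
    by apply/eqP; rewrite eq_le Xw X0.
  apply: filterS2 N0 (ae_integrable1 ik) => w Xw ikw _.
  by rewrite /fubini_F; exact: (exp_law_ibp b0 Xw mg mg' dg cg' (gy _ Xw) ikw).
have mF := measurable_fubini_F ik.
have igX : P.-integrable setT (fun w => (g (X w))%:E).
  have /integrableP[_ fin] := integrable_fubini_F ik.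
  apply/integrableP; split => //; apply: le_lt_trans fin.
  rewrite le_eqVlt; apply/orP; left; apply/eqP; apply: ae_eq_integral => //.
  - exact: measurableT_comp.
  - exact: measurableT_comp.
  - by apply: filterS ae => w H /H /= ->.
split => //.
have : (\int[P]_w (g (X w))%:E = \int[Q]_z (k z)%:E)%E.
  rewrite -integral12_prod_meas1//; apply: ae_eq_integral => //.
  by apply: filterS ae => w H /H /= ->.
move=> /(congr1 fine); rewrite -/(Rintegral _ _ _) -/(Rintegral _ _ _) => ->.
rewrite RintegralB//; last exact: (integrableZl measurableT b ig').
by rewrite RintegralZl// subrK.
Qed.

End smoothing.

(** * Comparison and limits on the positive half-line *)

Section halfline.
Context {R : realType}.
Implicit Types f F : R -> R.

Lemma halfline_MVT F f (x y : R) : (forall z : R, 0 < z -> is_derive z 1 F (f z)) ->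
  0 < x -> x < y -> exists2 c, x < c < y & F y - F x = f c * (y - x).
Proof.
move=> dF x0 xy.
have dFi z : z \in `]x, y[%R -> is_derive z 1 F (f z).
  by rewrite in_itv/= => /andP[xz _]; apply: dF; exact: lt_trans xz.
have cF : {within `[x, y], continuous F}.
  apply: derivable_within_continuous => z; rewrite in_itv/= => /andP[xz _].
  by have [] := dF z (lt_le_trans x0 xz).
by have [c cxy E] := MVT xy dFi cF; exists c => //; move: cxy; rewrite in_itv.
Qed.

Lemma halfline_nondecreasing F f (x y : R) : (forall z : R, 0 < z -> is_derive z 1 F (f z)) ->
  (forall z, x < z -> z < y -> 0 <= f z) -> 0 < x -> x <= y -> F x <= F y.
Proof.
move=> dF f0 x0; rewrite le_eqVlt => /predU1P[->//|xy].
have [c /andP[xc cy] E] := halfline_MVT dF x0 xy.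
by rewrite -subr_ge0 E mulr_ge0 ?subr_ge0 ?(ltW xy)// f0.
Qed.

Lemma halfline_ge0 F f : (forall z : R, 0 < z -> is_derive z 1 F (f z)) ->
  (forall z, 0 < z -> 0 <= f z) -> F x @[x --> (0:R)^'+] --> (0 : R) ->
  forall x, 0 < x -> 0 <= F x.
Proof.
move=> dF f0 F0 x x0; apply: (cvgr_to_le F0); near=> y.
have y0 : 0 < y by near: y; exact: nbhs_right_gt.
have yx : y <= x by near: y; exact: nbhs_right_le.
by apply: (halfline_nondecreasing dF) => // z yz _; apply: f0; exact: lt_trans yz.
Unshelve. all: end_near. Qed.

Lemma halfline_ge0y F f (x0 : R) : 0 < x0 -> (forall z : R, 0 < z -> is_derive z 1 F (f z)) ->
  (forall z, x0 < z -> f z <= 0) -> F x @[x --> +oo%R] --> (0 : R) ->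
  forall x, x0 <= x -> 0 <= F x.
Proof.
move=> x00 dF f0 F0 x xx0; apply: (cvgr_to_le F0); near=> y.
have xy : x <= y by near: y; apply: nbhs_pinfty_ge; exact: num_real.
have x'0 : 0 < x by exact: lt_le_trans xx0.
rewrite -lerN2; apply: (halfline_nondecreasing (F := fun y => - F y) (f := fun y => - f y)) => //.
  by move=> z z0; apply: rderiveN; exact: dF.
by move=> z yz _; rewrite oppr_ge0 f0//; exact: le_lt_trans yz.
Unshelve. all: end_near. Qed.

Lemma halfline_lipschitz F f (C x y : R) : (forall z : R, 0 < z -> is_derive z 1 F (f z)) ->
  0 < x -> x <= y -> (forall z, x < z -> z < y -> `|f z| <= C) -> `|F y - F x| <= C * (y - x).
Proof.
move=> dF x0; rewrite le_eqVlt => /predU1P[->|xy] fC.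
  by rewrite !subrr normr0 mulr0.
have [c /andP[xc cy] ->] := halfline_MVT dF x0 xy.
by rewrite normrM [`|y - x|]ger0_norm ?subr_ge0 ?(ltW xy)// ler_wpM2r ?subr_ge0 ?(ltW xy)// fC.
Qed.

Lemma measurable_halfline f : (forall x : R, 0 < x -> {for x, continuous f}) ->
  measurable_fun setT (f \_ `]0%R, +oo[).
Proof.
move=> cf; apply: (measurable_restrictT _ _).1 => //.
apply: open_continuous_measurable_fun; first exact: interval_open.
by move=> x; rewrite inE/= in_itv/= andbT => /cf.
Qed.

Lemma cvgy0_sum F G : F x @[x --> +oo%R] --> (0 : R) -> G x @[x --> +oo%R] --> (0 : R) ->
  F x + G x @[x --> +oo%R] --> (0 : R).
Proof. by move=> F0 G0; rewrite -[X in _ --> X]addr0; exact: cvgD. Qed.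

Lemma cvgy0_scale F (c : R) : F x @[x --> +oo%R] --> (0 : R) ->
  c * F x @[x --> +oo%R] --> (0 : R).
Proof. by move=> F0; rewrite -[X in _ --> X](mulr0 c); apply: cvgM => //; exact: cvg_cst. Qed.

Lemma cvg00_mul F G (l : R) : F x @[x --> (0:R)^'+] --> l -> G x @[x --> (0:R)^'+] --> (0 : R) ->
  F x * G x @[x --> (0:R)^'+] --> (0 : R).
Proof. by move=> F0 G0; rewrite -[X in _ --> X](mulr0 l); exact: cvgM. Qed.

Lemma cvg00_id : (x : R) @[x --> (0:R)^'+] --> (0 : R).
Proof. by apply: cvg_at_right_filter; exact: cvg_id. Qed.

Lemma cvg00_le F G : (forall x, 0 < x -> x < 1 -> `|F x| <= G x) ->
  G x @[x --> (0:R)^'+] --> (0 : R) -> F x @[x --> (0:R)^'+] --> (0 : R).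
Proof.
move=> FG G0; apply/norm_cvg0P; apply: (squeeze_cvgr _ (cvg_cst 0) G0).
near=> x; have x0 : 0 < x by near: x; exact: nbhs_right_gt.
have x1 : x < 1 by near: x; exact: nbhs_right_lt.
by rewrite normr_ge0/= FG.
Unshelve. all: end_near. Qed.

Lemma cvgy0_le_fun F G (M : R) : (forall x, M <= x -> 0 < x -> `|F x| <= G x) ->
  G x @[x --> +oo%R] --> (0 : R) -> F x @[x --> +oo%R] --> (0 : R).
Proof.
move=> FG G0; apply/norm_cvg0P; apply: (squeeze_cvgr _ (cvg_cst 0) G0).
near=> x; have x0 : 0 < x by near: x; exact: nbhs_pinfty_gt.
have Mx : M <= x by near: x; apply: nbhs_pinfty_ge; exact: num_real.
by rewrite normr_ge0/= FG.
Unshelve. all: end_near. Qed.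

End halfline.

(** * Stein's equation for the Gamma law *)

Section gamma_density.
Context {R : realType}.
Notation leb := (@lebesgue_measure R).
Variable a : R.
Hypothesis a0 : 0 < a.
Local Notation p := (gamma_pdf a 1).
Hypothesis mass1 : (\int[leb]_(x in `]0%R, +oo[) (p x)%:E = 1)%E.

Lemma Gamma_fun_ge0 : 0 <= Gamma_fun a.
Proof.
apply: Rintegral_ge0 => x _.
by rewrite mulr_ge0 ?expR_ge0 ?powR_ge0.
Qed.

Lemma Gamma_fun_gt0 : 0 < Gamma_fun a.
Proof.
rewrite lt_def Gamma_fun_ge0 andbT; apply/eqP => G0.
have : (\int[leb]_(x in `]0%R, +oo[) (p x)%:E = 0)%E.
  by apply: integral0_eq => x _; rewrite /gamma_pdf G0 mul0r invr0 !mul0r if_same.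
by rewrite mass1 => /eqP; rewrite eqe oner_eq0.
Qed.

Lemma gamma_pdfE (x : R) : 0 < x -> p x = (Gamma_fun a)^-1 * x `^ (a - 1) * expR (- x).
Proof. by move=> x0; rewrite /gamma_pdf x0 powR1 mulr1 divr1. Qed.

Lemma gamma_pdf_gt0 (x : R) : 0 < x -> 0 < p x.
Proof.
by move=> x0; rewrite gamma_pdfE// !mulr_gt0 ?expR_gt0 ?powR_gt0// invr_gt0 Gamma_fun_gt0.
Qed.

Lemma gamma_pdf_ge0 (x : R) : 0 <= p x.
Proof. by rewrite /gamma_pdf; case: ifPn => // x0; have := gamma_pdf_gt0 x0; rewrite /gamma_pdf x0 => /ltW. Qed.

Lemma gamma_pdf_le0 (x : R) : x <= 0 -> p x = 0.
Proof. by rewrite /gamma_pdf ltNge => ->. Qed.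

Lemma gamma_pdf_derive (x : R) : 0 < x -> is_derive x 1 p (((a - 1) / x - 1) * p x).
Proof.
move=> x0.
apply: (near_rderive (f := fun y => (Gamma_fun a)^-1 * expR ((a - 1) * ln y) * expR (- y))).
  near=> y; have y0 : 0 < y by near: y; exact: near_gt0.
  by rewrite gamma_pdfE// /powR gt_eqF.
rderive => //; rewrite gamma_pdfE// /powR gt_eqF//; field.
by rewrite !gt_eqF ?Gamma_fun_gt0.
Unshelve. all: end_near. Qed.

Lemma gamma_pdf_continuous (x : R) : 0 < x -> {for x, continuous p}.
Proof. by move=> x0; exact: (rderive_continuous (gamma_pdf_derive x0)). Qed.

Lemma measurable_gamma_pdf : measurable_fun setT p.
Proof.
have -> : p = p \_ `]0%R, +oo[.
  apply/funext => x; rewrite patchE; case: ifPn => //.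
  rewrite notin_setE/= in_itv/= andbT => /negP; rewrite -leNgt.
  exact: gamma_pdf_le0.
exact: measurable_halfline gamma_pdf_continuous.
Qed.

(** For a < 1 the density itself is unbounded at 0, but x p(x) is at most a multiple of x^a. *)
Lemma gamma_pdf_at0 : x * p x @[x --> (0:R)^'+] --> (0 : R).
Proof.
apply: (cvg00_le (G := fun x => (Gamma_fun a)^-1 * x `^ a)); last first.
  by apply: cvg00_mul (cvg_cst _) _; exact: powR_cvg0.
move=> x x0 x1; rewrite ger0_norm; last by rewrite mulr_ge0 ?gamma_pdf_ge0// ltW.
have -> : x `^ a = x * x `^ (a - 1).
  rewrite -[X in _ = X * _](powRr1 (ltW x0)) -powRD; first by rewrite addrC subrK.
  by rewrite [x == 0]gt_eqF// implybT.
rewrite gamma_pdfE// mulrA [x * (_ * _)]mulrCA ler_piMr ?mulr_ge0 ?powR_ge0 ?invr_ge0 ?Gamma_fun_ge0 ?(ltW x0)//.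
by rewrite -expR0 ler_expR oppr_le0 ltW.
Qed.

Lemma gamma_pdf_decay n : exists2 C, 0 <= C & forall x, 1 <= x -> x ^+ n * p x <= C / x.
Proof.
(* An integer exponent above a - 1, so that x^(a - 1) <= x^N for x >= 1. *)
pose N := (Num.truncn a).+1.
exists ((Gamma_fun a)^-1 * (n + N).+1%:R ^+ (n + N).+1).
  by rewrite mulr_ge0 ?invr_ge0 ?Gamma_fun_ge0 ?exprn_ge0.
move=> x x1; have x0 : 0 < x by exact: lt_le_trans x1.
rewrite gamma_pdfE// !mulrA [_ ^+ n * _]mulrC -!mulrA ler_wpM2l ?invr_ge0 ?Gamma_fun_ge0//.
apply: le_trans (exprn_expRN_le (n + N) x0).
rewrite mulrA ler_wpM2r ?expR_ge0// exprD ler_wpM2l ?exprn_ge0 ?(ltW x0)//.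
rewrite -powR_mulrn ?(ltW x0)// ler_powR//.
have := truncnS_gt a; rewrite /N; lra.
Qed.

Lemma gamma_pdf_aty n : x ^+ n * p x @[x --> +oo%R] --> (0 : R).
Proof.
have [C C0 H] := gamma_pdf_decay n.
apply: (@cvgy0_le _ _ 1 C) => x x1 x0.
by rewrite ger0_norm ?H// mulr_ge0 ?gamma_pdf_ge0 ?exprn_ge0 ?ltW.
Qed.

End gamma_density.

(** * Iterated tails of the Gamma law *)

Section gamma_tails.
Context {R : realType}.
Notation leb := (@lebesgue_measure R).
Variable a : R.
Hypothesis a0 : 0 < a.
Local Notation p := (gamma_pdf a 1).
Hypothesis mass1 : (\int[leb]_(x in `]0%R, +oo[) (p x)%:E = 1)%E.
Local Notation P := (gamma_low a).
Local Notation Q := (gamma_up a).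

Let dp := gamma_pdf_derive mass1.
Let mp := measurable_gamma_pdf mass1.
Let p0 := gamma_pdf_gt0 mass1.
Let p0' := gamma_pdf_ge0 mass1.

Lemma gamma_pdf_integrable : leb.-integrable setT (EFin \o p).
Proof.
apply/integrableP; split; first exact/measurable_EFinP.
have -> : (\int[leb]_x `|(EFin \o p) x| = \int[leb]_(x in `]0%R, +oo[) (p x)%:E)%E.
  rewrite [RHS]integral_mkcond; apply: eq_integral => x _; rewrite patchE/= ger0_norm//.
  case: ifPn => //; rewrite notin_setE/= in_itv/= andbT => /negP; rewrite -leNgt.
  by move=> /gamma_pdf_le0 ->.
by rewrite mass1 ltry.
Qed.

Let ip A : measurable A -> leb.-integrable A (EFin \o p).
Proof. by move=> mA; exact: integrableS gamma_pdf_integrable. Qed.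

Lemma gamma_low_derive (x : R) : 0 < x -> is_derive x 1 P (p x).
Proof.
move=> x0; have [||||D E] := @continuous_FTC1_closed R p 0 x (x + 1).
- by rewrite ltrDl.
- exact: ip.
- by [].
- exact: gamma_pdf_continuous.
- by apply: (DeriveDef D); rewrite -derive1E E.
Qed.
Let dP := gamma_low_derive.

Lemma gamma_low_at0 : P x @[x --> (0:R)^'+] --> (0 : R).
Proof.
apply: cvg_at_right_filter; apply: (@parameterized_integral_cvg_left _ 0 1) => //.
exact: ip.
Qed.

Lemma gamma_low_ge0 (x : R) : 0 <= P x.
Proof. by rewrite /gamma_low; apply: Rintegral_ge0 => u _; exact: p0'. Qed.

Lemma gamma_upE (x : R) : 0 <= x -> Q x = 1 - P x.
Proof.
move=> x0.
have <- : \int[leb]_(u in `[0, +oo[) p u = 1 :> R.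
  rewrite -Rintegral_itv_obnd_cbnd; last exact: ip.
  by rewrite /Rintegral mass1.
rewrite /gamma_low /gamma_up -(@Rintegral_itv_obnd_cbnd _ x); last exact: ip.
apply/esym; apply: (@Rintegral_itvB _ p (BLeft 0) +oo%O x); last 2 first.
- by rewrite bnd_simp.
- by [].
- exact: ip.
Qed.

Lemma gamma_up_ge0 (x : R) : 0 <= Q x.
Proof. by rewrite /gamma_up; apply: Rintegral_ge0 => u _; exact: p0'. Qed.

Lemma gamma_up_derive (x : R) : 0 < x -> is_derive x 1 Q (- p x).
Proof.
move=> x0; apply: (near_rderive (f := fun x => 1 - P x)).
  near=> y; have y0 : 0 < y by near: y; exact: near_gt0.
  by rewrite gamma_upE// ltW.
by have := dP x0 => ?; rderive; rewrite sub0r.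
Unshelve. all: end_near. Qed.
Let dQ := gamma_up_derive.

(** On [1, +oo[ the density is at most C / u^2, whose integral over [x, +oo[ is C / x. *)
Lemma gamma_up_aty : Q x @[x --> +oo%R] --> (0 : R).
Proof.
have [C C0 H] := gamma_pdf_decay a 1.
apply: (@cvgy0_le _ _ 1 C) => x x1 x0.
rewrite ger0_norm ?gamma_up_ge0//.
pose F u : R := - (C / u); pose f u : R := C / u ^+ 2.
have dF (u : R) : 0 < u -> is_derive u 1 F (f u).
  by move=> u0; rewrite /F /f; rderive; rewrite ?gt_eqF//; field; rewrite gt_eqF.
have cf (u : R) : 0 < u -> {for u, continuous f}.
  move=> u0; apply: rderive_continuous; rewrite /f; rderive; rewrite ?expf_neq0 ?gt_eqF//.
have Fy : F u @[u --> +oo%R] --> (0 : R).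
  by apply: (@cvgy0_le _ _ 1 C) => u _ u0; rewrite normrN ger0_norm// divr_ge0// ltW.
have If : (\int[leb]_(u in `[x, +oo[) (f u)%:E = (0 - F x)%:E)%E.
  apply: ge0_FTC_itvxy => //.
  - by move=> u xu; apply: dF; exact: lt_le_trans xu.
  - by move=> u xu; apply: cf; exact: lt_le_trans xu.
  - by move=> u xu; rewrite /f divr_ge0// exprn_ge0// (le_trans (ltW x0)).
rewrite -lee_fin /gamma_up /Rintegral fineK; last first.
  by apply: integrable_fin_num => //; exact: ip.
have <- : (\int[leb]_(u in `[x, +oo[) (f u)%:E = (C / x)%:E)%E by rewrite If sub0r opprK.
apply: ge0_le_integral => //.
- by move=> u _; rewrite lee_fin.
- by apply/measurable_EFinP; exact: measurable_funTS.
- apply/measurable_EFinP; apply: (eq_measurable_fun (f \_ `]0%R, +oo[)).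
    move=> u; rewrite inE/= in_itv/= andbT => xu.
    by rewrite patchE mem_set//= in_itv/= andbT (lt_le_trans x0).
  by apply: measurable_funTS; exact: measurable_halfline.
- move=> u; rewrite /= in_itv/= andbT => xu; rewrite lee_fin /f.
  have u0 : 0 < u by exact: lt_le_trans xu.
  have := H u (le_trans x1 xu); rewrite expr1 ler_pdivlMr// => H1.
  by rewrite ler_pdivlMr ?exprn_gt0// expr2 mulrA [p u * u]mulrC.
Qed.

(** 2 p - Q has derivative (2 (a - 1) / x - 1) p, which is nonpositive beyond 2 a, and it tends to
    0. Thereby powers of x times Q tend to 0 as those times p do. *)
Lemma gamma_up_le2 (x : R) : 2 * a <= x -> Q x <= 2 * p x.
Proof.
move=> ax; rewrite -subr_ge0.
have x0 : 0 < 2 * a by rewrite mulr_gt0.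
apply: (halfline_ge0y (F := fun x => 2 * p x - Q x) (f := fun x => (2 * (a - 1) / x - 1) * p x) x0) => //.
- move=> z z0; have := dp z0 => ?; have := dQ z0 => ?.
  by rderive; ring.
- move=> z az; have z0 : 0 < z by exact: lt_trans az.
  rewrite mulr_le0_ge0// subr_le0 ler_pdivrMr//; lra.
- rewrite -[X in _ --> X]subr0; apply: cvgB; last exact: gamma_up_aty.
  apply: cvgy0_scale; have := gamma_pdf_aty mass1 0.
  by under eq_cvg do rewrite expr0 mul1r.
Qed.

Lemma gamma_up_moment_aty n : x ^+ n * Q x @[x --> +oo%R] --> (0 : R).
Proof.
apply: (cvgy0_le_fun (M := 2 * a) (G := fun x => 2 * (x ^+ n * p x))); last first.
  by apply: cvgy0_scale; exact: gamma_pdf_aty.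
move=> x ax x0; rewrite normrM ger0_norm ?exprn_ge0 ?(ltW x0)//.
rewrite ger0_norm ?gamma_up_ge0// mulrCA ler_wpM2l ?exprn_ge0 ?(ltW x0)//.
exact: gamma_up_le2.
Qed.

(** Closed forms of the iterated integrals of P from 0 and of Q to infinity. Counting P as order 0
    and p as order -1, the lower ones obey k low_k = x low_(k-2) - (a + k - 1 - x) low_(k-1), which
    stems from (x p)' = (a - x) p; the upper ones obey the same recursion with a plus sign. *)
Definition low1 x := x * p x - (a - x) * P x.
Definition low2 x := (x * P x - (a + 1 - x) * low1 x) / 2.
Definition low3 x := (x * low1 x - (a + 2 - x) * low2 x) / 3.
Definition up1 x := x * p x + (a - x) * Q x.
Definition up2 x := (x * Q x + (a + 1 - x) * up1 x) / 2.
Definition up3 x := (x * up1 x + (a + 2 - x) * up2 x) / 3.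

Lemma low1_derive (x : R) : 0 < x -> is_derive x 1 low1 (P x).
Proof.
move=> x0; have := dp x0 => ?; have := dP x0 => ?.
by rewrite /low1; rderive; field; rewrite gt_eqF.
Qed.

Lemma low2_derive (x : R) : 0 < x -> is_derive x 1 low2 (low1 x).
Proof.
move=> x0; have := dP x0 => ?; have := low1_derive x0 => ?.
by rewrite /low2; rderive; rewrite /low1; field.
Qed.

Lemma low3_derive (x : R) : 0 < x -> is_derive x 1 low3 (low2 x).
Proof.
move=> x0; have := low2_derive x0 => ?; have := low1_derive x0 => ?.
by rewrite /low3; rderive; rewrite /low2; field.
Qed.

Lemma up1_derive (x : R) : 0 < x -> is_derive x 1 up1 (- Q x).
Proof.
move=> x0; have := dp x0 => ?; have := dQ x0 => ?.
by rewrite /up1; rderive; field; rewrite gt_eqF.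
Qed.

Lemma up2_derive (x : R) : 0 < x -> is_derive x 1 up2 (- up1 x).
Proof.
move=> x0; have := dQ x0 => ?; have := up1_derive x0 => ?.
by rewrite /up2; rderive; rewrite /up1; field.
Qed.

Lemma up3_derive (x : R) : 0 < x -> is_derive x 1 up3 (- up2 x).
Proof.
move=> x0; have := up2_derive x0 => ?; have := up1_derive x0 => ?.
by rewrite /up3; rderive; rewrite /up2; field.
Qed.

Let lin_cvg0 (c d : R) : (c * x + d) @[x --> (0:R)^'+] --> d.
Proof.
apply: cvg_at_right_filter.
have H : {for (0 : R), continuous (fun x : R => c * x + d)}.
  by apply: rderive_continuous; rderive; reflexivity.
by rewrite [X in _ --> X](_ : d = c * 0 + d)//; rewrite mulr0 add0r.
Qed.

Let cvg00_add (F G : R -> R) : F x @[x --> (0:R)^'+] --> (0 : R) -> G x @[x --> (0:R)^'+] --> (0 : R) ->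
  F x + G x @[x --> (0:R)^'+] --> (0 : R).
Proof. by move=> F0 G0; rewrite -[X in _ --> X]addr0; exact: cvgD. Qed.

Let lin_mul0 (c d : R) (F : R -> R) : F x @[x --> (0:R)^'+] --> (0 : R) ->
  (c * x + d) * F x @[x --> (0:R)^'+] --> (0 : R).
Proof. by apply: cvg00_mul; exact: lin_cvg0. Qed.

Lemma low1_at0 : low1 x @[x --> (0:R)^'+] --> (0 : R).
Proof.
rewrite (_ : low1 = fun x => x * p x + ((-1) * (- 1 * x + a)) * P x); last first.
  by apply/funext => x; rewrite /low1; ring.
apply: cvg00_add; first exact: gamma_pdf_at0.
have -> : (fun x => (-1) * (- 1 * x + a) * P x) = (fun x => (1 * x - a) * P x).
  by apply/funext => x; ring.
apply: lin_mul0; exact: gamma_low_at0.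
Qed.

Let id_mul0 (F : R -> R) : F x @[x --> (0:R)^'+] --> (0 : R) ->
  x * F x @[x --> (0:R)^'+] --> (0 : R).
Proof. by move=> F0; apply: cvg00_mul F0; exact: cvg00_id. Qed.

Lemma low2_at0 : low2 x @[x --> (0:R)^'+] --> (0 : R).
Proof.
rewrite (_ : low2 = fun x => x * (P x / 2) + (2^-1 * x - (a + 1) / 2) * low1 x); last first.
  by apply/funext => x; rewrite /low2; field.
apply: cvg00_add; last by apply: lin_mul0; exact: low1_at0.
apply: id_mul0; rewrite -[X in _ --> X](mul0r 2^-1); apply: cvgM; last exact: cvg_cst.
exact: gamma_low_at0.
Qed.

Lemma low1_ge0 (x : R) : 0 < x -> 0 <= low1 x.
Proof.
by apply: (halfline_ge0 low1_derive) low1_at0 _ => z _; exact: gamma_low_ge0.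
Qed.

Lemma low2_ge0 (x : R) : 0 < x -> 0 <= low2 x.
Proof. by apply: (halfline_ge0 low2_derive) low2_at0 _; exact: low1_ge0. Qed.

Lemma low3_at0 : low3 x @[x --> (0:R)^'+] --> (0 : R).
Proof.
rewrite (_ : low3 = fun x => x * (low1 x / 3) + (3^-1 * x - (a + 2) / 3) * low2 x); last first.
  by apply/funext => x; rewrite /low3; field.
apply: cvg00_add; last by apply: lin_mul0; exact: low2_at0.
apply: id_mul0; rewrite -[X in _ --> X](mul0r 3^-1); apply: cvgM; last exact: cvg_cst.
exact: low1_at0.
Qed.

Lemma low3_ge0 (x : R) : 0 < x -> 0 <= low3 x.
Proof. by apply: (halfline_ge0 low3_derive) low3_at0 _; exact: low2_ge0. Qed.

Lemma up1_moment_aty n : x ^+ n * up1 x @[x --> +oo%R] --> (0 : R).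
Proof.
rewrite (_ : (fun x => _) = fun x => x ^+ n.+1 * p x + (a * (x ^+ n * Q x) + (-1) * (x ^+ n.+1 * Q x))); last first.
  by apply/funext => x; rewrite /up1 exprS; ring.
apply: cvgy0_sum; first exact: gamma_pdf_aty.
by apply: cvgy0_sum; apply: cvgy0_scale; exact: gamma_up_moment_aty.
Qed.

Lemma up2_moment_aty n : x ^+ n * up2 x @[x --> +oo%R] --> (0 : R).
Proof.
rewrite (_ : (fun x => _) = fun x => 2^-1 * (x ^+ n.+1 * Q x) + ((a + 1) / 2 * (x ^+ n * up1 x) + (-2^-1) * (x ^+ n.+1 * up1 x))); last first.
  by apply/funext => x; rewrite /up2 exprS; field.
apply: cvgy0_sum; first by apply: cvgy0_scale; exact: gamma_up_moment_aty.
by apply: cvgy0_sum; apply: cvgy0_scale; exact: up1_moment_aty.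
Qed.

Lemma up3_moment_aty n : x ^+ n * up3 x @[x --> +oo%R] --> (0 : R).
Proof.
rewrite (_ : (fun x => _) = fun x => 3^-1 * (x ^+ n.+1 * up1 x) + ((a + 2) / 3 * (x ^+ n * up2 x) + (-3^-1) * (x ^+ n.+1 * up2 x))); last first.
  by apply/funext => x; rewrite /up3 exprS; field.
apply: cvgy0_sum; first by apply: cvgy0_scale; exact: up1_moment_aty.
by apply: cvgy0_sum; apply: cvgy0_scale; exact: up2_moment_aty.
Qed.

Let aty0 (F : R -> R) : x ^+ 0 * F x @[x --> +oo%R] --> (0 : R) -> F x @[x --> +oo%R] --> (0 : R).
Proof. by under eq_cvg do rewrite expr0 mul1r. Qed.

Lemma up1_ge0 (x : R) : 0 < x -> 0 <= up1 x.
Proof.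
move=> x0; apply: (halfline_ge0y x0 up1_derive _ (aty0 (up1_moment_aty 0)) (lexx x)) => z xz.
by rewrite oppr_le0 gamma_up_ge0.
Qed.

Lemma up2_ge0 (x : R) : 0 < x -> 0 <= up2 x.
Proof.
move=> x0; apply: (halfline_ge0y x0 up2_derive _ (aty0 (up2_moment_aty 0)) (lexx x)) => z xz.
by rewrite oppr_le0 up1_ge0// (lt_trans x0).
Qed.

Lemma up3_ge0 (x : R) : 0 < x -> 0 <= up3 x.
Proof.
move=> x0; apply: (halfline_ge0y x0 up3_derive _ (aty0 (up3_moment_aty 0)) (lexx x)) => z xz.
by rewrite oppr_le0 up2_ge0// (lt_trans x0).
Qed.

(** In these combinations the terms with the factor a + k - 1 - x cancel, so that each identity is
    the previous one multiplied by x. The right sides are the denominators of the Stein solution and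
    of its derivatives. *)
Lemma tails1 (x : R) : 0 < x -> Q x * low1 x + P x * up1 x = x * p x.
Proof. by move=> x0; rewrite /low1 /up1 gamma_upE ?ltW//; ring. Qed.

Lemma tails2 (x : R) : 0 < x -> 2 * (up2 x * low1 x + low2 x * up1 x) = x ^+ 2 * p x.
Proof.
move=> x0; transitivity (x * (Q x * low1 x + P x * up1 x)); last by rewrite tails1//; ring.
by rewrite /low2 /up2; field.
Qed.

Lemma tails3 (x : R) : 0 < x -> 6 * (up3 x * low2 x + low3 x * up2 x) = x ^+ 3 * p x.
Proof.
move=> x0; transitivity (x * (2 * (up2 x * low1 x + low2 x * up1 x))); last by rewrite tails2//; ring.
by rewrite /low3 /up3; field.
Qed.

End gamma_tails.

(** * Closed form of [C2] *)

Section C2_formula.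
Context {R : realType}.
Notation leb := (@lebesgue_measure R).
Variable a : R.
Hypothesis a0 : 0 < a.
Local Notation p := (gamma_pdf a 1).
Hypothesis mass1 : (\int[leb]_(x in `]0%R, +oo[) (p x)%:E = 1)%E.
Local Notation P := (gamma_low a).
Local Notation Q := (gamma_up a).

Let Rintegral_itv0x (f F : R -> R) (x : R) : 0 < x ->
  (forall y : R, 0 < y -> is_derive y 1 F (f y)) -> (forall y : R, 0 < y -> {for y, continuous f}) ->
  F y @[y --> (0:R)^'+] --> (0 : R) -> (forall y : R, 0 < y -> 0 <= f y) ->
  \int[leb]_(y in `[0, x]) f y = F x.
Proof.
move=> x0 dF cf F0 f0.
rewrite /Rintegral -integral_itv_obnd_cbnd; last first.
  apply/measurable_EFinP; apply: (eq_measurable_fun (f \_ `]0%R, +oo[)).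
    by move=> u; rewrite inE/= in_itv/= => /andP[u0 _]; rewrite patchE mem_set//= in_itv/= u0.
  by apply: measurable_funTS; exact: measurable_halfline.
by rewrite (ge0_FTC_itv0x x0 dF cf F0 f0)/= subr0.
Qed.

Let Rintegral_itvxy (f F : R -> R) (x : R) : 0 < x ->
  (forall y : R, 0 < y -> is_derive y 1 F (- f y)) -> (forall y : R, 0 < y -> {for y, continuous f}) ->
  F y @[y --> +oo%R] --> (0 : R) -> (forall y : R, 0 < y -> 0 <= f y) ->
  \int[leb]_(y in `[x, +oo[) f y = F x.
Proof.
move=> x0 dF cf Fy f0.
have dG (y : R) : x <= y -> is_derive y 1 (fun y => - F y) (f y).
  move=> xy; have := dF y (lt_le_trans x0 xy) => ?.
  by rderive; rewrite opprK.
have Gy : - F y @[y --> +oo%R] --> (0 : R) by rewrite -oppr0; exact: cvgN.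
rewrite /Rintegral (ge0_FTC_itvxy dG _ Gy)/= ?sub0r ?opprK//.
- by move=> y xy; apply: cf; exact: lt_le_trans xy.
- by move=> y xy; apply: f0; exact: lt_le_trans xy.
Qed.

Let aty0 (F : R -> R) : x ^+ 0 * F x @[x --> +oo%R] --> (0 : R) -> F x @[x --> +oo%R] --> (0 : R).
Proof. by under eq_cvg do rewrite expr0 mul1r. Qed.

Lemma gamma_low1E (x : R) : 0 < x -> gamma_low1 a x = low1 a x.
Proof.
move=> x0; apply: Rintegral_itv0x x0 (low1_derive mass1) _ (low1_at0 a0 mass1) _.
- by move=> y y0; exact: (rderive_continuous (gamma_low_derive mass1 y0)).
- by move=> y _; exact: gamma_low_ge0.
Qed.

Lemma gamma_up1E (x : R) : 0 < x -> gamma_up1 a x = up1 a x.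
Proof.
move=> x0; apply: Rintegral_itvxy x0 (up1_derive mass1) _ (aty0 (up1_moment_aty a0 mass1 0)) _.
- by move=> y y0; exact: (rderive_continuous (gamma_up_derive mass1 y0)).
- by move=> y _; exact: gamma_up_ge0.
Qed.

Lemma Rintegral_gamma_low1 (x : R) : 0 < x ->
  \int[leb]_(y in `[0, x]) gamma_low1 a y = low2 a x.
Proof.
move=> x0; have D (y : R) : 0 < y -> is_derive y 1 (low2 a) (gamma_low1 a y).
  by move=> y0; rewrite gamma_low1E//; exact: low2_derive.
apply: Rintegral_itv0x x0 D _ (low2_at0 a0 mass1) _.
- move=> y y0; apply: (rderive_continuous (a := P y)).
  apply: near_rderive (low1_derive mass1 y0); near=> z.
  by rewrite gamma_low1E//; near: z; exact: near_gt0.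
- by move=> y y0; rewrite gamma_low1E// low1_ge0.
Unshelve. all: end_near. Qed.

Lemma Rintegral_gamma_up1 (x : R) : 0 < x ->
  \int[leb]_(y in `[x, +oo[) gamma_up1 a y = up2 a x.
Proof.
move=> x0; have D (y : R) : 0 < y -> is_derive y 1 (up2 a) (- gamma_up1 a y).
  by move=> y0; rewrite gamma_up1E//; exact: up2_derive.
apply: Rintegral_itvxy x0 D _ (aty0 (up2_moment_aty a0 mass1 0)) _.
- move=> y y0; apply: (rderive_continuous (a := - Q y)).
  apply: near_rderive (up1_derive mass1 y0); near=> z.
  by rewrite gamma_up1E//; near: z; exact: near_gt0.
- by move=> y y0; rewrite gamma_up1E// up1_ge0.
Unshelve. all: end_near. Qed.

Lemma derive1n2E (f f1 : R -> R) (x b : R) : 0 < x ->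
  (forall y : R, 0 < y -> is_derive y 1 f (f1 y)) -> is_derive x 1 f1 b ->
  derive1n 2 f x = b.
Proof.
move=> x0 df df1; rewrite derive1nS derive1n1.
apply: rderive1E; apply: near_rderive df1; near=> y.
by apply/esym/rderive1E/df; near: y; exact: near_gt0.
Unshelve. all: end_near. Qed.

(** The derivative of P / (y p) is low1 / (y^2 p): each differentiation raises the order of the
    iterated tail by one. *)
Lemma M_low2E (x : R) : 0 < x -> derive1n 2 (M_low a) x = 2 * low2 a x / (x ^+ 3 * p x).
Proof.
move=> x0; apply: (derive1n2E (f1 := fun y => low1 a y / (y ^+ 2 * p y)) x0).
  move=> y y0; have p0 := gamma_pdf_gt0 mass1 y0.
  have := gamma_pdf_derive mass1 y0 => ?; have := gamma_low_derive mass1 y0 => ?.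
  rewrite /M_low; rderive; first by rewrite mulf_neq0 ?gt_eqF.
  by rewrite /low1; field; rewrite !gt_eqF.
have p0 := gamma_pdf_gt0 mass1 x0.
have := gamma_pdf_derive mass1 x0 => ?; have := low1_derive mass1 x0 => ?.
rderive; first by rewrite mulf_neq0 ?expf_neq0 ?gt_eqF.
by rewrite /low2; field; rewrite !gt_eqF.
Qed.

Lemma M_up2E (x : R) : 0 < x -> derive1n 2 (M_up a) x = 2 * up2 a x / (x ^+ 3 * p x).
Proof.
move=> x0; apply: (derive1n2E (f1 := fun y => - up1 a y / (y ^+ 2 * p y)) x0).
  move=> y y0; have p0 := gamma_pdf_gt0 mass1 y0.
  have := gamma_pdf_derive mass1 y0 => ?; have := gamma_up_derive mass1 y0 => ?.
  rewrite /M_up; rderive; first by rewrite mulf_neq0 ?gt_eqF.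
  by rewrite /up1; field; rewrite !gt_eqF.
have p0 := gamma_pdf_gt0 mass1 x0.
have := gamma_pdf_derive mass1 x0 => ?; have := up1_derive mass1 x0 => ?.
rderive; first by rewrite mulf_neq0 ?expf_neq0 ?gt_eqF.
by rewrite /up2; field; rewrite !gt_eqF.
Qed.

Lemma C2E (x : R) : 0 < x -> C2 a x = 4 * up2 a x * low2 a x / (x ^+ 3 * p x).
Proof.
move=> x0; rewrite /C2 M_up2E// M_low2E// Rintegral_gamma_low1// Rintegral_gamma_up1//.
by field; rewrite !gt_eqF// (gamma_pdf_gt0 mass1).
Qed.

Lemma e_const_ge (x : R) : 0 < x ->
  ((4 * up2 a x * low2 a x / (x ^+ 3 * p x))%:E <= e_const a)%E.
Proof.
move=> x0; rewrite -C2E//; apply: ereal_sup_ubound.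
by exists x => //=; rewrite in_itv/= x0.
Qed.

End C2_formula.

Section gamma_moments.
Context {R : realType}.
Notation leb := (@lebesgue_measure R).
Variable a : R.
Hypothesis a0 : 0 < a.
Local Notation p := (gamma_pdf a 1).
Hypothesis mass1 : (\int[leb]_(x in `]0%R, +oo[) (p x)%:E = 1)%E.
Local Notation P := (gamma_low a).
Local Notation Q := (gamma_up a).

(** Primitive of (1 + x)^2 p(x); the coefficient of P is the second moment of 1 + X under the Gamma
    law. *)
Definition gamma_sqr_primitive x :=
  (1 + 2 * a + a * (a + 1)) * P x + ((- 1 * x - (a + 3)) * (x * p x)).
Local Notation G := gamma_sqr_primitive.
Let Ginf := 1 + 2 * a + a * (a + 1).

Lemma gamma_sqr_primitive_derive (x : R) : 0 < x -> is_derive x 1 G ((1 + x) ^+ 2 * p x).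
Proof.
move=> x0; have := gamma_pdf_derive mass1 x0 => ?; have := gamma_low_derive mass1 x0 => ?.
by rewrite /G; rderive; field; rewrite gt_eqF.
Qed.

Lemma gamma_sqr_primitive_at0 : G x @[x --> (0:R)^'+] --> (0 : R).
Proof.
rewrite -[X in _ --> X]addr0; apply: cvgD.
  by apply: cvg00_mul (cvg_cst _) _; exact: gamma_low_at0.
apply: cvg00_mul (gamma_pdf_at0 a0 mass1); apply: cvg_at_right_filter.
suff : {for (0 : R), continuous (fun x : R => - 1 * x - (a + 3))} by exact.
by apply: rderive_continuous; rderive; reflexivity.
Qed.

Lemma gamma_sqr_primitive_aty : Ginf - G x @[x --> +oo%R] --> (0 : R).
Proof.
apply: (cvgy0_le_fun (M := 0) (G := fun x => Ginf * (x ^+ 0 * Q x) + (x ^+ 2 * p x + (a + 3) * (x ^+ 1 * p x)))).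
  move=> x _ x0; rewrite gamma_upE ?(ltW x0)// /G -/Ginf.
  have p0 := gamma_pdf_ge0 mass1 x; have q0 := gamma_up_ge0 mass1 x.
  rewrite gamma_upE ?(ltW x0)// in q0.
  have -> : Ginf - (Ginf * P x + (- 1 * x - (a + 3)) * (x * p x)) = Ginf * (x ^+ 0 * (1 - P x)) + (x ^+ 2 * p x + (a + 3) * (x ^+ 1 * p x)) by ring.
  move: q0; set q := 1 - P x => q0.
  have a0' := ltW a0; have x0' := ltW x0.
  have G0 : 0 <= Ginf by rewrite /Ginf !addr_ge0// mulr_ge0// addr_ge0.
  by rewrite ger0_norm// !addr_ge0// ?mulr_ge0 ?exprn_ge0// ?addr_ge0// mulr_ge0.
apply: cvgy0_sum; first by apply: cvgy0_scale; exact: gamma_up_moment_aty.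
apply: cvgy0_sum; first exact: gamma_pdf_aty.
by apply: cvgy0_scale; exact: gamma_pdf_aty.
Qed.

End gamma_moments.

(** * The Stein solution, its derivatives and their bounds *)

Section stein.
Context {R : realType}.
Notation leb := (@lebesgue_measure R).
Variable a : R.
Hypothesis a0 : 0 < a.
Local Notation p := (gamma_pdf a 1).
Hypothesis mass1 : (\int[leb]_(x in `]0%R, +oo[) (p x)%:E = 1)%E.
Local Notation P := (gamma_low a).
Local Notation Q := (gamma_up a).
Local Notation G := (gamma_sqr_primitive a).
Let Ginf := 1 + 2 * a + a * (a + 1).

Variables (h h' : R -> R) (K : R).
Hypothesis dh : forall x : R, 0 < x -> is_derive x 1 h (h' x).
Hypothesis ch' : forall x : R, 0 < x -> {for x, continuous h'}.
Hypothesis hK : forall x : R, 0 < x -> `|h x| <= K * (1 + x) ^+ 2.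
Hypothesis h'K : forall x : R, 0 < x -> `|h' x| <= K * (1 + x).

Let dp (x : R) (x0 : 0 < x) := gamma_pdf_derive mass1 x0.
Let dP (x : R) (x0 : 0 < x) := gamma_low_derive mass1 x0.
Let dQ (x : R) (x0 : 0 < x) := gamma_up_derive mass1 x0.

Let K0 : 0 <= K.
Proof.
have := le_trans (normr_ge0 _) (hK ltr01).
by rewrite pmulr_lge0// exprn_gt0// addr_gt0.
Qed.

Let g x := (1 + x) ^+ 2 * p x.
Let cg (x : R) : 0 < x -> {for x, continuous g}.
Proof.
move=> x0; have := dp x0 => ?; apply: rderive_continuous; rewrite /g; rderive; reflexivity.
Qed.
Let g0 (x : R) : 0 <= g x.
Proof. by rewrite mulr_ge0 ?sqr_ge0// gamma_pdf_ge0. Qed.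

Let patch0 (f : R -> R) : (forall x, x <= 0 -> f x = 0) -> f = f \_ `]0%R, +oo[.
Proof.
move=> f0; apply/funext => x; rewrite patchE; case: ifPn => //.
by rewrite notin_setE/= in_itv/= andbT => /negP; rewrite -leNgt => /f0.
Qed.

Let mg : measurable_fun setT g.
Proof.
rewrite (patch0 (f := g)); first exact: measurable_halfline.
by move=> x x0; rewrite /g gamma_pdf_le0// mulr0.
Qed.

Let ig : leb.-integrable setT (EFin \o g).
Proof.
apply/integrableP; split; first exact/measurable_EFinP.
have -> : (\int[leb]_x `|(EFin \o g) x| = \int[leb]_(x in `]0%R, +oo[) (g x)%:E)%E.
  rewrite [RHS]integral_mkcond; apply: eq_integral => x _; rewrite patchE/= ger0_norm//.
  case: ifPn => //; rewrite notin_setE/= in_itv/= andbT => /negP; rewrite -leNgt.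
  by move=> x0; rewrite /g gamma_pdf_le0// mulr0.
have Gy : G x @[x --> +oo%R] --> Ginf.
  rewrite -[X in _ --> X]subr0 (_ : G = fun x => Ginf - (Ginf - G x)); last first.
    by apply/funext => x; ring.
  by apply: cvgB; [exact: cvg_cst|exact: gamma_sqr_primitive_aty].
rewrite (ge0_FTC_itv0y (gamma_sqr_primitive_derive mass1) cg (gamma_sqr_primitive_at0 a0 mass1) Gy)//.
- by rewrite ltry.
- by move=> x _; exact: g0.
Qed.

Definition gamma_mean := \int[leb]_x (h x * p x).
Local Notation m := gamma_mean.
Let K' := K + `|m|.
Let H x := h x - m.
Let k x := H x * p x.

Let HK (x : R) : 0 < x -> `|H x| <= K' * (1 + x) ^+ 2.
Proof.
move=> x0; apply: (le_trans (ler_normB _ _)); rewrite mulrDl lerD ?hK//.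
by rewrite ler_peMr// exprn_ege1// lerDl ltW.
Qed.

Let le_g (c : R -> R) (C : R) : (forall x : R, 0 < x -> `|c x| <= C * (1 + x) ^+ 2) ->
  forall x, `|c x * p x| <= C * g x.
Proof.
move=> cC x; have [x0|x0] := leP x 0.
  by rewrite /g gamma_pdf_le0// !mulr0 normr0.
rewrite normrM [`|p x|]ger0_norm ?gamma_pdf_ge0// /g mulrA ler_wpM2r ?gamma_pdf_ge0//.
exact: cC.
Qed.

Let mwp (c : R -> R) : (forall x : R, 0 < x -> {for x, continuous c}) ->
  measurable_fun setT (fun x => c x * p x).
Proof.
move=> cc; rewrite (patch0 (f := fun x => c x * p x)); last first.
  by move=> x x0; rewrite gamma_pdf_le0// mulr0.
apply: measurable_halfline => x x0; apply: continuousM; first exact: cc.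
exact: gamma_pdf_continuous.
Qed.

Let iwp (c : R -> R) (C : R) : (forall x : R, 0 < x -> {for x, continuous c}) ->
  (forall x : R, 0 < x -> `|c x| <= C * (1 + x) ^+ 2) ->
  leb.-integrable setT (fun x => (c x * p x)%:E).
Proof.
move=> cc cC; apply: (@le_integrable _ _ _ leb setT measurableT _ (fun x => (C * g x)%:E)).
- by apply/measurable_EFinP; exact: mwp.
- move=> x _; rewrite lee_fin; apply: le_trans (ler_norm _); exact: le_g.
- exact: (integrableZl measurableT C ig).
Qed.

Let chx (x : R) : 0 < x -> {for x, continuous h}.
Proof. by move=> x0; exact: rderive_continuous (dh x0). Qed.

Let cH (x : R) : 0 < x -> {for x, continuous H}.
Proof. by move=> x0; apply: continuousB; [exact: chx|exact: cvg_cst]. Qed.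

Lemma gamma_mean_integrable : leb.-integrable setT (fun x => (h x * p x)%:E).
Proof. exact: (iwp chx hK). Qed.

Let ik A : measurable A -> leb.-integrable A (fun x => (k x)%:E).
Proof. by move=> mA; apply: integrableS (iwp cH HK) => //. Qed.

Let mass1T : \int[leb]_x p x = 1.
Proof.
have -> : \int[leb]_x p x = \int[leb]_(x in `]0%R, +oo[) p x.
  rewrite [RHS]Rintegral_mkcond; congr Rintegral; apply: patch0.
  by move=> x x0; rewrite gamma_pdf_le0.
by rewrite /Rintegral mass1.
Qed.

Let int_k : \int[leb]_x k x = 0.
Proof.
have ip := gamma_pdf_integrable mass1.
transitivity (\int[leb]_x (h x * p x) - \int[leb]_x (m * p x)).
  rewrite -RintegralB//; last 2 first.
  - exact: gamma_mean_integrable.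
  - exact: (integrableZl measurableT m ip).
  by apply: eq_Rintegral => x _; rewrite /k /H; ring.
by rewrite RintegralZl// mass1T mulr1 subrr.
Qed.

Definition stein_primitive x := \int[leb]_(u in `[0, x]) (h u * p u - m * p u).
Local Notation S := stein_primitive.

Let SE x : S x = \int[leb]_(u in `[0, x]) k u.
Proof. by apply: eq_Rintegral => u _; rewrite /k /H mulrBl. Qed.

Lemma stein_primitive_derive (x : R) : 0 < x -> is_derive x 1 S (H x * p x).
Proof.
move=> x0; have [||||D E] := @continuous_FTC1_closed R k 0 x (x + 1).
- by rewrite ltrDl.
- exact: ik.
- by [].
- by apply: continuousM; [exact: cH|exact: gamma_pdf_continuous].
- rewrite (_ : S = fun x => \int[leb]_(u in `[0, x]) k u); last by apply/funext => y; exact: SE.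
  by apply: (DeriveDef D); rewrite -derive1E E.
Qed.
Let dS := stein_primitive_derive.

Lemma stein_primitive_at0 : S x @[x --> (0:R)^'+] --> (0 : R).
Proof.
under eq_cvg do rewrite SE.
apply: cvg_at_right_filter; apply: (@parameterized_integral_cvg_left _ 0 1) => //.
exact: ik.
Qed.

Lemma stein_primitive_aty : S x @[x --> +oo%R] --> (0 : R).
Proof.
apply: (cvgy0_le_fun (M := 0) (G := fun x => K' * (Ginf - G x))); last first.
  by apply: cvgy0_scale; exact: gamma_sqr_primitive_aty.
move=> x _ x0.
(* The total integral of [k] is 0, so S is minus an integral over the tail, dominated by that of K'
   (1 + u)^2 p(u). *)
have E : S x = - \int[leb]_(u in `]x, +oo[) k u.
  have k0 : \int[leb]_(u in `[0, +oo[) k u = 0.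
    rewrite -Rintegral_itv_obnd_cbnd; last exact: ik.
    apply: etrans int_k; rewrite [LHS]Rintegral_mkcond; apply: eq_Rintegral => y _.
    by rewrite -(patch0 (f := k))// => z z0; rewrite /k gamma_pdf_le0// mulr0.
  have x0' : (BLeft (0 : R) <= BRight x)%O by rewrite bnd_simp ltW.
  have := @Rintegral_itvB _ k (BLeft 0) +oo%O x (ik (measurable_itv _)) x0' isT.
  by rewrite k0 sub0r SE => <-; rewrite opprK.
rewrite E normrN Rintegral_itv_obnd_cbnd; last exact: ik.
have igx : leb.-integrable `[x, +oo[ (EFin \o g).
  by apply: integrableS ig.
apply: (@le_trans _ _ (\int[leb]_(u in `[x, +oo[) (K' * g u))).
  apply: le_trans (le_normr_Rintegral _ _) _ => //; first exact: ik.
  apply: le_Rintegral => //.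
  - by apply: integrable_norm; exact: ik.
  - have iK : leb.-integrable setT (fun x => (K' * g x)%:E).
      exact: (integrableZl measurableT K' ig).
    by apply: integrableS iK.
  - by move=> u _; exact: (le_g HK).
have Gy : G x @[x --> +oo%R] --> Ginf.
  rewrite -[X in _ --> X]subr0 (_ : G = fun x => Ginf - (Ginf - G x)); last first.
    by apply/funext => y; ring.
  by apply: cvgB; [exact: cvg_cst|exact: gamma_sqr_primitive_aty].
have dG (u : R) : x <= u -> is_derive u 1 G (g u).
  by move=> xu; apply: gamma_sqr_primitive_derive => //; exact: lt_le_trans xu.
have cgx (u : R) : x <= u -> {for u, continuous g}.
  by move=> xu; apply: cg; exact: lt_le_trans xu.
rewrite RintegralZl//.
by rewrite /Rintegral (ge0_FTC_itvxy dG cgx Gy).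
Qed.

(** By parts, A is the integral of h' P over [0, x] and B that of h' Q over [x, +oo[. They express
    the solution through h' and make it bilinear in (A, B) and the tails. *)
Definition steinA x := (h x - m) * P x - S x.
Definition steinB x := - ((h x - m) * Q x + S x).
Local Notation A := steinA.
Local Notation B := steinB.

Lemma steinA_derive (x : R) : 0 < x -> is_derive x 1 A (h' x * P x).
Proof.
move=> x0; have := dh x0 => ?; have := dP x0 => ?; have := dS x0 => ?.
by rewrite /A; rderive; rewrite /H; ring.
Qed.

Lemma steinB_derive (x : R) : 0 < x -> is_derive x 1 B (- (h' x * Q x)).
Proof.
move=> x0; have := dh x0 => ?; have := dQ x0 => ?; have := dS x0 => ?.
by rewrite /B; rderive; rewrite /H; ring.
Qed.

Lemma steinA_at0 : A x @[x --> (0:R)^'+] --> (0 : R).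
Proof.
rewrite -[X in _ --> X]subr0; apply: cvgB; last exact: stein_primitive_at0.
apply: (cvg00_le (G := fun x => K' * 4 * P x)); last first.
  by apply: cvg00_mul (cvg_cst _) _; exact: gamma_low_at0.
move=> x x0 x1; rewrite normrM [`|P x|]ger0_norm ?gamma_low_ge0// ler_wpM2r ?gamma_low_ge0//.
apply: (le_trans (HK x0)); rewrite ler_wpM2l ?addr_ge0//.
by rewrite (_ : 4 = 2 ^+ 2); [rewrite lerXn2r ?nnegrE//; lra|rewrite expr2; ring].
Qed.

Lemma steinB_aty : B x @[x --> +oo%R] --> (0 : R).
Proof.
rewrite -oppr0; apply: cvgN; apply: cvgy0_sum; last exact: stein_primitive_aty.
apply: (cvgy0_le_fun (M := 0) (G := fun x => K' * (x ^+ 0 * Q x + (2 * (x ^+ 1 * Q x) + x ^+ 2 * Q x)))); last first.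
  apply: cvgy0_scale; apply: cvgy0_sum; first exact: gamma_up_moment_aty.
  by apply: cvgy0_sum; [apply: cvgy0_scale|]; exact: gamma_up_moment_aty.
move=> x _ x0; rewrite normrM [`|Q x|]ger0_norm ?gamma_up_ge0//.
apply: (@le_trans _ _ (K' * (1 + x) ^+ 2 * Q x)).
  by rewrite ler_wpM2r ?gamma_up_ge0// HK.
by rewrite le_eqVlt; apply/orP; left; apply/eqP; ring.
Qed.

Lemma stein_SE (x : R) : 0 < x -> S x = - (Q x * A x + P x * B x).
Proof. by move=> x0; rewrite /A /B gamma_upE ?(ltW x0)//; ring. Qed.

(** The Stein equation amounts to (x p f)' = (h - m) p, and S is the primitive of the right side
    that vanishes at 0. *)
Definition stein_sol x := S x / (x * p x).
Definition stein_sol1 x := (up1 a x * A x - low1 a x * B x) / (x ^+ 2 * p x).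
Definition stein_sol2 x := (h' x - 2 * (up2 a x * A x + low2 a x * B x) / (x ^+ 2 * p x)) / x.
Local Notation f := stein_sol.
Local Notation f1 := stein_sol1.
Local Notation f2 := stein_sol2.

Lemma stein_sol_derive (x : R) : 0 < x -> is_derive x 1 f (f1 x).
Proof.
move=> x0; have p0 := gamma_pdf_gt0 mass1 x0.
have := dS x0 => ?; have := dp x0 => ?.
rewrite /f; rderive; first by rewrite mulf_neq0 ?gt_eqF.
rewrite /f1 /A /B /up1 /low1 /H gamma_upE ?(ltW x0)//.
by field; rewrite !gt_eqF.
Qed.

Lemma stein_equation (x : R) : 0 < x -> x * f1 x + (a - x) * f x = h x - m.
Proof.
move=> x0; have p0 := gamma_pdf_gt0 mass1 x0.
rewrite /f1 /f /A /B /up1 /low1 gamma_upE ?(ltW x0)//.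
by field; rewrite !gt_eqF.
Qed.

Lemma stein_sol1_derive (x : R) : 0 < x -> is_derive x 1 f1 (f2 x).
Proof.
move=> x0; have p0 := gamma_pdf_gt0 mass1 x0.
have := dp x0 => ?; have := up1_derive mass1 x0 => ?; have := low1_derive mass1 x0 => ?.
have := steinA_derive x0 => ?; have := steinB_derive x0 => ?.
rewrite /f1; rderive; first by rewrite mulf_neq0 ?expf_neq0 ?gt_eqF.
rewrite /f2 /up2 /low2 /up1 /low1 gamma_upE ?(ltW x0)//.
by field; rewrite !gt_eqF.
Qed.

Lemma stein_equation_derive (x : R) : 0 < x -> x * f2 x + (a + 1 - x) * f1 x - f x = h' x.
Proof.
move=> x0; have p0 := gamma_pdf_gt0 mass1 x0.
rewrite /f2 /f1 /f stein_SE// /up2 /low2.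
by field; rewrite !gt_eqF.
Qed.

Lemma stein_sol2_continuous (x : R) : 0 < x -> {for x, continuous f2}.
Proof.
move=> x0; have p0 := gamma_pdf_gt0 mass1 x0.
have := dp x0 => ?; have := up2_derive mass1 x0 => ?; have := low2_derive mass1 x0 => ?.
have := steinA_derive x0 => ?; have := steinB_derive x0 => ?.
have xp0 : x ^+ 2 * p x != 0 by apply: mulf_neq0; [apply: expf_neq0|]; rewrite gt_eqF.
apply: continuousM; last first.
  apply: rderive_continuous; apply: (rderiveV _ (rderive_id x)).
  by rewrite gt_eqF.
apply: continuousB; first exact: ch'.
apply: rderive_continuous.
Qed.

(** G + F and G - F have nonnegative derivatives and vanish at 0. *)
Let sandwich0 (F df G dG : R -> R) :
  (forall x : R, 0 < x -> is_derive x 1 F (df x)) ->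
  (forall x : R, 0 < x -> is_derive x 1 G (dG x)) ->
  F x @[x --> (0:R)^'+] --> (0 : R) -> G x @[x --> (0:R)^'+] --> (0 : R) ->
  (forall x : R, 0 < x -> `|df x| <= dG x) -> forall x : R, 0 < x -> `|F x| <= G x.
Proof.
move=> dF dGG F0 G0 dfG x x0; rewrite ler_norml lerNl -subr_ge0 opprK -[X in _ && X]subr_ge0.
apply/andP; split.
  apply: (halfline_ge0 (F := fun x => G x + F x) (f := fun x => dG x + df x)) => //.
  - by move=> z z0; have := dF z z0 => ?; have := dGG z z0 => ?; rderive.
  - by move=> z /dfG; rewrite ler_norml => /andP[H1 _]; lra.
  - by rewrite -[X in _ --> X]addr0; exact: cvgD.
apply: (halfline_ge0 (F := fun x => G x - F x) (f := fun x => dG x - df x)) => //.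
- by move=> z z0; have := dF z z0 => ?; have := dGG z z0 => ?; rderive.
- by move=> z /dfG; rewrite ler_norml => /andP[_ H1]; lra.
- by rewrite -[X in _ --> X]subr0; exact: cvgB.
Qed.

Let sandwichy (F df G dG : R -> R) :
  (forall x : R, 0 < x -> is_derive x 1 F (df x)) ->
  (forall x : R, 0 < x -> is_derive x 1 G (- dG x)) ->
  F x @[x --> +oo%R] --> (0 : R) -> G x @[x --> +oo%R] --> (0 : R) ->
  (forall x : R, 0 < x -> `|df x| <= dG x) -> forall x : R, 0 < x -> `|F x| <= G x.
Proof.
move=> dF dGG F0 G0 dfG x x0; rewrite ler_norml lerNl -subr_ge0 opprK -[X in _ && X]subr_ge0.
apply/andP; split.
  apply: (halfline_ge0y (F := fun x => G x + F x) (f := fun x => - dG x + df x) x0) (lexx x) => //.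
  - by move=> z z0; have := dF z z0 => ?; have := dGG z z0 => ?; rderive.
  - by move=> z /(lt_trans x0)/dfG; rewrite ler_norml => /andP[_ H1]; lra.
  - exact: cvgy0_sum.
apply: (halfline_ge0y (F := fun x => G x - F x) (f := fun x => - dG x - df x) x0) (lexx x) => //.
- by move=> z z0; have := dF z z0 => ?; have := dGG z z0 => ?; rderive.
- by move=> z /(lt_trans x0)/dfG; rewrite ler_norml => /andP[H1 _]; lra.
- by rewrite -[X in _ --> X]subr0; exact: cvgB.
Qed.

Let aty0 (F : R -> R) : x ^+ 0 * F x @[x --> +oo%R] --> (0 : R) -> F x @[x --> +oo%R] --> (0 : R).
Proof. by under eq_cvg do rewrite expr0 mul1r. Qed.

Let comb (u v l w z t : R) : 0 <= u -> 0 <= v -> `|l| <= w -> `|z| <= t ->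
  `|u * l + v * z| <= u * w + v * t.
Proof.
move=> u0 v0 lw zt; apply: (le_trans (ler_normD _ _)); rewrite !normrM.
by rewrite (ger0_norm u0) (ger0_norm v0) lerD// ler_wpM2l.
Qed.

Section first_order.
Hypothesis h'1 : forall x : R, 0 < x -> `|h' x| <= 1.

Lemma steinA_le (x : R) : 0 < x -> `|A x| <= low1 a x.
Proof.
apply: (sandwich0 steinA_derive (low1_derive mass1) steinA_at0 (low1_at0 a0 mass1)) => z z0.
by rewrite normrM [`|P z|]ger0_norm ?gamma_low_ge0// ler_piMl ?gamma_low_ge0// h'1.
Qed.

Lemma steinB_le (x : R) : 0 < x -> `|B x| <= up1 a x.
Proof.
apply: (sandwichy steinB_derive (up1_derive mass1) steinB_aty (aty0 (up1_moment_aty a0 mass1 0))) => z z0.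
by rewrite normrN normrM [`|Q z|]ger0_norm ?gamma_up_ge0// ler_piMl ?gamma_up_ge0// h'1.
Qed.

(** |Q A + P B| <= Q low1 + P up1, and the latter is the denominator x p. *)
Lemma stein_sol_le1 (x : R) : 0 < x -> `|f x| <= 1.
Proof.
move=> x0; have p0 := gamma_pdf_gt0 mass1 x0; have xp : 0 < x * p x by rewrite mulr_gt0.
rewrite /f stein_SE// normrM normfV normrN (gtr0_norm xp) ler_pdivrMr// mul1r -(tails1 mass1 x0).
by apply: comb; [exact: gamma_up_ge0|exact: gamma_low_ge0|exact: steinA_le|exact: steinB_le].
Qed.

(** One unit comes from h', the other from the tail term, which [tails2] normalises exactly. *)
Lemma stein_sol2_le2 (x : R) : 0 < x -> `|x * f2 x| <= 2.
Proof.
move=> x0; have p0 := gamma_pdf_gt0 mass1 x0; have xp : 0 < x ^+ 2 * p x by rewrite mulr_gt0 ?exprn_gt0.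
rewrite /f2 [x * _]mulrCA divff ?gt_eqF// mulr1.
apply: (le_trans (ler_normB _ _)); rewrite (_ : 2 = 1 + 1)//; apply: lerD; first exact: h'1.
rewrite normrM normfV (gtr0_norm xp) ler_pdivrMr// mul1r normrM ger0_norm// -(tails2 mass1 x0).
rewrite ler_pM2l//.
by apply: comb; [exact: up2_ge0|exact: low2_ge0|exact: steinA_le|exact: steinB_le].
Qed.

End first_order.

Section second_order.
Variable h'' : R -> R.
Hypothesis dh' : forall x : R, 0 < x -> is_derive x 1 h' (h'' x).
Hypothesis ch'' : forall x : R, 0 < x -> {for x, continuous h''}.
Hypothesis h''1 : forall x : R, 0 < x -> `|h'' x| <= 1.

(** By parts once more, A2 is the integral of h'' low1 over [0, x] and B2 that of h'' up1 over [x,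
    +oo[. *)
Definition steinA2 x := h' x * low1 a x - A x.
Definition steinB2 x := B x - h' x * up1 a x.
Local Notation A2 := steinA2.
Local Notation B2 := steinB2.

Lemma steinA2_derive (x : R) : 0 < x -> is_derive x 1 A2 (h'' x * low1 a x).
Proof.
move=> x0; have := dh' x0 => ?; have := low1_derive mass1 x0 => ?; have := steinA_derive x0 => ?.
by rewrite /A2; rderive; ring.
Qed.

Lemma steinB2_derive (x : R) : 0 < x -> is_derive x 1 B2 (- (h'' x * up1 a x)).
Proof.
move=> x0; have := dh' x0 => ?; have := up1_derive mass1 x0 => ?; have := steinB_derive x0 => ?.
by rewrite /B2; rderive; ring.
Qed.

Lemma steinA2_at0 : A2 x @[x --> (0:R)^'+] --> (0 : R).
Proof.
rewrite -[X in _ --> X]subr0; apply: cvgB; last exact: steinA_at0.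
apply: (cvg00_le (G := fun x => K * 2 * low1 a x)); last first.
  by apply: cvg00_mul (cvg_cst _) _; exact: low1_at0.
move=> x x0 x1; have l0 := low1_ge0 a0 mass1 x0.
rewrite normrM (ger0_norm l0) ler_wpM2r// (le_trans (h'K x0))// ler_wpM2l//; lra.
Qed.

Lemma steinB2_aty : B2 x @[x --> +oo%R] --> (0 : R).
Proof.
rewrite -[X in _ --> X]subr0; apply: cvgB; first exact: steinB_aty.
apply: (cvgy0_le_fun (M := 0) (G := fun x => K * (x ^+ 0 * up1 a x + x ^+ 1 * up1 a x))); last first.
  by apply: cvgy0_scale; apply: cvgy0_sum; exact: up1_moment_aty.
move=> x _ x0; have u0 := up1_ge0 a0 mass1 x0; rewrite normrM (ger0_norm u0).
apply: (@le_trans _ _ (K * (1 + x) * up1 a x)).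
  by rewrite ler_wpM2r// h'K.
by rewrite le_eqVlt; apply/orP; left; apply/eqP; ring.
Qed.

Lemma steinA2_le (x : R) : 0 < x -> `|A2 x| <= low2 a x.
Proof.
apply: (sandwich0 steinA2_derive (low2_derive mass1) steinA2_at0 (low2_at0 a0 mass1)) => z z0.
by rewrite normrM (ger0_norm (low1_ge0 a0 mass1 z0)) ler_piMl ?low1_ge0// h''1.
Qed.

Lemma steinB2_le (x : R) : 0 < x -> `|B2 x| <= up2 a x.
Proof.
apply: (sandwichy steinB2_derive (up2_derive mass1) steinB2_aty (aty0 (up2_moment_aty a0 mass1 0))) => z z0.
by rewrite normrN normrM (ger0_norm (up1_ge0 a0 mass1 z0)) ler_piMl ?up1_ge0// h''1.
Qed.

Definition stein_sol3 x := (h'' x - 6 * (up3 a x * A2 x + low3 a x * B2 x) / (x ^+ 3 * p x)) / x.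
Local Notation f3 := stein_sol3.

(** h' is multiplied by the expression of 1 that [tails2] provides, and then combines with A and B
    into A2 and B2. *)
Lemma stein_sol2E (x : R) : 0 < x -> f2 x = 2 * (up2 a x * A2 x - low2 a x * B2 x) / (x ^+ 3 * p x).
Proof.
move=> x0; have p0 := gamma_pdf_gt0 mass1 x0.
have T : h' x = h' x * (2 * (up2 a x * low1 a x + low2 a x * up1 a x)) / (x ^+ 2 * p x).
  by rewrite tails2//; field; rewrite !gt_eqF.
rewrite /f2 [in LHS]T /A2 /B2; field; rewrite !gt_eqF//.
Qed.

Lemma stein_sol2_derive (x : R) : 0 < x -> is_derive x 1 f2 (f3 x).
Proof.
move=> x0; have p0 := gamma_pdf_gt0 mass1 x0.
have D : is_derive x 1 (fun x => 2 * (up2 a x * A2 x - low2 a x * B2 x) / (x ^+ 3 * p x)) (f3 x).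
  have := dp x0 => ?; have := up2_derive mass1 x0 => ?; have := low2_derive mass1 x0 => ?.
  have := steinA2_derive x0 => ?; have := steinB2_derive x0 => ?.
  rderive; first by rewrite mulf_neq0 ?expf_neq0 ?gt_eqF.
  have T : h'' x = h'' x * (2 * (up2 a x * low1 a x + low2 a x * up1 a x)) / (x ^+ 2 * p x).
    by rewrite tails2//; field; rewrite !gt_eqF.
  rewrite /f3 [in RHS]T /low3 /up3; field; rewrite !gt_eqF//.
apply: near_rderive D; near=> y.
by rewrite stein_sol2E//; near: y; exact: near_gt0.
Unshelve. all: end_near. Qed.

Lemma stein_sol3_continuous (x : R) : 0 < x -> {for x, continuous f3}.
Proof.
move=> x0; have p0 := gamma_pdf_gt0 mass1 x0.
apply: continuousM; last first.
  apply: rderive_continuous; rderive; [by rewrite gt_eqF|reflexivity].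
apply: continuousB; first exact: ch''.
apply: continuousM; last first.
  have := dp x0 => ?.
  apply: rderive_continuous; rderive; first by rewrite mulf_neq0 ?expf_neq0 ?gt_eqF.
  reflexivity.
apply: continuousM; first exact: cvg_cst.
apply: continuousD; apply: continuousM.
- exact: rderive_continuous (up3_derive mass1 x0).
- exact: rderive_continuous (steinA2_derive x0).
- exact: rderive_continuous (low3_derive mass1 x0).
- exact: rderive_continuous (steinB2_derive x0).
Qed.

(** The multiples of h' contained in A and B cancel in the numerator, which leaves A2 and B2. *)
Lemma stein_sol1_le1 (x : R) : 0 < x -> `|f1 x| <= 1.
Proof.
move=> x0; have p0 := gamma_pdf_gt0 mass1 x0; have xp : 0 < x ^+ 2 * p x by rewrite mulr_gt0 ?exprn_gt0.
have -> : f1 x = - (up1 a x * A2 x + low1 a x * B2 x) / (x ^+ 2 * p x).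
  by rewrite /f1 /A2 /B2; congr (_ / _); ring.
rewrite normrM normfV (gtr0_norm xp) ler_pdivrMr// mul1r normrN -(tails2 mass1 x0).
apply: (@le_trans _ _ (up1 a x * low2 a x + low1 a x * up2 a x)).
  by apply: comb; [exact: up1_ge0|exact: low1_ge0|exact: steinA2_le|exact: steinB2_le].
have H1 : 0 <= up2 a x * low1 a x by rewrite mulr_ge0 ?up2_ge0 ?low1_ge0.
have H2 : 0 <= low2 a x * up1 a x by rewrite mulr_ge0 ?low2_ge0 ?up1_ge0.
by rewrite [up1 a x * _]mulrC [low1 a x * _]mulrC; lra.
Qed.

(** The bounds low2 and up2 of A2 and B2 contribute equally, and their sum is the closed form of
    [C2]; this is where [e_const] enters. *)
Lemma stein_sol2_le_C2 (x : R) : 0 < x -> `|f2 x| <= 4 * up2 a x * low2 a x / (x ^+ 3 * p x).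
Proof.
move=> x0; have p0 := gamma_pdf_gt0 mass1 x0; have xp : 0 < x ^+ 3 * p x by rewrite mulr_gt0 ?exprn_gt0.
rewrite stein_sol2E// normrM normfV (gtr0_norm xp) ler_pM2r ?invr_gt0// normrM ger0_norm//.
have -> : 4 * up2 a x * low2 a x = 2 * (up2 a x * low2 a x + low2 a x * up2 a x) by ring.
rewrite ler_pM2l// -mulrN; apply: comb; rewrite ?normrN.
- exact: up2_ge0.
- exact: low2_ge0.
- exact: steinA2_le.
- exact: steinB2_le.
Qed.

Lemma stein_sol3_le2 (x : R) : 0 < x -> `|x * f3 x| <= 2.
Proof.
move=> x0; have p0 := gamma_pdf_gt0 mass1 x0; have xp : 0 < x ^+ 3 * p x by rewrite mulr_gt0 ?exprn_gt0.
rewrite /f3 [x * _]mulrCA divff ?gt_eqF// mulr1.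
apply: (le_trans (ler_normB _ _)); rewrite (_ : 2 = 1 + 1)//; apply: lerD; first exact: h''1.
rewrite normrM normfV (gtr0_norm xp) ler_pdivrMr// mul1r normrM ger0_norm// -(tails3 mass1 x0).
rewrite ler_pM2l//.
by apply: comb; [exact: up3_ge0|exact: low3_ge0|exact: steinA2_le|exact: steinB2_le].
Qed.

End second_order.
End stein.

Section positive_part.
Context {R : realType}.
Local Notation mR := (measurableTypeR R).
Implicit Types f : R -> R.

(** Stein solutions are controlled on the positive half-line; extension by 0 makes them measurable
    on the line, and X = 0 is a null event. *)
Definition halfline_patch f : R -> R := f \_ `]0%R, +oo[.

Lemma halfline_patchE f (x : R) : 0 < x -> halfline_patch f x = f x.
Proof. by move=> x0; rewrite /halfline_patch patchE mem_set//= in_itv/= x0. Qed.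

Lemma halfline_patch0 f (x : R) : x <= 0 -> halfline_patch f x = 0.
Proof.
by move=> x0; rewrite /halfline_patch patchE memNset//= in_itv/= andbT; apply/negP; rewrite -leNgt.
Qed.

Lemma halfline_patch_derive f (x b : R) : 0 < x -> is_derive x 1 f b ->
  is_derive x 1 (halfline_patch f) b.
Proof.
move=> x0; apply: near_rderive; near=> y.
by rewrite halfline_patchE//; near: y; exact: near_gt0.
Unshelve. all: end_near. Qed.

Lemma halfline_patch_continuous f (x : R) : 0 < x -> {for x, continuous f} ->
  {for x, continuous (halfline_patch f)}.
Proof.
move=> x0; rewrite /prop_for /continuous_at halfline_patchE//; apply: cvg_trans.
apply: near_eq_cvg; near=> y; rewrite halfline_patchE//; near: y; exact: near_gt0.
Unshelve. all: end_near. Qed.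

Lemma expRN_growth0 f (x b M : R) : 0 < x -> 0 < b ->
  (forall y, x <= y -> `|f y| <= M * (1 + y)) ->
  expR (- u) * f (x + b * u) @[u --> +oo%R] --> (0 : R).
Proof.
move=> x0 b0 fM.
have M0 : 0 <= M.
  have := le_trans (normr_ge0 _) (fM x (lexx x)); rewrite pmulr_lge0//; lra.
apply: (@cvgy0_le _ _ 0 (M * ((1 + x) + b * 4))) => u _ u0.
have bu : 0 < b * u by rewrite mulr_gt0.
rewrite normrM ger0_norm ?expR_ge0//.
apply: (@le_trans _ _ (expR (- u) * (M * (1 + (x + b * u))))).
  by rewrite ler_wpM2l ?expR_ge0// fM// lerDl ltW.
have E0 := exprn_expRN_le 0 u0; have E1 := exprn_expRN_le 1 u0.
rewrite expr0 mul1r expr1 in E0; rewrite expr1 in E1.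
have -> : expR (- u) * (M * (1 + (x + b * u))) = M * ((1 + x) * expR (- u) + b * (u * expR (- u))) by ring.
have -> : M * ((1 + x) + b * 4) / u = M * ((1 + x) * (1 / u) + b * (2 ^+ 2 / u)).
  by field; rewrite gt_eqF.
rewrite ler_wpM2l//; apply: lerD; rewrite ler_wpM2l ?(ltW b0)//; lra.
Qed.

End positive_part.

(** * Moments and growth conditions *)

Section gamma_sum_moments.
Context {R : realType} {d : measure_display} {T : measurableType d}.
Notation leb := (@lebesgue_measure R).
Local Notation mR := (measurableTypeR R).
Local Notation E := (@exp_law R).
Variables (P : probability T R) (X : T -> mR).
Hypothesis mX : measurable_fun setT X.
Hypothesis X0 : forall w, 0 <= X w.
Variables (I : finType) (al be : I -> R).
Hypothesis al0 : forall i, 0 < al i.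
Hypothesis be0 : forall i, 0 < be i.
Hypothesis HL : forall t : R, 0 <= t ->
  (\int[P]_w (expR (- (t * X w)))%:E = (gamma_laplace al be t)%:E)%E.

Lemma gamma_sum_integrable : P.-integrable setT (fun w => (X w)%:E).
Proof.
apply/integrableP; split; first exact/measurable_EFinP.
have := weighted_laplace mX X0 be0 HL (lexx 0).
under eq_integral do rewrite mul0r oppr0 expR0 mulr1.
move=> H; under eq_integral do rewrite abse_EFin ger0_norm//.
by rewrite H ltry.
Qed.

Let mabs : measurable_fun setT (fun u : mR => (`|u| : R)%:E).
Proof. by apply/measurable_EFinP; exact: (@normr_measurable R setT). Qed.

Let exp_law_mean : (\int[E]_u `|u|%:E < +oo)%E.
Proof.
rewrite ge0_integral_exponential//.
pose F (u : R) := - ((1 + u) * expR (- u)).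
have dF (u : R) : 0 < u -> is_derive u 1 F (u * expR (- u)).
  by move=> _; rewrite /F; rderive; ring.
rewrite (eq_integral (fun u : mR => (u * expR (- u) : R)%:E)); last first.
  by move=> u; rewrite inE/= in_itv/= andbT => u0; rewrite -EFinM ger0_norm ?ltW// mulrC.
rewrite (ge0_FTC_itv0y (la := - 1) (lb := 0) dF).
- by rewrite ltry.
- move=> u _; apply: rderive_continuous; rderive; reflexivity.
- apply: cvg_at_right_filter.
  have -> : (- 1 : R) = F 0 by rewrite /F oppr0 expR0 mulr1 addr0.
  suff : {for (0 : R), continuous F} by [].
  by apply: rderive_continuous; rewrite /F; rderive; reflexivity.
- rewrite -oppr0; apply: cvgN.
  have := @expRN_growth0 R (fun y => y) 1 1 1 ltr01 ltr01.
  under eq_cvg do rewrite mul1r mulrC.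
  by apply => y y1; rewrite mul1r ger0_norm; lra.
- by move=> u u0; rewrite mulr_ge0 ?expR_ge0// ltW.
Qed.

(** The bias identity for the function |x| reduces the second moment to the means of X + be_i u. *)
Lemma gamma_sum_sqr_integrable : P.-integrable setT (fun w => (X w ^+ 2)%:E).
Proof.
apply/integrableP; split.
  by apply/measurable_EFinP; exact: measurable_funX.
have H := ge0_bias_identity mX X0 al0 be0 HL mabs (fun y => lee_tofin (normr_ge0 y)).
under eq_integral do rewrite abse_EFin ger0_norm ?sqr_ge0//.
rewrite (eq_integral (fun w => (X w)%:E * `|X w|%:E)%E); last first.
  by move=> w _; rewrite -EFinM ger0_norm// -expr2.
rewrite H; have iX := gamma_sum_integrable.
have [m mE] : exists m, (\int[E]_u `|u|%:E = m%:E)%E.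
  by exists (fine (\int[E]_u `|u|%:E)); rewrite fineK// ge0_fin_numE ?exp_law_mean//; apply: integral_ge0.
apply: lte_sum_pinfty => i _.
have c0 : 0 <= al i * be i by rewrite mulr_ge0// ltW.
apply: lte_mul_pinfty => //.
have m0 : 0 <= m by rewrite -lee_fin -mE; apply: integral_ge0.
have mY : measurable_fun setT (fun z : T * mR => (`|X z.1 + be i * z.2| : R)%:E).
  have mYi : measurable_fun setT (fun z : T * mR => X z.1 + be i * z.2 : mR).
    apply: measurable_funD; first exact: measurableT_comp.
    by apply: measurable_funM => //; exact: measurable_snd.
  exact: (measurableT_comp mabs mYi).
apply: (@le_lt_trans _ _ (\int[P]_w ((X w)%:E + (be i * m)%:E))%E); last first.
  rewrite integralD//; last exact: (finite_measure_integrable_cst P (be i * m)).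
  rewrite lte_add_pinfty//.
    by have /integrable_fin_num := iX; rewrite ltey_eq => ->.
  have /integrable_fin_num := finite_measure_integrable_cst P (be i * m) measurableT.
  by rewrite ltey_eq => ->.
apply: ge0_le_integral => //.
- by move=> w _; exact: integral_ge0.
- exact: (measurable_fun_fubini_tonelli_F (m2 := E) (fun z : T * mR => (`|X z.1 + be i * z.2| : R)%:E)).
- by apply/measurable_EFinP; exact: measurable_funD.
- move=> w _; rewrite EFinM -mE -(ge0_integralZl_EFin E measurableT)//; last exact: ltW.
  have -> : (X w)%:E = (\int[E]_u (cst (X w)%:E u))%E.
    by rewrite integral_cst//= probability_setT mule1.
  rewrite -ge0_integralD//; last 3 first.
  + by move=> u _; rewrite lee_fin.
  + by move=> u _; rewrite mule_ge0// lee_fin ltW.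
  + by apply: emeasurable_funM.
  apply: ge0_le_integral => //.
  + by apply: (measurableT_comp mY (pair1_measurable w)).
  + by apply: emeasurable_funD => //; exact: emeasurable_funM.
  + move=> u _; rewrite -EFinM -EFinD lee_fin (le_trans (ler_normD _ _))//.
    by rewrite normrM (ger0_norm (X0 w)) (gtr0_norm (be0 i)).
Qed.

Lemma gamma_sum_quadratic_integrable (f : mR -> R) (K : R) : measurable_fun setT f ->
  (forall x, `|f x| <= K * (1 + x) ^+ 2) -> P.-integrable setT (fun w => (f (X w))%:E).
Proof.
move=> mf fK; apply: (@le_integrable _ _ _ P setT measurableT _
    (fun w => (K * (1 + (X w + (X w + X w ^+ 2))))%:E)).
- by apply/measurable_EFinP; exact: (measurableT_comp mf).
- move=> w _; rewrite lee_fin; apply: le_trans (ler_norm _); apply: le_trans (fK _) _.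
  by rewrite le_eqVlt; apply/orP; left; apply/eqP; ring.
- have i1 := finite_measure_integrable_cst P 1 measurableT.
  have iX := gamma_sum_integrable.
  have H := integrableD measurableT iX gamma_sum_sqr_integrable.
  have := integrableZl measurableT K (integrableD measurableT i1 (integrableD measurableT iX H)).
  by apply: eq_integrable => // w _; rewrite /= -!EFinD -EFinM.
Qed.

End gamma_sum_moments.

Section growth.
Context {R : realType}.
Implicit Types g h : R -> R.

(** Values are compared with the one at 1, since g is controlled on the open half-line only. *)
Lemma linear_growth g (g' : R -> R) (L x : R) : (forall y : R, 0 < y -> is_derive y 1 g (g' y)) ->
  (forall y : R, 0 < y -> `|g' y| <= L) -> 0 < x -> `|g x| <= (`|g 1| + L) * (1 + x).
Proof.
move=> dg g'L x0; have L0 : 0 <= L by exact: le_trans (normr_ge0 _) (g'L 1 ltr01).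
have H : `|g x - g 1| <= L * (1 + x).
  have [x1|x1] := leP x 1.
    have := halfline_lipschitz dg x0 x1 (fun z xz _ => g'L _ (lt_trans x0 xz)).
    by rewrite distrC; nra.
  have := halfline_lipschitz dg ltr01 (ltW x1) (fun z xz _ => g'L _ (lt_trans ltr01 xz)); nra.
have := le_trans (lerB_dist _ _) H; have := normr_ge0 (g 1); nra.
Qed.

Lemma linear_growth_sqr h h' (x : R) : (forall y : R, 0 < y -> is_derive y 1 h (h' y)) ->
  (forall y : R, 0 < y -> `|h' y| <= 1) -> 0 < x -> `|h x| <= (`|h 1| + 1) * (1 + x) ^+ 2.
Proof.
move=> dh h'1 x0; apply: (le_trans (linear_growth dh h'1 x0)); rewrite ler_wpM2l ?addr_ge0//.
by rewrite expr2 ler_peMl//; lra.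
Qed.

Lemma quadratic_growth h h' h'' (x : R) : (forall y : R, 0 < y -> is_derive y 1 h (h' y)) ->
  (forall y : R, 0 < y -> is_derive y 1 h' (h'' y)) ->
  (forall y : R, 0 < y -> `|h'' y| <= 1) -> 0 < x ->
  `|h x| <= (`|h 1| + 2 * (`|h' 1| + 1)) * (1 + x) ^+ 2.
Proof.
move=> dh dh' h''1 x0; set K1 := `|h' 1| + 1.
have K10 : 0 <= K1 by rewrite addr_ge0.
have h'K1 (y : R) : 0 < y -> `|h' y| <= K1 * (1 + y) by move=> y0; exact: linear_growth.
have H : `|h x - h 1| <= 2 * K1 * (1 + x) ^+ 2.
  have [x1|x1] := leP x 1.
    have H : `|h 1 - h x| <= 2 * K1 * (1 - x).
      apply: (halfline_lipschitz dh x0 x1) => z xz z1.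
      apply: (le_trans (h'K1 _ (lt_trans x0 xz))); nra.
    rewrite distrC; apply: (le_trans H); nra.
  have H : `|h x - h 1| <= K1 * (1 + x) * (x - 1).
    apply: (halfline_lipschitz dh ltr01 (ltW x1)) => z z1 zx.
    apply: (le_trans (h'K1 _ (lt_trans ltr01 z1))); rewrite ler_wpM2l //; lra.
  apply: (le_trans H); rewrite expr2 mulrA; nra.
have H1 := le_trans (lerB_dist _ _) H.
have H2 : `|h 1| <= `|h 1| * (1 + x) ^+ 2 by rewrite ler_peMr// exprn_ege1// lerDl ltW.
rewrite mulrDl; lra.
Qed.

End growth.

(** * Comparison with the Gamma law *)

Section gamma_comparison.
Context {R : realType} {d : measure_display} {T : measurableType d}.
Notation leb := (@lebesgue_measure R).
Local Notation mR := (measurableTypeR R).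
Local Notation E := (@exp_law R).
Local Notation "f ^#" := (halfline_patch f) (at level 2, format "f ^#").
Variables (P : probability T R) (X : T -> mR).
Hypothesis mX : measurable_fun setT X.
Hypothesis X0 : forall w, 0 <= X w.
Variables (I : finType) (al be : I -> R) (i0 : I).
Hypothesis al0 : forall i, 0 < al i.
Hypothesis be0 : forall i, 0 < be i.
Hypothesis HL : forall t : R, 0 <= t ->
  (\int[P]_w (expR (- (t * X w)))%:E = (gamma_laplace al be t)%:E)%E.
Variable a : R.
Hypothesis mean_be : \sum_i al i * be i = a.
Hypothesis var_be : \sum_i al i * be i * be i = a.
Hypothesis mass1 : (\int[leb]_(x in `]0%R, +oo[) (gamma_pdf a 1 x)%:E = 1)%E.

Local Notation Q := (P \x E)%E.
Local Notation Y i := (fun z : T * mR => X z.1 + be i * z.2).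
Let c i := al i * be i.

Let c0 i : 0 < c i. Proof. by rewrite mulr_gt0. Qed.

Lemma gamma_shape_gt0 : 0 < a.
Proof.
rewrite -mean_be (bigD1 i0)//= ltr_pwDl//; first exact: c0.
by apply: sumr_ge0 => i _; exact: ltW (c0 i).
Qed.
Let a0 := gamma_shape_gt0.

Let PX0 := gamma_null0 mX al0 be0 HL i0.

Let Xpos : {ae P, forall w, 0 < X w}.
Proof.
exists (X @^-1` [set 0]); split => //.
  by rewrite -[X in measurable X]setTI; exact: mX.
move=> w /= /negP; rewrite -leNgt => Xw.
by apply/eqP; rewrite eq_le Xw X0.
Qed.

Let ae_Rintegral (f g : T -> R) : measurable_fun setT f -> measurable_fun setT g ->
  (forall w, 0 < X w -> f w = g w) -> \int[P]_w f w = \int[P]_w g w.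
Proof.
move=> mf mg fg; congr fine; apply: ae_eq_integral => //; try exact/measurable_EFinP.
by apply: filterS Xpos => w /fg -> _.
Qed.

Let smooth i (g g' : R -> R) :
  (forall y : R, 0 < y -> is_derive y 1 g (g' y)) ->
  (forall y : R, 0 < y -> {for y, continuous g'}) ->
  (forall x : R, 0 < x -> exists M, forall y, x <= y -> `|g y| <= M * (1 + y)) ->
  P.-integrable setT (fun w => (X w * g^# (X w))%:E) ->
  P.-integrable setT (fun w => (X w * g'^# (X w))%:E) ->
  P.-integrable setT (fun w => (g^# (X w))%:E) /\
  \int[Q]_z g^# (Y i z) = \int[P]_w g^# (X w) + be i * \int[Q]_z g'^# (Y i z).
Proof.
move=> dg cg' gM ig ig'.
have cg (y : R) : 0 < y -> {for y, continuous g} by move=> y0; exact: rderive_continuous (dg y y0).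
have mg : measurable_fun setT (g^# : mR -> mR) by exact: measurable_halfline.
have mg' : measurable_fun setT (g'^# : mR -> mR) by exact: measurable_halfline.
apply: (exp_smoothing mX X0 PX0 (be0 i) mg mg').
- by move=> y y0; rewrite halfline_patchE//; apply: halfline_patch_derive => //; exact: dg.
- by move=> y y0; apply: halfline_patch_continuous => //; exact: cg'.
- move=> x x0; have [M HM] := gM x x0.
  apply: (expRN_growth0 (M := M) x0 (be0 i)) => y xy.
  by rewrite halfline_patchE ?HM//; exact: lt_le_trans xy.
- exact: (bias_integrable mX X0 al0 be0 HL mg ig).
- exact: (bias_integrable mX X0 al0 be0 HL mg' ig').
Qed.

(** Bias and one smoothing give E X f' = sum c_i (E f' + be_i E f''(Y_i)); bias and two smoothings
    give E X f = sum c_i (E f + be_i E f' + be_i^2 E f''(Y_i)). The terms in E f cancel because sum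
    c_i = a, those in E f' because sum c_i be_i = a as well. *)
Lemma stein_discrepancy (f f1 f2 : R -> R) :
  (forall y : R, 0 < y -> is_derive y 1 f (f1 y)) ->
  (forall y : R, 0 < y -> is_derive y 1 f1 (f2 y)) ->
  (forall y : R, 0 < y -> {for y, continuous f2}) ->
  (forall x : R, 0 < x -> exists M, forall y, x <= y -> `|f y| <= M * (1 + y)) ->
  (forall x : R, 0 < x -> exists M, forall y, x <= y -> `|f1 y| <= M * (1 + y)) ->
  P.-integrable setT (fun w => (X w * f^# (X w))%:E) ->
  P.-integrable setT (fun w => (X w * f1^# (X w))%:E) ->
  P.-integrable setT (fun w => (X w * f2^# (X w))%:E) ->
  \int[P]_w (X w * f1^# (X w) + (a - X w) * f^# (X w)) =
  \sum_i c i * (1 - be i) * be i * \int[Q]_z f2^# (Y i z).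
Proof.
move=> df df1 cf2 fM f1M i_f i_f1 i_f2.
have cf1 (y : R) : 0 < y -> {for y, continuous f1} by move=> y0; exact: rderive_continuous (df1 y y0).
have cf (y : R) : 0 < y -> {for y, continuous f} by move=> y0; exact: rderive_continuous (df y y0).
have mf : measurable_fun setT (f^# : mR -> mR) by exact: measurable_halfline.
have mf1 : measurable_fun setT (f1^# : mR -> mR) by exact: measurable_halfline.
have [ifX _] := smooth i0 df cf1 fM i_f i_f1.
have S1 i := (smooth i df cf1 fM i_f i_f1).2.
have S2 i := (smooth i df1 cf2 f1M i_f1 i_f2).2.
transitivity (\int[P]_w (X w * f1^# (X w)) + (a * \int[P]_w f^# (X w) - \int[P]_w (X w * f^# (X w)))).
  have iaf := integrableZl measurableT a ifX.
  rewrite -RintegralZl// -RintegralB// -RintegralD//; last exact: (integrableB measurableT iaf i_f).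
  by apply: eq_Rintegral => w _; ring.
rewrite (bias_identity mX X0 al0 be0 HL mf1 i_f1) (bias_identity mX X0 al0 be0 HL mf i_f).
set F := \int[P]_w f^# (X w); set F1 := \int[P]_w f1^# (X w).
rewrite -{1}mean_be mulr_suml -sumrB -big_split/=.
transitivity (\sum_i (c i * (1 - be i) * be i * \int[Q]_z f2^# (Y i z) + (c i * F1 - c i * be i * F1))).
  by apply: eq_bigr => i _; rewrite S1 S2 -/F -/F1 /c; ring.
by rewrite big_split/= sumrB -!mulr_suml mean_be var_be subrr addr0.
Qed.

(** A bound on the derivative that degenerates at 0 but is uniform on each [x, +oo[ gives the linear
    growth there which exponential averages require. *)
Let growth_of_lipschitz (g g' : R -> R) (M : R -> R) :
  (forall y : R, 0 < y -> is_derive y 1 g (g' y)) ->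
  (forall x y, 0 < x -> x <= y -> `|g' y| <= M x) ->
  forall x : R, 0 < x -> exists C, forall y, x <= y -> `|g y| <= C * (1 + y).
Proof.
move=> dg g'M x x0; exists (`|g x| + M x) => y xy.
have H := halfline_lipschitz dg x0 xy (fun z xz _ => g'M x z x0 (ltW xz)).
have M0 : 0 <= M x by exact: le_trans (g'M x x x0 (lexx _)).
have := le_trans (lerB_dist _ _) H => H1.
have := normr_ge0 (g x); nra.
Qed.

Let quad (g : R -> R) (C : R) : (forall y : R, 0 < y -> {for y, continuous g}) ->
  (forall x : R, 0 < x -> `|g x| <= C * (1 + x) ^+ 2) ->
  P.-integrable setT (fun w => (g^# (X w))%:E).
Proof.
move=> cg gC.
have C0 : 0 <= C.
  by have := le_trans (normr_ge0 _) (gC 1 ltr01); rewrite pmulr_lge0// exprn_gt0.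
apply: (gamma_sum_quadratic_integrable mX X0 al0 be0 HL (K := C)).
  exact: measurable_halfline.
move=> x; have [x0|x0] := ltP 0 x; first by rewrite halfline_patchE// gC.
by rewrite halfline_patch0// normr0 mulr_ge0// sqr_ge0.
Qed.

Let quadX (g : R -> R) (C : R) : (forall y : R, 0 < y -> {for y, continuous g}) ->
  (forall x : R, 0 < x -> `|x * g x| <= C * (1 + x) ^+ 2) ->
  P.-integrable setT (fun w => (X w * g^# (X w))%:E).
Proof.
move=> cg gC; have := quad (g := fun x => x * g x) _ gC.
have -> : (fun w => (halfline_patch (fun x => x * g x) (X w))%:E) = (fun w => (X w * g^# (X w))%:E).
  apply/funext => w; congr EFin; have [x0|x0] := ltP 0 (X w); first by rewrite !halfline_patchE.
  by rewrite !halfline_patch0// mulr0.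
by apply => y y0; apply: continuousM; [exact: cvg_id|exact: cg].
Qed.

Let weighted_bound (g : R -> R) (e : I -> R) (dl : R) :
  (forall y : R, 0 < y -> {for y, continuous g}) ->
  (forall x : R, 0 < x -> `|x * g x| <= 2) -> (forall i, `|e i| <= dl) ->
  `|\sum_i c i * e i * \int[Q]_z g^# (Y i z)| <= 2 * dl.
Proof.
move=> cg g2 eD.
have dl0 : 0 <= dl by exact: le_trans (normr_ge0 _) (eD i0).
have ig : P.-integrable setT (fun w => (X w * g^# (X w))%:E).
  apply: (quadX (C := 2)) => // x x0; apply: (le_trans (g2 x x0)).
  by rewrite ler_peMr// exprn_ege1// lerDl ltW.
have mg : measurable_fun setT (g^# : mR -> mR) by exact: measurable_halfline.
have mag : measurable_fun setT ((fun x => `|g^# x|) : mR -> mR) by exact: measurableT_comp.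
have iag : P.-integrable setT (fun w => (X w * `|g^# (X w)|)%:E).
  have := integrable_abse ig; apply: eq_integrable => // w _ /=.
  by rewrite normrM ger0_norm.
apply: (@le_trans _ _ (dl * \int[P]_w (X w * `|g^# (X w)|))).
  (* The bias identity from right to left. *)
  rewrite (bias_identity mX X0 al0 be0 HL mag iag) mulr_sumr.
  apply: (le_trans (ler_norm_sum _ _ _)); apply: ler_sum => i _.
  rewrite normrM [`|c i * e i|]normrM (ger0_norm (ltW (c0 i))) mulrAC [leRHS]mulrC.
  apply: ler_pM => //; first by rewrite mulr_ge0// ltW.
  rewrite ler_wpM2l ?(ltW (c0 i))//.
  apply: le_normr_Rintegral => //.
  exact: (bias_integrable mX X0 al0 be0 HL mg ig).
rewrite mulrC ler_wpM2r//.
apply: (@le_trans _ _ (\int[P]_w (2 : R))); last by rewrite Rintegral_cst_probability.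
apply: le_Rintegral => //.
- exact: (finite_measure_integrable_cst P 2 measurableT).
- move=> w _; have [x0|x0] := ltP 0 (X w); last by rewrite halfline_patch0// normr0 mulr0.
  by rewrite halfline_patchE// -[X in X * _](ger0_norm (X0 w)) -normrM g2.
Qed.

(** The Stein equation holds where X > 0, that is almost surely. *)
Let stein_expectation (h h' : R -> R) (K : R) (f := stein_sol a h) (f1 := stein_sol1 a h) :
  (forall x : R, 0 < x -> is_derive x 1 h (h' x)) ->
  (forall x : R, 0 < x -> {for x, continuous h'}) ->
  (forall x : R, 0 < x -> `|h x| <= K * (1 + x) ^+ 2) ->
  P.-integrable setT (fun w => (h^# (X w))%:E) /\
  \int[P]_w h^# (X w) - gamma_mean a h = \int[P]_w (X w * f1^# (X w) + (a - X w) * f^# (X w)).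
Proof.
move=> dh ch' hK.
have ch (x : R) : 0 < x -> {for x, continuous h} by move=> x0; exact: rderive_continuous (dh x x0).
have cf (x : R) : 0 < x -> {for x, continuous f}.
  by move=> x0; exact: rderive_continuous (stein_sol_derive a0 mass1 dh hK x0).
have cf1 (x : R) : 0 < x -> {for x, continuous f1}.
  by move=> x0; exact: rderive_continuous (stein_sol1_derive a0 mass1 dh hK x0).
have ih := quad ch hK; split => //.
transitivity (\int[P]_w (h^# (X w) - gamma_mean a h)).
  rewrite RintegralB//; last exact: (finite_measure_integrable_cst P _ measurableT).
  by rewrite Rintegral_cst_probability.
have mp (g : R -> R) : (forall x : R, 0 < x -> {for x, continuous g}) ->
    measurable_fun setT (fun w => g^# (X w)).
  by move=> cg; apply: measurableT_comp => //; exact: measurable_halfline.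
apply: ae_Rintegral.
- by apply: measurable_funB => //; exact: mp.
- apply: measurable_funD; apply: measurable_funM => //; try exact: mp.
  exact: measurable_funB.
- by move=> w Xw; rewrite !halfline_patchE// stein_equation.
Qed.

Section order1.
Variables (h h' : R -> R).
Hypothesis dh : forall x : R, 0 < x -> is_derive x 1 h (h' x).
Hypothesis ch' : forall x : R, 0 < x -> {for x, continuous h'}.
Hypothesis h'1 : forall x : R, 0 < x -> `|h' x| <= 1.
Variable dl : R.
Hypothesis dl1 : forall i, `|be i - 1| * be i <= dl.

Let K := `|h 1| + 1.
Let K0 : 0 <= K. Proof. by rewrite addr_ge0. Qed.

Let hK (x : R) (x0 : 0 < x) : `|h x| <= K * (1 + x) ^+ 2 := linear_growth_sqr dh h'1 x0.
Let h'K (x : R) : 0 < x -> `|h' x| <= K * (1 + x).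
Proof. move=> /[dup] x0 /h'1; have := normr_ge0 (h 1); rewrite /K; nra. Qed.

Lemma expect_diff_order1 :
  P.-integrable setT (fun w => (h^# (X w))%:E) /\
  `|\int[P]_w h^# (X w) - gamma_mean a h| <= 2 * dl.
Proof.
pose f := stein_sol a h; pose f1 := stein_sol1 a h; pose f2 := stein_sol2 a h h'.
have df (x : R) (x0 : 0 < x) := stein_sol_derive a0 mass1 dh hK x0.
have df1 (x : R) (x0 : 0 < x) := stein_sol1_derive a0 mass1 dh hK x0.
have cf2 (x : R) (x0 : 0 < x) : {for x, continuous f2}.
  exact: (stein_sol2_continuous a0 mass1 dh ch' hK x0).
have f_1 (x : R) (x0 : 0 < x) : `|f x| <= 1.
  exact: (stein_sol_le1 a0 mass1 dh hK h'1 x0).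
have f2_2 (x : R) (x0 : 0 < x) : `|x * f2 x| <= 2.
  exact: (stein_sol2_le2 a0 mass1 dh hK h'1 x0).
have cf (x : R) : 0 < x -> {for x, continuous f}.
  by move=> x0; exact: rderive_continuous (df x x0).
have cf1 (x : R) : 0 < x -> {for x, continuous f1}.
  by move=> x0; exact: rderive_continuous (df1 x x0).
have [ih E1] := stein_expectation dh ch' hK; split => //; rewrite E1.
rewrite (stein_discrepancy df df1 cf2).
- under eq_bigr do rewrite -[c _ * _ * _]mulrA.
  apply: weighted_bound => // i.
  by rewrite normrM distrC (ger0_norm (ltW (be0 i))).
- by move=> x x0; exists 1 => y xy; rewrite (le_trans (f_1 y (lt_le_trans x0 xy)))//; lra.
(* On [x, +oo[ the bound |y f''(y)| <= 2 gives a Lipschitz constant 2 / x for f'. *)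
- apply: (growth_of_lipschitz (M := fun x => 2 / x) df1) => x y x0 xy.
  have y0 := lt_le_trans x0 xy.
  have := f2_2 y y0; rewrite normrM (gtr0_norm y0) => H.
  rewrite ler_pdivlMr// mulrC; apply: le_trans H; rewrite ler_wpM2r//.
- apply: (quadX (C := 1)) => // x x0; have H : `|stein_sol a h x| <= 1 := f_1 x x0.
  rewrite [`|x * _|]normrM (gtr0_norm x0) mul1r; have := normr_ge0 (stein_sol a h x); nra.
- apply: (quadX (C := K + `|gamma_mean a h| + a + 1)) => // x x0.
  (* Here x f' is estimated through the Stein equation, from the growth of h and |f| <= 1. *)
  have -> : x * stein_sol1 a h x = h x - gamma_mean a h - (a - x) * f x.
    by rewrite -(stein_equation mass1 h x0) addrK.
  apply: (le_trans (ler_normB _ _)); rewrite normrM.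
  have H1 := le_trans (ler_normB (h x) (gamma_mean a h)) (lerD (hK x0) (lexx _)).
  have H2 : `|a - x| <= a + x by rewrite ler_norml; apply/andP; split; have := a0; lra.
  have H3 := f_1 x x0; have H4 := normr_ge0 (f x); have := normr_ge0 (gamma_mean a h).
  have H5 : `|a - x| * `|f x| <= (a + x) * 1 by apply: ler_pM.
  have := a0; nra.
- apply: (quadX (C := 2)) => // x x0; apply: (le_trans (f2_2 x x0)).
  by rewrite ler_peMr// exprn_ege1// lerDl ltW.
Qed.

End order1.

Section order2.
Variables (h h' h'' : R -> R).
Hypothesis dh : forall x : R, 0 < x -> is_derive x 1 h (h' x).
Hypothesis dh' : forall x : R, 0 < x -> is_derive x 1 h' (h'' x).
Hypothesis ch'' : forall x : R, 0 < x -> {for x, continuous h''}.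
Hypothesis h''1 : forall x : R, 0 < x -> `|h'' x| <= 1.

Let K1 := `|h' 1| + 1.
Let K := `|h 1| + 2 * K1.
Let K10 : 0 <= K1. Proof. by rewrite addr_ge0. Qed.

Let h'K1 (x : R) : 0 < x -> `|h' x| <= K1 * (1 + x).
Proof. by move=> x0; exact: linear_growth. Qed.

Let h'K (x : R) : 0 < x -> `|h' x| <= K * (1 + x).
Proof.
move=> x0; apply: (le_trans (h'K1 x0)); rewrite ler_wpM2r//; first by rewrite addr_ge0// ltW.
rewrite /K; have := normr_ge0 (h 1); have := K10; lra.
Qed.

Let hK (x : R) (x0 : 0 < x) : `|h x| <= K * (1 + x) ^+ 2 := quadratic_growth dh dh' h''1 x0.

Local Notation f := (stein_sol a h).
Local Notation f1 := (stein_sol1 a h).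
Local Notation f2 := (stein_sol2 a h h').
Local Notation f3 := (stein_sol3 a h h' h'').

Let ch' (x : R) (x0 : 0 < x) : {for x, continuous h'} := rderive_continuous (dh' x0).
Let df (x : R) (x0 : 0 < x) := stein_sol_derive a0 mass1 dh hK x0.
Let df1 (x : R) (x0 : 0 < x) := stein_sol1_derive a0 mass1 dh hK x0.
Let df2 (x : R) (x0 : 0 < x) := stein_sol2_derive a0 mass1 dh hK dh' x0.
Let cf (x : R) (x0 : 0 < x) : {for x, continuous f} := rderive_continuous (df x0).
Let cf1 (x : R) (x0 : 0 < x) : {for x, continuous f1} := rderive_continuous (df1 x0).
Let cf2 (x : R) (x0 : 0 < x) : {for x, continuous f2} := rderive_continuous (df2 x0).
Let cf3 (x : R) (x0 : 0 < x) : {for x, continuous f3} :=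
  stein_sol3_continuous a0 mass1 dh hK dh' ch'' x0.
Let f1_1 (x : R) (x0 : 0 < x) : `|f1 x| <= 1 :=
  stein_sol1_le1 a0 mass1 dh hK h'K dh' h''1 x0.
Let f3_2 (x : R) (x0 : 0 < x) : `|x * f3 x| <= 2 :=
  stein_sol3_le2 a0 mass1 dh hK h'K dh' h''1 x0.
Let f_lin (x : R) : 0 < x -> `|f x| <= (`|f 1| + 1) * (1 + x).
Proof. by move=> x0; exact: (linear_growth df f1_1). Qed.

Let i_f : P.-integrable setT (fun w => (X w * f^# (X w))%:E).
Proof.
apply: (quadX (C := `|f 1| + 1)) => // x x0.
rewrite normrM (gtr0_norm x0); have := f_lin x0; have := normr_ge0 (f 1); nra.
Qed.

Let i_f1 : P.-integrable setT (fun w => (X w * f1^# (X w))%:E).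
Proof.
apply: (quadX (C := 1)) => // x x0.
rewrite normrM (gtr0_norm x0); have := f1_1 x0; have := normr_ge0 (f1 x); nra.
Qed.

Let i_f2 : P.-integrable setT (fun w => (X w * f2^# (X w))%:E).
Proof.
apply: (quadX (C := K + (`|f 1| + 1) + (a + 1))) => // x x0.
have -> : x * f2 x = h' x + f x - (a + 1 - x) * f1 x.
  by rewrite -(stein_equation_derive mass1 h h' x0); ring.
apply: (le_trans (ler_normB _ _)); rewrite normrM.
have H1 := le_trans (ler_normD (h' x) (f x)) (lerD (h'K x0) (f_lin x0)).
have H2 : `|a + 1 - x| <= a + 1 + x by rewrite ler_norml; apply/andP; split; have := a0; lra.
have H5 : `|a + 1 - x| * `|f1 x| <= (a + 1 + x) * 1 by apply: ler_pM => //; exact: f1_1.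
have G0 : 0 <= K + (`|f 1| + 1) by have := le_trans (normr_ge0 _) H1; nra.
have := a0; nra.
Qed.

Let i_f3 : P.-integrable setT (fun w => (X w * f3^# (X w))%:E).
Proof.
apply: (quadX (C := 2)) => // x x0; apply: (le_trans (f3_2 x0)).
by rewrite ler_peMr// exprn_ege1// lerDl ltW.
Qed.

Let growth_f1 (x : R) : 0 < x -> exists M, forall y, x <= y -> `|f1 y| <= M * (1 + y).
Proof.
by move=> x0; exists 1 => y xy; rewrite (le_trans (f1_1 (lt_le_trans x0 xy)))//; lra.
Qed.

Let diff2 : \int[P]_w h^# (X w) - gamma_mean a h =
  \sum_i c i * (1 - be i) * be i * \int[Q]_z f2^# (Y i z).
Proof.
have [_ ->] := stein_expectation dh ch' hK.
apply: (stein_discrepancy df df1 cf2) => // x x0.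
by exists (`|f 1| + 1) => y xy; exact: (f_lin (lt_le_trans x0 xy)).
Qed.

Lemma expect_integrable_order2 : P.-integrable setT (fun w => (h^# (X w))%:E).
Proof. by have [] := stein_expectation dh ch' hK. Qed.

(** Serves the case of an infinite [e_const] and a vanishing Delta, where the second order bound has
    to hold without its last term. *)
Lemma expect_diff_order2_eq : (forall i, be i = 1) ->
  \int[P]_w h^# (X w) = gamma_mean a h.
Proof.
move=> be1; apply/eqP; rewrite -subr_eq0 diff2 big1// => i _.
by rewrite be1 subrr mulr0 !mul0r.
Qed.

(** One more smoothing, E f''(Y_i) = E f''(X) + be_i E f'''(Y_i). The sum with f''' is bounded as at
    first order; E f''(X) factors out of the rest, is at most C in absolute value, and has a
    coefficient of size at most a dl1. *)
Lemma expect_diff_order2 (dl1 dl2 C : R) :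
  (forall i, `|be i - 1| * be i <= dl1) -> (forall i, `|be i - 1| * be i ^+ 2 <= dl2) ->
  (forall x, 0 < x -> 4 * up2 a x * low2 a x / (x ^+ 3 * gamma_pdf a 1 x) <= C) ->
  `|\int[P]_w h^# (X w) - gamma_mean a h| <= 2 * dl2 + a * C * dl1.
Proof.
move=> dl1P dl2P CP; rewrite diff2.
have growth_f2 (x : R) : 0 < x -> exists M, forall y, x <= y -> `|f2 y| <= M * (1 + y).
  apply: (growth_of_lipschitz (M := fun x => 2 / x) df2) => {}x y x0 xy.
  have y0 := lt_le_trans x0 xy.
  have := f3_2 y0; rewrite normrM (gtr0_norm y0) => H.
  by rewrite ler_pdivlMr// mulrC; apply: le_trans H; rewrite ler_wpM2r.
have S3 i := (smooth i df2 cf3 growth_f2 i_f2 i_f3).2.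
have [if2 _] := smooth i0 df2 cf3 growth_f2 i_f2 i_f3.
set F2 := \int[P]_w f2^# (X w).
have C0 : 0 <= C.
  by apply: le_trans (le_trans (normr_ge0 _) (stein_sol2_le_C2 a0 mass1 dh hK h'K dh' h''1 ltr01)) (CP 1 ltr01).
have F2C : `|F2| <= C.
  apply: le_trans (le_normr_Rintegral _ _) _ => //.
  apply: (@le_trans _ _ (\int[P]_w C)); last by rewrite Rintegral_cst_probability.
  apply: le_Rintegral => //.
  - exact: (integrable_norm if2).
  - exact: (finite_measure_integrable_cst P C measurableT).
  - move=> w _; have [x0|x0] := ltP 0 (X w); last by rewrite halfline_patch0// normr0.
    rewrite halfline_patchE//; apply: le_trans (CP _ x0).
    exact: (stein_sol2_le_C2 a0 mass1 dh hK h'K dh' h''1 x0).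
have -> : \sum_i c i * (1 - be i) * be i * \int[Q]_z f2^# (Y i z) =
    \sum_i c i * ((1 - be i) * be i ^+ 2) * \int[Q]_z f3^# (Y i z) +
    (\sum_i c i * ((1 - be i) * be i)) * F2.
  by rewrite mulr_suml -big_split/=; apply: eq_bigr => i _; rewrite S3 -/F2; ring.
apply: (le_trans (ler_normD _ _)); apply: lerD.
  apply: weighted_bound => // i.
  by rewrite normrM distrC (ger0_norm (sqr_ge0 _)).
rewrite normrM mulrAC; apply: ler_pM => //.
rewrite -mean_be mulr_suml; apply: (le_trans (ler_norm_sum _ _ _)); apply: ler_sum => i _.
rewrite normrM (ger0_norm (ltW (c0 i))) ler_wpM2l ?(ltW (c0 i))//.
by rewrite normrM distrC (gtr0_norm (be0 i)).
Qed.

End order2.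
End gamma_comparison.

(** * The law of [U]: scaling and normalisation *)

Section gamma_law.
Context {R : realType}.
Notation leb := (@lebesgue_measure R).
Local Notation mR := (measurableTypeR R).

(** Lebesgue measure is characterised by the lengths of intervals, which division by b with weight 1
    / b preserves. *)
Lemma ge0_integral_scale (b : R) (k : mR -> \bar R) : 0 < b ->
  measurable_fun setT k -> (forall y, 0 <= k y)%E ->
  (\int[leb]_x ((b^-1)%:E * k (x / b)%R) = \int[leb]_x k x)%E.
Proof.
move=> b0 mk k0.
have mX : measurable_fun setT (fun x : mR => x / b : mR) by exact: measurable_funM.
have w0 : forall x : mR, 0 <= cst b^-1 x by move=> x; rewrite /= invr_ge0 ltW.
pose nu := weighted_law leb mX (measurable_cst b^-1) w0.
rewrite -(integral_weighted_law leb mX (measurable_cst b^-1) w0 mk k0).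
apply/esym; apply: (@eq_law _ _ mR _ _ mR mR leb nu id id) => //.
apply: lebesgue_measure_unique => _ [[x y] /= xy <-].
rewrite /nu /= /weighted_law.
have -> : (fun x : mR => x / b : mR) @^-1` `]x, y]%classic = `](x * b), (y * b)]%classic.
  by apply/seteqP; split => z /=; rewrite !in_itv/= ltr_pdivlMr// ler_pdivrMr.
rewrite (_ : (fun x0 : mR => (cst b^-1 x0)%:E) = cst (b^-1)%:E)// integral_cst//.
have E1 := lebesgue_measure_itv `](x * b), (y * b)]; rewrite /= lte_fin ltr_pM2r// in E1.
rewrite lebesgue_measure_itv/= lte_fin [X in (_ * X)%E]E1.
case: ifP => _; last by rewrite mule0.
by rewrite -!EFinB -EFinM; congr EFin; field; rewrite gt_eqF.
Qed.

Lemma gamma_pdf_scale (a b x : R) : 0 < b -> gamma_pdf a b x = b^-1 * gamma_pdf a 1 (x / b).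
Proof.
move=> b0; rewrite /gamma_pdf pmulr_lgt0 ?invr_gt0//; case: ifPn => x0; last by rewrite mulr0.
rewrite powR1 mulr1 divr1 -mulNr mulrA; congr (_ * _).
rewrite powRM ?(ltW x0) ?invr_ge0 ?(ltW b0)// invfM.
have -> : b `^ a = b * b `^ (a - 1).
  rewrite -[X in _ = X * _](powRr1 (ltW b0)) -powRD; first by rewrite addrC subrK.
  by rewrite [b == 0]gt_eqF// implybT.
rewrite invfM -[b^-1]powR_inv1 ?(ltW b0)//; first last.
have -> : (b `^ (-1)) `^ (a - 1) = (b `^ (a - 1))^-1.
  by rewrite -powRrM mulN1r powRN.
ring.
Qed.

Lemma measurable_gamma_pdfT (a b : R) : measurable_fun setT (gamma_pdf a b : mR -> mR).
Proof.
rewrite (_ : gamma_pdf a b = halfline_patch (fun x => (Gamma_fun a * b `^ a)^-1 * x `^ (a - 1) * expR (- x / b))).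
  apply: (measurable_restrictT _ _).1 => //; apply: measurable_funTS.
  apply: measurable_funM; first by apply: measurable_funM => //; exact: measurable_powR.
  by apply: measurableT_comp => //; apply: measurable_funM => //; exact: oppr_measurable.
apply/funext => x; rewrite /gamma_pdf; have [x0|x0] := ltP 0 x; first by rewrite halfline_patchE.
by rewrite halfline_patch0.
Qed.

Variables (d : measure_display) (T : measurableType d) (P : probability T R) (U : {RV P >-> R}).
Variables (a b : R).
Hypothesis a0 : 0 < a.
Hypothesis b0 : 0 < b.
Hypothesis hU : forall A : set R, measurable A -> distribution P U A = gamma_prob a b A.

Local Notation p := (gamma_pdf a 1).
Local Notation V := (fun w => U w / b).

Let Gamma0 : 0 <= Gamma_fun a := Gamma_fun_ge0 a.
Let p_ge0 (x : R) : 0 <= p x.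
Proof.
rewrite /gamma_pdf; case: ifP => // _.
by rewrite !mulr_ge0 ?expR_ge0 ?powR_ge0// invr_ge0 mulr_ge0 ?powR_ge0.
Qed.

Let mV : measurable_fun setT (V : T -> mR).
Proof. by apply: measurable_funM. Qed.

Lemma ge0_gamma_law (phi : mR -> R) : measurable_fun setT phi -> (forall y, 0 <= phi y) ->
  (\int[leb]_x (p x * phi x)%:E = \int[P]_w (cst 1 w * phi (V w))%:E)%E.
Proof.
move=> mphi phi0.
have mp := measurable_gamma_pdfT a 1.
have mb : measurable_fun setT (fun x : mR => x / b : mR) by exact: measurable_funM.
rewrite -(ge0_integral_scale b0); last 2 first.
- by apply/measurable_EFinP; exact: measurable_funM.
- by move=> y; rewrite lee_fin mulr_ge0.
transitivity (\int[leb]_x ((gamma_pdf a b x)%:E * (phi (x / b))%:E))%E.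
  by apply: eq_integral => x _; rewrite -!EFinM (gamma_pdf_scale a x b0) mulrA.
rewrite -(@ge0_integral_density _ _ _ P U (gamma_pdf a b) _ _ _ _ (fun x => (phi (x / b))%:E)).
- by apply: eq_integral => w _; rewrite mul1r.
- have mU : measurable_fun setT (U : T -> R) by [].
  exact: mU.
- exact: measurable_gamma_pdfT.
- by move=> x; rewrite gamma_pdf_scale// mulr_ge0// invr_ge0 ltW.
- by move=> A mA; exact: (hU mA).
- by apply/measurable_EFinP; exact: (measurableT_comp mphi).
- by move=> y; rewrite lee_fin.
Qed.

(** Read off from the total mass of [P], with the constant 1 as test function. *)
Lemma gamma_mass1 : (\int[leb]_(x in `]0%R, +oo[) (p x)%:E = 1)%E.
Proof.
have := @ge0_gamma_law (cst 1) (measurable_cst _) (fun=> ler01).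
under eq_integral do rewrite mulr1.
rewrite (_ : (\int[P]_w _ = 1)%E); last first.
  rewrite (eq_integral (cst 1%E)); last by move=> w _; rewrite /= mulr1.
  by rewrite integral_cst// mul1e; exact: probability_setT.
move=> <-.
rewrite [LHS]integral_mkcond; apply: eq_integral => x _; rewrite patchE.
case: ifPn => //; rewrite notin_setE/= in_itv/= andbT => /negP; rewrite -leNgt.
by move=> /gamma_pdf_le0 ->.
Qed.

Lemma gamma_law_mean (h h' : R -> R) (K : R) : (forall x : R, 0 < x -> is_derive x 1 h (h' x)) ->
  (forall x : R, 0 < x -> `|h x| <= K * (1 + x) ^+ 2) ->
  P.-integrable setT (fun w => (halfline_patch h (V w))%:E) /\
  \int[P]_w halfline_patch h (V w) = gamma_mean a h.
Proof.
move=> dh hK.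
have mh : measurable_fun setT (halfline_patch h : mR -> mR).
  by apply: measurable_halfline => x x0; exact: rderive_continuous (dh x x0).
have E x : h x * p x = p x * halfline_patch h x.
  have [x0|x0] := ltP 0 x; first by rewrite halfline_patchE// mulrC.
  by rewrite gamma_pdf_le0// mulr0 mul0r.
have im : leb.-integrable setT (fun x => (p x * halfline_patch h x)%:E).
  by have := gamma_mean_integrable a0 gamma_mass1 dh hK; under eq_fun do rewrite E.
have c1 : (fun w => (halfline_patch h (V w))%:E) = (fun w => (cst 1 w * halfline_patch h (V w))%:E).
  by apply/funext => w; rewrite mul1r.
have [||H1 H2] := integral_signed_transfer (m1 := leb) (m2 := P) (D1 := setT) (D2 := setT)
  (w1 := p) (w2 := cst 1) (X1 := id) (X2 := V) (phi := halfline_patch h) measurableT measurableT p_ge0 _ _ mh ge0_gamma_law im.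
- by [].
- by apply: measurable_funM => //; exact: measurableT_comp.
- split; first by rewrite c1.
  rewrite /Rintegral c1 -H2 /gamma_mean /Rintegral; congr fine.
  by apply: eq_integral => x _; rewrite E.
Qed.

End gamma_law.

(** * The trace of a sum of Wishart matrices *)

Section wishart_sum.
Context {R : realType}.
Local Notation mR := (measurableTypeR R).
Variables (K d : nat).
Hypotheses (hK : (0 < K)%N) (hd : (0 < d)%N).
Variable n : 'I_K -> nat.
Hypothesis hn : forall k, (0 < n k)%N.
Variable Sigma : 'I_K -> 'M[R]_d.
Hypothesis hSigma : forall k, posdefmx (Sigma k).
Variable lambda : 'I_K -> 'I_d -> R.
Hypothesis hlambda : forall k,
  char_poly (Sigma k) = \prod_(l < d) ('X - (lambda k l)%:P).
Variables (d1 : measure_display) (T1 : measurableType d1) (P1 : probability T1 R).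
Variable W : 'I_K -> {RV P1 >-> 'M[R]_d}.
Hypothesis hW : forall k, wishart (n k) ((n k)%:R^-1 *: Sigma k) (distribution P1 (W k)).
Hypothesis hindep : mutual_independence P1 W.

Let mu : R := \sum_(k < K) \tr (Sigma k).
Let sg : R := \sum_(k < K) ((n k)%:R^-1 * \tr (Sigma k *m Sigma k)).
Let nu : R := mu ^+ 2 / sg.
Let Wn : T1 -> R := fun w => \tr (\sum_(k < K) W k w).

Definition wishart_shape (i : 'I_K * 'I_d) : R := (n i.1)%:R / 2.
Definition wishart_scale (i : 'I_K * 'I_d) : R := lambda i.1 i.2 / (n i.1)%:R / (mu / nu).
Local Notation al := wishart_shape.
Local Notation be := wishart_scale.

Lemma lambda_gt0 k l : 0 < lambda k l.
Proof. exact: (posdef_eigenvalue_gt0 (hSigma k) (eigenvalues_root (hlambda k) l)). Qed.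

Let i0 : 'I_K * 'I_d := (Ordinal hK, Ordinal hd).

Lemma mu_sum : mu = \sum_(i : 'I_K * 'I_d) lambda i.1 i.2.
Proof.
rewrite -(pair_big xpredT xpredT (fun k l => lambda k l))/=; apply: eq_bigr => k _.
exact: trace_eigenvalues.
Qed.

Lemma sg_sum : sg = \sum_(i : 'I_K * 'I_d) (n i.1)%:R^-1 * lambda i.1 i.2 ^+ 2.
Proof.
rewrite -(pair_big xpredT xpredT (fun k l => (n k)%:R^-1 * lambda k l ^+ 2))/=; apply: eq_bigr => k _.
by rewrite (trace_sqr_eigenvalues hd (hlambda k)) mulr_sumr.
Qed.

Let n0 k : 0 < (n k)%:R :> R. Proof. by rewrite ltr0n. Qed.

Lemma mu_gt0 : 0 < mu.
Proof.
rewrite mu_sum (bigD1 i0)//= ltr_pwDl ?lambda_gt0//.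
by apply: sumr_ge0 => i _; exact: ltW (lambda_gt0 _ _).
Qed.

Lemma sg_gt0 : 0 < sg.
Proof.
rewrite sg_sum (bigD1 i0)//= ltr_pwDl//; first by rewrite mulr_gt0 ?invr_gt0 ?exprn_gt0 ?lambda_gt0.
by apply: sumr_ge0 => i _; rewrite mulr_ge0 ?invr_ge0 ?sqr_ge0.
Qed.

Lemma nu_gt0 : 0 < nu.
Proof. by rewrite divr_gt0 ?exprn_gt0 ?mu_gt0 ?sg_gt0. Qed.

Lemma wishart_shape_gt0 i : 0 < al i.
Proof. by rewrite divr_gt0. Qed.

Lemma wishart_scale_gt0 i : 0 < be i.
Proof.
apply: divr_gt0; first by apply: divr_gt0; [exact: lambda_gt0|exact: n0].
by apply: divr_gt0; [exact: mu_gt0|exact: nu_gt0].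
Qed.

Lemma wishart_mean : \sum_i al i * be i = nu / 2.
Proof.
have mu0 := mu_gt0; have nu0 := nu_gt0.
transitivity (\sum_(i : 'I_K * 'I_d) lambda i.1 i.2 * (nu / (2 * mu))).
  apply: eq_bigr => i _; rewrite /al /be; field.
  by rewrite !gt_eqF.
by rewrite -mulr_suml -mu_sum; field; rewrite gt_eqF.
Qed.

(** Together with [wishart_mean] this is the Welch-Satterthwaite choice of nu: mean and variance
    agree with those of the Gamma law. *)
Lemma wishart_var : \sum_i al i * be i * be i = nu / 2.
Proof.
have mu0 := mu_gt0; have nu0 := nu_gt0; have sg0 := sg_gt0.
transitivity (\sum_(i : 'I_K * 'I_d) (n i.1)%:R^-1 * lambda i.1 i.2 ^+ 2 * (nu ^+ 2 / (2 * mu ^+ 2))).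
  apply: eq_bigr => i _; rewrite /al /be; field.
  by rewrite !gt_eqF.
rewrite -mulr_suml -sg_sum expr2 {1}/nu; field.
by rewrite !gt_eqF.
Qed.

Let b := 2 * mu / nu.
Let b0 : 0 < b. Proof.
by apply: divr_gt0; [apply: mulr_gt0 => //; exact: mu_gt0|exact: nu_gt0].
Qed.

(** The trace is nonnegative almost surely; truncation makes it so everywhere without changing its
    law. *)
Definition scaled_trace (w : T1) : R := Num.max (Wn w / b) 0.

Let WnE w : Wn w = \sum_(k < K) \tr (W k w).
Proof. by rewrite /Wn raddf_sum. Qed.

Let mtr k : measurable_fun setT (fun w => \tr (W k w) : mR).
Proof. exact: wishart_trace_measurable. Qed.

Lemma measurable_trace_sum : measurable_fun setT (Wn : T1 -> mR).
Proof.
rewrite (_ : Wn = fun w => \sum_(k < K) \tr (W k w)); last by apply/funext => w; exact: WnE.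
by apply: measurable_sum => k; exact: mtr.
Qed.

Lemma measurable_scaled_trace : measurable_fun setT (scaled_trace : T1 -> mR).
Proof.
apply: measurable_maxr => //; apply: measurable_funM => //; exact: measurable_trace_sum.
Qed.

Lemma scaled_trace_ge0 w : 0 <= scaled_trace w.
Proof. by rewrite /scaled_trace le_max lexx orbT. Qed.

Let Psi_sym k : ((n k)%:R^-1 *: Sigma k)^T = (n k)%:R^-1 *: Sigma k.
Proof. by rewrite linearZ/=; have [-> _] := hSigma k. Qed.

Let Psi_psd k (t : 'cV[R]_d) : 0 <= (t^T *m ((n k)%:R^-1 *: Sigma k) *m t) 0 0.
Proof.
rewrite -scalemxAr -scalemxAl mxE mulr_ge0 ?invr_ge0//.
have [->|t0] := eqVneq t 0; first by rewrite mulmx0 mxE.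
by have [_ /(_ t t0)/ltW] := hSigma k.
Qed.

Lemma Wn_ge0 : {ae P1, forall w, 0 <= Wn w}.
Proof.
have H : {ae P1, forall w, forall k, 0 <= \tr (W k w)}.
  have Hk k : {ae P1, forall w, 0 <= \tr (W k w)}.
    exists [set w | \tr (W k w) < 0]; split.
    - rewrite (_ : [set w | _] = (fun w => \tr (W k w)) @^-1` `]-oo, 0[%classic).
        by rewrite -[X in measurable X]setTI; exact: mtr.
      by apply/seteqP; split => w /=; rewrite in_itv.
    - exact: (wishart_trace_ge0 (hW k)).
    - by move=> w /= /negP; rewrite -ltNge.
  exact: filter_forall.
by apply: filterS H => w H; rewrite WnE sumr_ge0.
Qed.

Lemma scaled_trace_laplace t : 0 <= t ->
  (\int[P1]_w (expR (- (t * scaled_trace w)))%:E = (gamma_laplace al be t)%:E)%E.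
Proof.
move=> t0; have mu0 := mu_gt0; have nu0 := nu_gt0.
have me (c : R) : measurable_fun setT (fun x : mR => expR (- (c * x))).
  by apply: measurableT_comp => //; apply: measurableT_comp => //; exact: measurable_funM.
transitivity (\int[P1]_w (expR (- (t / b * Wn w)))%:E)%E.
  apply: ae_eq_integral => //.
  - by apply/measurable_EFinP; exact: (measurableT_comp (me t) measurable_scaled_trace).
  - by apply/measurable_EFinP; exact: (measurableT_comp (me _) measurable_trace_sum).
  - apply: filterS Wn_ge0 => w w0 _; rewrite /scaled_trace max_l; last by apply: divr_ge0 => //; exact: ltW b0.
    by congr (expR (- _))%:E; ring.
(* The 2 offsets the factor 1 / 2 in the exponent of [wishart_trace_laplace]. *)
pose s := 2 * (t / b).
have s0 : 0 <= s by apply: mulr_ge0 => //; apply: divr_ge0 => //; exact: ltW b0.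
pose e k := (Num.sqrt (\det (1%:M + s *: ((n k)%:R^-1 *: Sigma k))))^-1 ^+ n k.
transitivity ((\prod_k e k)%:E).
  rewrite -(independent_prod (phi := fun=> fun M : 'M[R]_d => expR (- (s * \tr M / 2))) hindep).
  - apply: eq_integral => w _; congr EFin; rewrite -expR_sum; congr expR.
    rewrite WnE sumrN mulr_sumr; congr (- _); apply: eq_bigr => k _.
    by rewrite /s; move: (t / b) => x; field.
  - move=> k; apply: measurableT_comp => //; apply: measurableT_comp => //.
    apply: measurable_funM => //; apply: measurable_funM => //.
    by apply: measurable_sum => l; exact: measurable_mx_coord.
  - by move=> k M; exact: expR_ge0.
  - by move=> k; exact: (wishart_trace_laplace (Psi_sym k) (Psi_psd k) (hW k) s0).
congr EFin; rewrite /gamma_laplace -(pair_big xpredT xpredT (fun k l => al (k, l) * ln (1 + be (k, l) * t)))/=.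
rewrite -sumrN expR_sum; apply: eq_bigr => k _.
rewrite /e scalerA (det_1D_eigenvalues (hlambda k)) /=.
have x0 l : 0 < 1 + be (k, l) * t by rewrite ltr_wpDr// mulr_ge0// ltW// wishart_scale_gt0.
(* As b = 2 mu / nu, the product s lambda / n is exactly be t. *)
have -> : \prod_(l < d) (1 + s * (n k)%:R^-1 * lambda k l) = expR (\sum_(l < d) ln (1 + be (k, l) * t)).
  rewrite expR_sum; apply: eq_bigr => l _; rewrite lnK ?posrE//.
  by congr (1 + _); rewrite /s /b /be/=; field; rewrite !gt_eqF.
set y := \sum_(l < d) _.
have -> : expR y = expR (y / 2) ^+ 2 by rewrite -expRM_natl; congr expR; field.
have -> : \sum_(l < d) al (k, l) * ln (1 + be (k, l) * t) = (n k)%:R / 2 * y by rewrite mulr_sumr.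
rewrite sqrtr_sqr ger0_norm ?expR_ge0// -expRN -expRM_natl; congr expR.
by field.
Qed.

End wishart_sum.

(** * Bounds on the distances of orders 1 and 2 *)

Section dist_bounds.
Context {R : realType}.
Local Notation mR := (measurableTypeR R).

(** The test function becomes h(b x) / c, with c = b at order 1 and c = b^2 at order 2, so as to
    keep the derivative bound; the distance then picks up the factor c. *)
Lemma expect_pos_scaled {d} {T : measurableType d} (P : probability T R) (h : R -> R)
    (Y Z : T -> R) (b c : R) : 0 < b -> c != 0 ->
  (forall w, 0 < Y w -> Z w = Y w / b) -> (forall w, Y w <= 0 -> Z w <= 0) ->
  P.-integrable setT (fun w => (halfline_patch (fun x => h (b * x) / c) (Z w))%:E) ->
  expect_pos P h Y = (c * \int[P]_w halfline_patch (fun x => h (b * x) / c) (Z w))%:E.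
Proof.
move=> b0 c0 ZY Z0 iZ; rewrite /expect_pos unlock /Rintegral EFinM fineK; last exact: integrable_fin_num.
rewrite -integralZl//; apply: eq_integral => w _; rewrite -EFinM; congr EFin.
rewrite patchE; have [Y0|Y0] := ltP 0 (Y w).
  rewrite mem_set/=; last by rewrite /= in_itv/= Y0.
  rewrite ZY// halfline_patchE ?divr_gt0// mulrCA divff ?mulr1; last by [].
  by rewrite mulrCA divff ?mulr1// gt_eqF.
rewrite memNset/=; last by rewrite in_itv/= andbT; apply/negP; rewrite -leNgt.
by rewrite halfline_patch0 ?mulr0// Z0.
Qed.

Lemma Z1_class_derive (h : R -> R) (x : R) : Z1_class h -> 0 < x -> is_derive x 1 h (derive1 h x).
Proof. by move=> hZ /hZ[D _ _]; apply: (DeriveDef D); rewrite derive1E. Qed.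

Lemma Z2_class_derive (h : R -> R) (x : R) : Z2_class h -> 0 < x -> is_derive x 1 h (derive1 h x).
Proof. by move=> hZ /hZ[D _ _ _]; apply: (DeriveDef D); rewrite derive1E. Qed.

Lemma Z2_class_derive2 (h : R -> R) (x : R) : Z2_class h -> 0 < x ->
  is_derive x 1 (derive1 h) (derive1n 2 h x).
Proof. by move=> hZ /hZ[_ D _ _]; apply: (DeriveDef D); rewrite derive1nS derive1n1 derive1E. Qed.

Lemma scale_derive (g : R -> R) (b c x l : R) : b != 0 -> is_derive (b * x) 1 g l ->
  is_derive x 1 (fun x => g (b * x) / c) (l / (c / b)).
Proof.
move=> b0 dg; have H : is_derive x 1 (fun x => g (b * x)) (l * b).
  apply: (rderive_comp (f := fun x => b * x)) dg.
  by rderive; ring.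
by rderive; rewrite mulr0 addr0 invf_div mulrA.
Qed.

Lemma scale_continuous (g : R -> R) (b c x : R) : {for b * x, continuous g} ->
  {for x, continuous (fun x => g (b * x) / c)}.
Proof.
move=> cg; apply: continuousM; last exact: cvg_cst.
apply: (continuous_comp (f := fun x : R => b * x)) cg.
by apply: continuousM; [exact: cvg_cst|exact: cvg_id].
Qed.

Variables (d1 d2 : measure_display) (T1 : measurableType d1) (T2 : measurableType d2).
Variables (P1 : probability T1 R) (P2 : probability T2 R).
Variables (X : T1 -> mR) (Y : T1 -> R) (U : {RV P2 >-> R}).
Variables (I : finType) (i0 : I) (al be : I -> R) (a b : R).
Hypothesis mX : measurable_fun setT X.
Hypothesis X0 : forall w, 0 <= X w.
Hypothesis al0 : forall i, 0 < al i.
Hypothesis be0 : forall i, 0 < be i.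
Hypothesis HL : forall t : R, 0 <= t ->
  (\int[P1]_w (expR (- (t * X w)))%:E = (gamma_laplace al be t)%:E)%E.
Hypothesis mean_be : \sum_i al i * be i = a.
Hypothesis var_be : \sum_i al i * be i * be i = a.
Hypothesis b0 : 0 < b.
Hypothesis XY : forall w, 0 < Y w -> X w = Y w / b.
Hypothesis XY0 : forall w, Y w <= 0 -> X w <= 0.
Hypothesis hU : forall A : set R, measurable A -> distribution P2 U A = gamma_prob a b A.

Let a0 : 0 < a := gamma_shape_gt0 i0 al0 be0 mean_be.
Let mass1 := gamma_mass1 b0 hU.

Let V w := U w / b.
Let VU w : 0 < U w -> V w = U w / b. Proof. by []. Qed.
Let VU0 w : U w <= 0 -> V w <= 0.
Proof. by move=> U0; rewrite /V mulr_le0_ge0// invr_ge0 ltW. Qed.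

Lemma dist1_gamma (dl : R) : (forall i, `|be i - 1| * be i <= dl) ->
  (dist1 P1 P2 Y U <= (b * (2 * dl))%:E)%E.
Proof.
move=> dlP; apply: ge_ereal_sup => _ [h hZ <-].
pose g x := h (b * x) / b; pose g' x := derive1 h (b * x) / 1.
have bn0 : b != 0 by rewrite gt_eqF.
have dg (x : R) : 0 < x -> is_derive x 1 g (g' x).
  move=> x0; have bx0 : 0 < b * x by rewrite mulr_gt0.
  by have := scale_derive b bn0 (Z1_class_derive hZ bx0); rewrite divff.
have cg' (x : R) : 0 < x -> {for x, continuous g'}.
  by move=> x0; apply: scale_continuous; have [] := hZ (b * x) (mulr_gt0 b0 x0).
have g'1 (x : R) : 0 < x -> `|g' x| <= 1.
  by move=> x0; rewrite /g' divr1; have [] := hZ (b * x) (mulr_gt0 b0 x0).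
have [i1 D1] := expect_diff_order1 mX X0 i0 al0 be0 HL mean_be var_be mass1 dg cg' g'1 dlP.
have [i2 D2] := gamma_law_mean a0 b0 hU dg (fun x => linear_growth_sqr (x := x) dg g'1).
rewrite (expect_pos_scaled b0 bn0 XY XY0 i1) (expect_pos_scaled b0 bn0 VU VU0 i2).
rewrite -EFinB abse_EFin lee_fin -mulrBr normrM (gtr0_norm b0) ler_pM2l// -/g.
by rewrite D2.
Qed.

Lemma dist2_gamma (dl1 dl2 : R) : (forall i, `|be i - 1| * be i <= dl1) ->
  (forall i, `|be i - 1| * be i ^+ 2 <= dl2) ->
  (dist2 P1 P2 Y U <= (b ^+ 2 * (2 * dl2))%:E + (b ^+ 2 * a)%:E * e_const a * dl1%:E)%E.
Proof.
move=> dl1P dl2P; apply: ge_ereal_sup => _ [h hZ <-].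
pose g x := h (b * x) / b ^+ 2; pose g' x := derive1 h (b * x) / b; pose g'' x := derive1n 2 h (b * x) / 1.
have bn0 : b != 0 by rewrite gt_eqF.
have b20 : 0 < b ^+ 2 by rewrite exprn_gt0.
have b2n0 : b ^+ 2 != 0 by rewrite gt_eqF.
have dg (x : R) : 0 < x -> is_derive x 1 g (g' x).
  move=> x0; have bx0 : 0 < b * x by rewrite mulr_gt0.
  by have := scale_derive (b ^+ 2) bn0 (Z2_class_derive hZ bx0); rewrite expr2 mulfK.
have dg' (x : R) : 0 < x -> is_derive x 1 g' (g'' x).
  move=> x0; have bx0 : 0 < b * x by rewrite mulr_gt0.
  by have := scale_derive b bn0 (Z2_class_derive2 hZ bx0); rewrite divff.
have cg'' (x : R) : 0 < x -> {for x, continuous g''}.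
  by move=> x0; apply: scale_continuous; have [] := hZ (b * x) (mulr_gt0 b0 x0).
have g''1 (x : R) : 0 < x -> `|g'' x| <= 1.
  by move=> x0; rewrite /g'' divr1; have [] := hZ (b * x) (mulr_gt0 b0 x0).
have i1 := expect_integrable_order2 mX X0 i0 al0 be0 HL mean_be mass1 dg dg' g''1.
have [i2 D2] := gamma_law_mean a0 b0 hU dg (fun x => quadratic_growth (x := x) dg dg' g''1).
rewrite (expect_pos_scaled b0 b2n0 XY XY0 i1) (expect_pos_scaled b0 b2n0 VU VU0 i2).
rewrite -EFinB abse_EFin -mulrBr normrM (gtr0_norm b20) -/g.
have dl10 : 0 <= dl1 by apply: le_trans (dl1P i0); rewrite mulr_ge0// ltW.
have dl20 : 0 <= dl2 by apply: le_trans (dl2P i0); rewrite mulr_ge0// sqr_ge0.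
have e1 := e_const_ge a0 mass1 ltr01.
have c1 : 0 <= 4 * up2 a 1 * low2 a 1 / (1 ^+ 3 * gamma_pdf a 1 1).
  have u0 := up2_ge0 a0 mass1 ltr01; have l0 := low2_ge0 a0 mass1 ltr01.
  apply: divr_ge0; first by apply: mulr_ge0 => //; exact: mulr_ge0.
  by rewrite expr1n mul1r gamma_pdf_ge0.
have e0 : (0 <= e_const a)%E by apply: le_trans e1; rewrite lee_fin.
have b2a : 0 < b ^+ 2 * a by rewrite mulr_gt0.
case E : (e_const a) => [C| |]; last by move: e0; rewrite E.
- rewrite -!EFinM -EFinD lee_fin.
  have CP (x : R) : 0 < x -> 4 * up2 a x * low2 a x / (x ^+ 3 * gamma_pdf a 1 x) <= C.
    by move=> x0; rewrite -lee_fin -E; exact: e_const_ge.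
  have H := expect_diff_order2 mX X0 i0 al0 be0 HL mean_be var_be mass1 dg dg' cg'' g''1 dl1P dl2P CP.
  rewrite (_ : b ^+ 2 * a * C * dl1 = b ^+ 2 * (a * C * dl1)); last by ring.
  by rewrite -mulrDr ler_pM2l// D2.
(* An infinite [e_const] makes the right side infinite unless [dl1 = 0]; in that case every [be i]
   is 1 and the two expectations agree. *)
have [dl0|dl0] := eqVneq dl1 0.
  have be1 i : be i = 1.
    have := dl1P i; rewrite dl0 pmulr_lle0// normr_le0 subr_eq0 => /eqP.
    by [].
  rewrite dl0 mule0 adde0 lee_fin D2.
  have -> : \int[P1]_w halfline_patch g (X w) = gamma_mean a g.
    by apply: (expect_diff_order2_eq mX X0 i0 al0 be0 HL mean_be var_be mass1 dg dg').
  by rewrite subrr normr0 mulr0 mulr_ge0 ?sqr_ge0 ?mulr_ge0.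
have dl1p : 0 < dl1 by rewrite lt_def dl0.
by rewrite gt0_muley ?lte_fin// gt0_mulye ?lte_fin// addey ?leey.
Qed.

End dist_bounds.

(** * Robbins' lower bound for the Gamma function *)

Section logarithm_bounds.
Context {R : realType}.

Lemma interval_MVT_ge0 (F f : R -> R) (t : R) : 0 <= t ->
  (forall z : R, 0 <= z -> z <= t -> is_derive z 1 F (f z)) ->
  (forall z : R, 0 < z -> z < t -> 0 <= f z) -> F 0 <= F t.
Proof.
rewrite le_eqVlt => /predU1P[<-//|t0] dF f0.
have dFi z : z \in `]0, t[%R -> is_derive z 1 F (f z).
  by rewrite in_itv/= => /andP[z0 zt]; apply: dF; exact: ltW.
have cF : {within `[0, t], continuous F}.
  apply: derivable_within_continuous => z; rewrite in_itv/= => /andP[z0 zt].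
  by have [] := dF z z0 zt.
have [c] := MVT t0 dFi cF; rewrite in_itv/= => /andP[c0 ct] E.
by rewrite -subr_ge0 E subr0 mulr_ge0 ?f0// ltW.
Qed.

Lemma ln1D_ge (v : R) : 0 <= v -> v - v ^+ 2 / 2 <= ln (1 + v).
Proof.
move=> v0; rewrite -subr_ge0.
have := @interval_MVT_ge0 (fun z => ln (1 + z) - (z - z ^+ 2 / 2)) (fun z => z ^+ 2 / (1 + z)) v v0.
rewrite addr0 ln1 expr0n/= mul0r !subr0; apply.
- by move=> z z0 _; have z1 : 0 < 1 + z; [lra|rderive => //; field; rewrite gt_eqF].
- by move=> z z0 _; rewrite divr_ge0 ?sqr_ge0//; lra.
Qed.

Lemma ln1B_ge (w : R) : 0 <= w -> w <= 1 / 2 -> - w - w ^+ 2 / 2 - w ^+ 3 <= ln (1 - w).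
Proof.
move=> w0 w2; rewrite -subr_ge0.
have := @interval_MVT_ge0 (fun z => ln (1 - z) - (- z - z ^+ 2 / 2 - z ^+ 3))
  (fun z => z ^+ 2 * (2 - 3 * z) / (1 - z)) w w0.
rewrite subr0 ln1 !expr0n/= mul0r !subr0 oppr0 subr0; apply.
- move=> z z0 zw; have z1 : 0 < 1 - z by lra.
  by rderive => //; field; rewrite gt_eqF.
- by move=> z z0 zw; rewrite divr_ge0 ?mulr_ge0 ?sqr_ge0//; lra.
Qed.

(** The rational bound is dictated by its use at t = 1 / (2 x + 1): there 6 - 5 t = t (12 x + 1) and
    6 + 7 t = t (12 x + 13), so multiplying by x + 1 / 2 = 1 / (2 t) gives 1 + 1 / (12 x + 1) - 1 /
    (12 x + 13), whose last terms telescope in x. *)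
Lemma artanh_ge (t : R) : 0 <= t -> t < 1 ->
  2 * t + 24 * t ^+ 3 / ((6 - 5 * t) * (6 + 7 * t)) <= ln (1 + t) - ln (1 - t).
Proof.
move=> t0 t1; rewrite -subr_ge0.
pose F z := ln (1 + z) - ln (1 - z) - (2 * z + 24 * z ^+ 3 / ((6 - 5 * z) * (6 + 7 * z))) : R.
pose f z := 2 * z ^+ 3 * (576 - 660 * z - 552 * z ^+ 2 + 805 * z ^+ 3) /
  ((1 + z) * (1 - z) * ((6 - 5 * z) * (6 + 7 * z)) ^+ 2) : R.
have F0 : F 0 = 0 by rewrite /F !(addr0, subr0) ln1 subrr expr0n/= !(mulr0, mul0r) addr0 subrr.
rewrite -[X in X <= _]F0; apply: (interval_MVT_ge0 (F := F) (f := f) t0).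
- move=> z z0 zt; have z1 : 0 < 1 + z by lra.
  have z2 : 0 < 1 - z by lra.
  have z3 : 0 < 6 - 5 * z by lra.
  have z4 : 0 < 6 + 7 * z by lra.
  rewrite /F /f; rderive => //; first by rewrite mulf_neq0// gt_eqF.
  by field; rewrite !gt_eqF.
- move=> z z0 zt; rewrite /f.
  have H : 0 <= z * (z - 4 / 5) ^+ 2 by apply: mulr_ge0; [exact: ltW|exact: sqr_ge0].
  have q0 : 0 <= 576 - 660 * z - 552 * z ^+ 2 + 805 * z ^+ 3.
    (* The squares are centred at 4 / 5, close to the minimum of this cubic on the positive
       half-line. *)
    have -> : 576 - 660 * z - 552 * z ^+ 2 + 805 * z ^+ 3 =
      805 * (z * (z - 4 / 5) ^+ 2) + 736 * (z - 4 / 5) ^+ 2 + (2624 / 25 + 12 / 5 * z) by field.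
    have H2 := sqr_ge0 (z - 4 / 5); lra.
  apply: divr_ge0.
    apply: mulr_ge0; last exact: q0.
    by apply: mulr_ge0 => //; apply: exprn_ge0; exact: ltW.
  by apply: mulr_ge0; [apply: mulr_ge0; lra|exact: sqr_ge0].
Qed.

(* With [t = 1 / (2 x + 1)] one has [ln (1 + t) - ln (1 - t) = ln (x + 1) - ln x]. *)
Lemma robbins_step (x : R) : 0 < x ->
  1 + (12 * x + 1)^-1 - (12 * x + 13)^-1 <= (x + 1 / 2) * (ln (x + 1) - ln x).
Proof.
move=> x0; pose t := (2 * x + 1)^-1.
have x1 : 0 < 2 * x + 1 by lra.
have t0 : 0 < t by rewrite invr_gt0.
have t1 : t < 1 by rewrite invf_lt1//; lra.
have := artanh_ge (ltW t0) t1.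
have -> : 1 + t = 2 / (2 * x + 1) * (x + 1) by rewrite /t; field; rewrite gt_eqF.
have -> : 1 - t = 2 / (2 * x + 1) * x by rewrite /t; field; rewrite gt_eqF.
have c0 : 0 < 2 / (2 * x + 1) by rewrite divr_gt0.
rewrite !lnM ?posrE//; last lra.
move=> H; have {}H : 2 * t + 24 * t ^+ 3 / ((6 - 5 * t) * (6 + 7 * t)) <= ln (x + 1) - ln x by lra.
apply: le_trans (ler_wpM2l _ H); last lra.
rewrite le_eqVlt; apply/orP; left; apply/eqP; rewrite /t; field.
rewrite !gt_eqF//=; lra.
Qed.

(** From exp(s^2 / 4) >= (1 + s^2 / 8)^2 the gap is at least 8 + s^2 (s - 4)^2 / 8. It absorbs the
    cubic error of [laplace_pointwise]. *)
Lemma cube_le_expR (s : R) : 0 <= s -> s ^+ 3 <= 8 * expR (s ^+ 2 / 4).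
Proof.
move=> s0; have -> : expR (s ^+ 2 / 4) = expR (s ^+ 2 / 8) ^+ 2.
  by rewrite -expRM_natl; congr expR; field.
have H := expR_ge1Dx (s ^+ 2 / 8).
apply: (@le_trans _ _ (8 * (1 + s ^+ 2 / 8) ^+ 2)).
  have H1 : 0 <= s ^+ 2 * (s - 4) ^+ 2 by rewrite mulr_ge0 ?sqr_ge0.
  rewrite -subr_ge0; have -> : 8 * (1 + s ^+ 2 / 8) ^+ 2 - s ^+ 3 = 8 + s ^+ 2 * (s - 4) ^+ 2 / 8 by field.
  by rewrite addr_ge0// divr_ge0.
rewrite ler_wpM2l// lerXn2r// ?nnegrE ?expR_ge0//.
by rewrite addr_ge0// divr_ge0// sqr_ge0.
Qed.

End logarithm_bounds.

(** * Stirling's bound by recursion and Laplace's method *)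

Section stirling.
Context {R : realType}.
Notation leb := (@lebesgue_measure R).
Local Notation mR := (measurableTypeR R).
Local Notation mass1 a := (\int[leb]_(x in `]0%R, +oo[) (gamma_pdf a 1 x)%:E = 1)%E.

(** a P(x) - x p(x) is a primitive of x p(x), since (x p)' = (a - x) p. *)
Lemma gamma_density_mean (a : R) : 0 < a -> mass1 a ->
  (\int[leb]_(x in `]0%R, +oo[) (x * gamma_pdf a 1 x)%:E = a%:E)%E.
Proof.
move=> a0 m1; pose F x := a * gamma_low a x - x * gamma_pdf a 1 x.
have dF (x : R) : 0 < x -> is_derive x 1 F (x * gamma_pdf a 1 x).
  move=> x0; have := gamma_pdf_derive m1 x0 => ?; have := gamma_low_derive m1 x0 => ?.
  by rewrite /F; rderive; field; rewrite gt_eqF.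
have cf (x : R) : 0 < x -> {for x, continuous (fun x : R => x * gamma_pdf a 1 x)}.
  by move=> x0; apply: continuousM; [exact: cvg_id|exact: gamma_pdf_continuous].
have F0 : F x @[x --> (0:R)^'+] --> (0 : R).
  rewrite -[X in _ --> X]subr0; apply: cvgB; last exact: gamma_pdf_at0.
  by apply: cvg00_mul (cvg_cst _) _; exact: gamma_low_at0.
have Fy : F x @[x --> +oo%R] --> a.
  have H : a * gamma_up a x + x ^+ 1 * gamma_pdf a 1 x @[x --> +oo%R] --> (0 : R).
    apply: cvgy0_sum; last exact: gamma_pdf_aty.
    by apply: cvgy0_scale; exact: gamma_up_aty.
  rewrite -[X in _ --> X]subr0.
  have : a - (a * gamma_up a x + x ^+ 1 * gamma_pdf a 1 x) @[x --> +oo%R] --> a - 0.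
    by apply: cvgB H; exact: cvg_cst.
  apply: cvg_trans; apply: near_eq_cvg; near=> x.
  have x0 : 0 < x by near: x; exact: nbhs_pinfty_gt.
  by rewrite gamma_upE ?(ltW x0)// /F; ring.
rewrite (ge0_FTC_itv0y dF cf F0 Fy) ?subr0//.
by move=> x x0; rewrite mulr_ge0 ?gamma_pdf_ge0// ltW.
Unshelve. all: end_near. Qed.

Lemma Gamma_integrand (a x : R) : 0 < x -> mass1 a ->
  x `^ (a - 1) * expR (- x) = Gamma_fun a * gamma_pdf a 1 x.
Proof.
move=> x0 m1; rewrite gamma_pdfE// !mulrA divff ?mul1r//.
by rewrite gt_eqF// Gamma_fun_gt0.
Qed.

Lemma Gamma_integrandS (a x : R) : 0 < x -> mass1 a ->
  x `^ a * expR (- x) = Gamma_fun a * (x * gamma_pdf a 1 x).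
Proof.
move=> x0 m1; rewrite mulrCA -Gamma_integrand// mulrA; congr (_ * _).
rewrite -[X in _ = X * _](powRr1 (ltW x0)) -powRD; first by rewrite addrC subrK.
by rewrite [x == 0]gt_eqF// implybT.
Qed.

Let ge0_xp (a x : R) : mass1 a -> 0 < x -> 0 <= x * gamma_pdf a 1 x.
Proof. by move=> m1 x0; rewrite mulr_ge0 ?gamma_pdf_ge0// ltW. Qed.

Let int_GammaS (a : R) : 0 < a -> mass1 a ->
  (\int[leb]_(x in `]0%R, +oo[) (x `^ a * expR (- x))%:E = (a * Gamma_fun a)%:E)%E.
Proof.
move=> a0 m1; rewrite (eq_integral (fun x : mR => (Gamma_fun a)%:E * (x * gamma_pdf a 1 x)%:E)%E); last first.
  by move=> x; rewrite inE/= in_itv/= andbT => x0; rewrite -EFinM Gamma_integrandS.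
rewrite ge0_integralZl_EFin//.
- by rewrite gamma_density_mean// -EFinM mulrC.
- by move=> x; rewrite /= in_itv/= andbT => x0; rewrite lee_fin ge0_xp.
- apply/measurable_EFinP; apply: measurable_funTS; apply: measurable_funM => //.
  exact: measurable_gamma_pdfT.
- exact: Gamma_fun_ge0.
Qed.

Lemma Gamma_funS (a : R) : 0 < a -> mass1 a -> Gamma_fun (a + 1) = a * Gamma_fun a.
Proof. by move=> a0 m1; rewrite /Gamma_fun addrK /Rintegral int_GammaS. Qed.

(** The density of parameter a + 1 is x p(x) / a, whose integral is the mean divided by a. *)
Lemma gamma_mass1S (a : R) : 0 < a -> mass1 a -> mass1 (a + 1).
Proof.
move=> a0 m1.
rewrite (eq_integral (fun x : mR => (a^-1)%:E * (x * gamma_pdf a 1 x)%:E)%E); last first.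
  move=> x; rewrite inE/= in_itv/= andbT => x0; rewrite -EFinM gamma_pdfE// addrK -mulrA Gamma_integrandS// Gamma_funS//.
  by congr EFin; field; rewrite !gt_eqF// Gamma_fun_gt0.
rewrite ge0_integralZl_EFin//.
- by rewrite gamma_density_mean// -EFinM mulVf// gt_eqF.
- by move=> x; rewrite /= in_itv/= andbT => x0; rewrite lee_fin ge0_xp.
- apply/measurable_EFinP; apply: measurable_funTS; apply: measurable_funM => //.
  exact: measurable_gamma_pdfT.
- by rewrite invr_ge0 ltW.
Qed.

Lemma gamma_mass1_iter (a : R) n : 0 < a -> mass1 a -> mass1 (a + n%:R).
Proof.
move=> a0 m1; elim: n => [|n IH]; first by rewrite addr0.
by rewrite -natr1 addrA; apply: gamma_mass1S => //; rewrite ltr_wpDr.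
Qed.

(* [G x / (sqrt x * (x / e) ^ x) * exp (- 1 / (12 x + 1))] where [G x = Gamma (x + 1)]. *)
Definition robbins_ratio (x : R) :=
  Gamma_fun (x + 1) * expR (- ((x + 1 / 2) * ln x - x) - (12 * x + 1)^-1).

Lemma robbins_ratioS (x : R) : 0 < x -> mass1 (x + 1) ->
  robbins_ratio (x + 1) <= robbins_ratio x.
Proof.
move=> x0 m1; have x1 : 0 < x + 1 by rewrite addr_gt0.
rewrite /robbins_ratio Gamma_funS// [(x + 1) * _]mulrC -mulrA ler_wpM2l//; first exact: Gamma_fun_ge0.
rewrite -{1}[x + 1]lnK ?posrE// -expRD ler_expR.
have -> : 12 * (x + 1) + 1 = 12 * x + 13 by ring.
have := robbins_step x0; lra.
Qed.

Lemma robbins_ratio_iter (x : R) n : 0 < x -> mass1 (x + 1) ->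
  robbins_ratio (x + n%:R) <= robbins_ratio x.
Proof.
move=> x0 m1; elim: n => [|n IH]; first by rewrite addr0.
rewrite -natr1 addrA; apply: le_trans IH; apply: robbins_ratioS; first by rewrite ltr_wpDr.
by rewrite addrAC; apply: gamma_mass1_iter => //; rewrite addr_gt0.
Qed.

(* Laplace's method: the left side is the leading Gaussian term and the right one is
   [u `^ y * exp (- u)] normalised by its maximum, plus the cubic error. *)
Lemma laplace_pointwise (y u : R) : 0 < y ->
  expR (- (u - y) ^+ 2 / (2 * y)) <=
  (if 0 < u then expR (y * ln u - u - (y * ln y - y)) else 0) +
    8 / Num.sqrt y * expR (- (u - y) ^+ 2 / (4 * y)).
Proof.
move=> y0; pose s := Num.sqrt y; have s0 : 0 < s by rewrite sqrtr_gt0.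
have s2 : s ^+ 2 = y by rewrite sqr_sqrtr// ltW.
pose v := (u - y) / y; have uE : u = y * (1 + v) by rewrite /v; field; rewrite gt_eqF.
have E1 : - (u - y) ^+ 2 / (2 * y) = - (y * v ^+ 2 / 2) by rewrite uE; field; rewrite gt_eqF.
have E2 : - (u - y) ^+ 2 / (4 * y) = - (y * v ^+ 2 / 4) by rewrite uE; field; rewrite gt_eqF.
rewrite E1 E2 -/s.
have c0 : 0 <= 8 / s * expR (- (y * v ^+ 2 / 4)) by rewrite mulr_ge0 ?expR_ge0// divr_ge0// ltW.
have half : expR (- (y * v ^+ 2 / 2)) = expR (- (y * v ^+ 2 / 4)) * expR (- (y * v ^+ 2 / 4)).
  by rewrite -expRD; congr expR; field.
(* For u < y / 2 the error term alone dominates, because e^(-y / 16) <= 8 / sqrt y. *)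
have [v2|v2] := ltP v (- (1 / 2)).
  rewrite -[leLHS]add0r; apply: lerD; first by case: ifP => // _; exact: expR_ge0.
  rewrite half ler_wpM2r ?expR_ge0//.
  apply: (@le_trans _ _ (expR (- (y / 16)))).
    rewrite ler_expR lerN2 -mulrA ler_wpM2l ?(ltW y0)//.
    have : (1 / 2) ^+ 2 <= (- v) ^+ 2 by rewrite lerXn2r ?nnegrE//; lra.
    rewrite sqrrN; lra.
  rewrite expRN -[leRHS]invf_div lef_pV2 ?posrE ?expR_gt0 ?divr_gt0//.
  apply: le_trans (expR_ge1Dx _); rewrite -s2.
  have := sqr_ge0 (s - 1); lra.
have v1 : 0 < 1 + v by lra.
have u0 : 0 < u by rewrite uE mulr_gt0.
have E3 : y * ln u - u - (y * ln y - y) = y * (ln (1 + v) - v).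
  by rewrite {1}uE lnM ?posrE// uE; ring.
rewrite u0 E3.
(* For u >= y the bound ln(1 + v) >= v - v^2 / 2 leaves no error. *)
have [v0|v0] := leP 0 v.
  rewrite ler_wpDr// ler_expR; have := ln1D_ge v0 => H.
  have := ler_wpM2l (ltW y0) H; lra.
pose w := - v; have w0 : 0 < w by rewrite oppr_gt0.
have vE : v = - w by rewrite opprK.
have w2 : w <= 1 / 2 by rewrite /w; lra.
have H := ler_wpM2l (ltW y0) (ln1B_ge (ltW w0) w2).
(* For v = - w in [-1/2, 0[ the logarithm loses at most w^3. The inequality 1 <= e^(-r) + r with r =
   y w^3 makes this an additive error, which [cube_le_expR] bounds at sqrt y * w. *)
apply: (@le_trans _ _ (expR (- (y * v ^+ 2 / 2)) * expR (- (y * w ^+ 3)) +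
   expR (- (y * v ^+ 2 / 2)) * (y * w ^+ 3))).
  rewrite -mulrDr ler_peMr ?expR_ge0//.
  have := expR_ge1Dx (- (y * w ^+ 3)); lra.
apply: lerD.
  by rewrite -expRD ler_expR vE sqrrN; lra.
rewrite half -mulrA [leRHS]mulrC ler_wpM2l ?expR_ge0//.
have cub (k : R) : 0 <= k -> k ^+ 3 / s * expR (- (k ^+ 2 / 4)) <= 8 / s.
  move=> k0; rewrite expRN mulrAC ler_pM2r ?invr_gt0// ler_pdivrMr ?expR_gt0//.
  exact: cube_le_expR.
have := cub (s * w) (mulr_ge0 (ltW s0) (ltW w0)).
rewrite [(s * w) ^+ 3]exprMn [(s * w) ^+ 2]exprMn s2 (_ : s ^+ 3 = y * s); last by rewrite exprSr s2.
have -> : y * s * w ^+ 3 / s = y * w ^+ 3 by field; rewrite gt_eqF.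
by rewrite (_ : v ^+ 2 = w ^+ 2) 1?mulrC// /w sqrrN.
Qed.

Lemma integral_gaussian_bump (m s : R) : 0 < s ->
  (\int[leb]_u (expR (- (u - m) ^+ 2 / (2 * s)))%:E = (Num.sqrt (2 * pi * s))%:E)%E.
Proof.
move=> s0; have sn0 : Num.sqrt s != 0 by rewrite gt_eqF// sqrtr_gt0.
have p0 : 0 < 2 * pi * s by rewrite !mulr_gt0// pi_gt0.
rewrite (eq_integral (fun u : mR => (Num.sqrt (2 * pi * s))%:E * (normal_pdf m (Num.sqrt s) u)%:E)%E); last first.
  move=> u _; rewrite -EFinM normal_pdfE// /normal_peak /normal_fun sqr_sqrtr ?(ltW s0)//.
  have -> : s * pi *+ 2 = 2 * pi * s by ring.
  rewrite mulrA divff ?mul1r; first by congr (EFin (expR _)); field; rewrite gt_eqF.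
  by rewrite gt_eqF// sqrtr_gt0.
rewrite ge0_integralZl_EFin//.
- by rewrite integral_normal_pdf mule1.
- by move=> u _; rewrite lee_fin normal_pdf_ge0.
- by apply/measurable_EFinP; exact: measurable_normal_pdf.
Qed.

(** [laplace_pointwise] integrated in u: the Gaussian bumps have variances y and 2 y, and the error
    contributes 8 sqrt(4 pi) for every y. *)
Lemma Gamma_fun_laplace (y : R) : 0 < y -> mass1 (y + 1) ->
  (Num.sqrt (2 * pi * y) - 8 * Num.sqrt (4 * pi)) * expR (y * ln y - y) <= Gamma_fun (y + 1).
Proof.
move=> y0 m1; pose c := expR (- (y * ln y - y)).
pose k u := (if 0 < u then expR (y * ln u - u - (y * ln y - y)) else 0) : R.
have kE u : k u = c * (Gamma_fun (y + 1) * gamma_pdf (y + 1) 1 u).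
  rewrite /k; case: ifPn => [u0|]; last by rewrite -leNgt => u0; rewrite gamma_pdf_le0// !mulr0.
  rewrite -Gamma_integrand// addrK /powR gt_eqF// -!expRD; congr expR; lra.
have mk : measurable_fun setT k.
  rewrite (_ : k = fun u => c * (Gamma_fun (y + 1) * gamma_pdf (y + 1) 1 u)); last by apply/funext => u; exact: kE.
  by do 2! apply: measurable_funM => //; exact: measurable_gamma_pdfT.
have k0 u : 0 <= k u by rewrite /k; case: ifP => // _; exact: expR_ge0.
have ik : (\int[leb]_u (k u)%:E = (c * Gamma_fun (y + 1))%:E)%E.
  have -> : (\int[leb]_u (k u)%:E = \int[leb]_(u in `]0%R, +oo[) (k u)%:E)%E.
    rewrite [RHS]integral_mkcond; apply: eq_integral => u _; rewrite patchE.
    case: ifPn => // /negP; rewrite inE/= in_itv/= andbT => /negP u0.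
    by rewrite /k (negbTE u0).
  rewrite (eq_integral (fun u : mR => (c * Gamma_fun (y + 1))%:E * (gamma_pdf (y + 1) 1 u)%:E)%E); last first.
    by move=> u _; rewrite kE mulrA.
  have cG : 0 <= c * Gamma_fun (y + 1) by rewrite mulr_ge0 ?expR_ge0 ?Gamma_fun_ge0.
  rewrite ge0_integralZl_EFin ?m1 ?mule1//.
  + by move=> u; rewrite /= in_itv/= andbT => u0; rewrite lee_fin gamma_pdf_ge0.
  + by apply/measurable_EFinP; apply: measurable_funTS; exact: measurable_gamma_pdfT.
have mb (s : R) : measurable_fun setT (fun u : mR => (expR (- (u - y) ^+ 2 / (2 * s)))).
  apply: measurableT_comp => //; apply: measurable_funM => //; apply: measurable_funN => //.
  by apply: measurable_funX; exact: measurable_funB.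
have e0 : 0 <= 8 / Num.sqrt y by rewrite divr_ge0// sqrtr_ge0.
have : (\int[leb]_u (expR (- (u - y) ^+ 2 / (2 * y)))%:E <=
        \int[leb]_u ((k u)%:E + (8 / Num.sqrt y)%:E * (expR (- (u - y) ^+ 2 / (2 * (2 * y))))%:E))%E.
  apply: ge0_le_integral => //.
  - by apply/measurable_EFinP; exact: mb.
  - by apply/measurable_EFinP; apply: measurable_funD => //; apply: measurable_funM => //; exact: mb.
  - move=> u _; rewrite -EFinM -EFinD lee_fin mulrA (_ : 2 * 2 = 4 :> R); last by ring.
    exact: laplace_pointwise.
rewrite ge0_integralD//; first last.
- by apply/measurable_EFinP; apply: measurable_funM => //; exact: mb.
- exact/measurable_EFinP.
- by move=> u _; rewrite lee_fin.
rewrite ge0_integralZl_EFin//; last by apply/measurable_EFinP; exact: mb.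
rewrite !integral_gaussian_bump ?mulr_gt0// ik -EFinM -EFinD lee_fin.
have -> : 8 / Num.sqrt y * Num.sqrt (2 * pi * (2 * y)) = 8 * Num.sqrt (4 * pi).
  have -> : 2 * pi * (2 * y) = 4 * pi * y by ring.
  rewrite sqrtrM ?mulr_ge0 ?pi_ge0//; field.
  by rewrite gt_eqF// sqrtr_gt0.
move=> H; by rewrite -ler_pdivlMr ?expR_gt0// -expRN -/c [leRHS]mulrC lerBlDr.
Qed.

(** The ratio decreases along x + n, while Laplace's method keeps it above sqrt(2 pi) up to O(1 /
    sqrt y); a value below sqrt(2 pi) would be contradicted far out. *)
Lemma robbins_ratio_ge (x : R) : 0 < x -> mass1 (x + 1) -> Num.sqrt (2 * pi) <= robbins_ratio x.
Proof.
move=> x0 m1; rewrite leNgt; apply/negP => lt.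
pose S := Num.sqrt (2 * pi) : R; pose B := 8 * Num.sqrt (4 * pi) : R.
have S0 : 0 <= S by exact: sqrtr_ge0.
have B0 : 0 <= B by rewrite mulr_ge0 ?sqrtr_ge0.
have dS : 0 < S - robbins_ratio x by rewrite subr_gt0.
(* At y the ratio is at least S - (S + B) / sqrt y, so sqrt y > q yields the contradiction. *)
pose q := (S + B) / (S - robbins_ratio x).
have q0 : 0 <= q by apply: divr_ge0; [exact: addr_ge0|exact: ltW].
pose n := Num.truncn (q ^+ 2 + 1); pose y := x + n.+1%:R.
have yq : q ^+ 2 + 1 < y by rewrite /y ltr_wpDl ?(ltW x0)// truncnS_gt.
have y1 : 1 < y by have := sqr_ge0 q; lra.
have y0 : 0 < y by lra.
have my : mass1 (y + 1) by rewrite /y addrAC; apply: gamma_mass1_iter => //; rewrite addr_gt0.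
pose s := Num.sqrt y; have s0 : 0 < s by rewrite sqrtr_gt0.
have s2 : s ^+ 2 = y by rewrite sqr_sqrtr// ltW.
have sq : q < s.
  rewrite -(@ltr_pXn2r _ 2) ?nnegrE ?(ltW s0)// s2; lra.
have s1 : 1 < s by rewrite -(@ltr_pXn2r _ 2) ?nnegrE ?(ltW s0)// s2 expr1n.
have lnS : y * ln y - y = ((y + 1 / 2) * ln y - y) - ln s.
  have -> : ln y = 2 * ln s by rewrite -s2 lnXn// mulr_natl.
  by field.
pose t := (12 * y + 1)^-1.
have t1 : t <= s^-1.
  rewrite lef_pV2 ?posrE//; last lra.
  have := mulr_ge0 (ltW s0) (ltW (_ : 0 < s - 1)); rewrite -s2; nra.
have t0 : 0 < t by rewrite invr_gt0; lra.
have := robbins_ratio_iter n.+1 x0 m1; rewrite -/y leNgt => /negP; apply.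
have -> : robbins_ratio y = Gamma_fun (y + 1) * expR (- (y * ln y - y)) * expR (- ln s - t).
  by rewrite /robbins_ratio -/t -mulrA -expRD; congr (_ * expR _); rewrite lnS; ring.
have H : S * s - B <= Gamma_fun (y + 1) * expR (- (y * ln y - y)).
  rewrite expRN ler_pdivlMr ?expR_gt0//.
  by have := Gamma_fun_laplace y0 my; rewrite sqrtrM// mulr_ge0 ?pi_ge0.
apply: (@lt_le_trans _ _ ((S * s - B) * expR (- ln s - t))); last by rewrite ler_wpM2r ?expR_ge0.
rewrite expRD expRN lnK ?posrE//.
have et1 : expR (- t) <= 1 by rewrite expR_le1; lra.
have et2 := expR_ge1Dx (- t).
have -> : (S * s - B) * (s^-1 * expR (- t)) = S * expR (- t) - B / s * expR (- t).
  by field; rewrite gt_eqF.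
have H1 : B / s * expR (- t) <= B / s by rewrite ler_piMr// divr_ge0// ltW.
have H2 : S * (1 - s^-1) <= S * expR (- t) by rewrite ler_wpM2l//; lra.
have H3 : (S + B) / s < S - robbins_ratio x by rewrite ltr_pdivrMr// mulrC -ltr_pdivrMr.
lra.
Qed.

End stirling.

(** * Kolmogorov distance *)

Section smooth_step.
Context {R : realType}.
Notation leb := (@lebesgue_measure R).
Local Notation mR := (measurableTypeR R).
Local Notation mass1 a := (\int[leb]_(x in `]0%R, +oo[) (gamma_pdf a 1 x)%:E = 1)%E.

(** The maximum sits at y = a - 1, by ln(x / y) <= x / y - 1. Its value is bounded by
    [robbins_ratio_ge], whose correction e^(1 / (12 y + 1)) is [r_const a]. *)
Lemma gamma_pdf_le (a x : R) : 1 < a -> mass1 a ->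
  gamma_pdf a 1 x <= (Num.sqrt (2 * pi * (a - 1)) * r_const a)^-1.
Proof.
move=> a1 m1; pose y := a - 1; have y0 : 0 < y by rewrite subr_gt0.
have aE : y + 1 = a by rewrite subrK.
have p0 : 0 < 2 * pi * (a - 1) by rewrite !mulr_gt0 ?pi_gt0.
have K0 : 0 < Num.sqrt (2 * pi * (a - 1)) * r_const a by rewrite mulr_gt0 ?sqrtr_gt0 ?expR_gt0.
have [x0|x0] := ltP 0 x; last by rewrite gamma_pdf_le0// invr_ge0 ltW.
have G0 : 0 < Gamma_fun a := Gamma_fun_gt0 m1.
rewrite gamma_pdfE// -mulrA mulrC ler_pdivrMr// [leRHS]mulrC ler_pdivlMr//.
have := robbins_ratio_ge y0; rewrite aE => /(_ m1); rewrite /robbins_ratio aE.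
have -> : - ((y + 1 / 2) * ln y - y) - (12 * y + 1)^-1 = - ((y + 1 / 2) * ln y - y + (12 * y + 1)^-1) by ring.
rewrite expRN ler_pdivlMr ?expR_gt0//; apply: le_trans.
rewrite (_ : Num.sqrt _ = Num.sqrt (2 * pi) * expR (ln y / 2)); last first.
  rewrite sqrtrM ?mulr_ge0 ?pi_ge0//; congr (_ * _).
  apply/eqP; rewrite -(@eqrXn2 _ 2) ?sqrtr_ge0 ?expR_ge0// sqr_sqrtr ?ltW//.
  by rewrite -expRM_natl [2 * _]mulrC divfK// lnK.
rewrite /powR gt_eqF// /r_const.
rewrite (_ : 12 * a - 11 = 12 * y + 1); last by rewrite /y; ring.
rewrite mulrCA -!mulrA ler_wpM2l ?sqrtr_ge0// -!expRD ler_expR.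
have H := @le_ln1Dx _ (x / y - 1).
have {H} : ln (x / y) <= x / y - 1 by rewrite -[X in ln X](subrKC 1) H// ltrBrDl subrr divr_gt0.
rewrite lnM ?posrE ?invr_gt0// lnV// => H; have := ler_wpM2l (ltW y0) H.
rewrite (_ : y * (x / y - 1) = x - y); last by field; rewrite gt_eqF.
by rewrite -/y; lra.
Qed.

Lemma continuous_pos_part : continuous (fun t : R => Num.max t 0).
Proof.
move=> t; rewrite (_ : (fun t : R => Num.max t 0) = fun t : R => (t + 0 + `|t - 0|) / 2); last first.
  by apply/funext => u; exact: maxr_absE.
apply: cvgM; last exact: cvg_cst.
apply: cvgD; first by apply: cvgD; [exact: cvg_id|exact: cvg_cst].
by apply: cvg_norm; apply: cvgB; [exact: cvg_id|exact: cvg_cst].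
Qed.

Lemma rderive_pos_part (n : nat) (t : R) :
  is_derive t 1 (fun t => Num.max t 0 ^+ n.+2) (n.+2%:R * Num.max t 0 ^+ n.+1).
Proof.
have [t0|t0|<-] := ltgtP 0 t.
- apply: (near_rderive (f := fun y => y ^+ n.+2)).
    by near=> y; rewrite (max_idPl _)// ltW//; near: y; exact: lt_nbhsr.
  by have := rderiveX n.+2 (rderive_id t); rewrite mulr1.
- rewrite exprS mul0r mulr0; apply: (near_rderive (f := fun=> (0 : R))).
  near=> y; rewrite (max_idPr _) ?expr0n//= ltW//; near: y; exact: lt_nbhsl.
(* At the kink the difference quotient is the power n + 1 of the positive part of h, which tends to
   0. *)
have H : (fun h : R => h^-1 *: (((fun t : R => Num.max t 0 ^+ n.+2) \o shift 0) (h *: 1) - Num.max 0 0 ^+ n.+2))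
    @ (0 : R)^' --> (0 : R).
  have : Num.max h 0 ^+ n.+1 @[h --> (0:R)^'] --> (0 : R).
    have C : {for 0, continuous (fun h : R => Num.max h 0 ^+ n.+1)}.
      apply: (continuous_comp (f := fun h : R => Num.max h 0) (g := fun h => h ^+ n.+1)).
        exact: continuous_pos_part.
      exact: exprn_continuous.
    by move/continuous_withinNx : C; rewrite maxxx [X in _ --> X]exprS mul0r.
  apply: cvg_trans; apply: near_eq_cvg; near=> h.
  have h0 : h != 0 by near: h; exact: nbhs_dnbhs_neq.
  rewrite /= addr0 maxxx [0 ^+ _]exprS mul0r subr0 /GRing.scale/= mulr1.
  have [hp|hn] := ltP 0 h; first by rewrite [in RHS]exprS mulKf.
  by rewrite !exprS !mul0r mulr0.
apply: DeriveDef; first by apply/cvg_ex; exists 0; exact: H.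
by rewrite exprS mul0r mulr0; apply: cvg_lim.
Unshelve. all: end_near. Qed.

Lemma rderive_shift_pos_part (n : nat) (c t : R) :
  is_derive t 1 (fun t => Num.max (t - c) 0 ^+ n.+2) (n.+2%:R * Num.max (t - c) 0 ^+ n.+1).
Proof.
have D := rderive_eq (rderiveB (rderive_id t) (rderive_cst c t)) (subr0 1).
exact: rderive_eq (rderive_comp D (rderive_pos_part n (t - c))) (mulr1 _).
Qed.

(* A C^1 quadratic spline decreasing from 1 to 0 on [0, 1], with slope at least -2. *)
Definition smooth_step (t : R) := 1 - 2 * Num.max t 0 ^+ 2 +
  4 * Num.max (t - 1 / 2) 0 ^+ 2 - 2 * Num.max (t - 1) 0 ^+ 2.

Definition smooth_step_slope (t : R) := - 4 * Num.max t 0 +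
  8 * Num.max (t - 1 / 2) 0 - 4 * Num.max (t - 1) 0.

Lemma smooth_step_derive (t : R) : is_derive t 1 smooth_step (smooth_step_slope t).
Proof.
have H0 := rderive_pos_part 0 t.
have H1 := rderive_shift_pos_part 0 (1 / 2) t; have H2 := rderive_shift_pos_part 0 1 t.
rewrite /smooth_step /smooth_step_slope; rderive; ring.
Qed.

Lemma continuous_smooth_step_slope : continuous smooth_step_slope.
Proof.
have H (c : R) : continuous (fun t : R => Num.max (t - c) 0).
  move=> t; apply: (continuous_comp (f := fun t : R => t - c) (g := fun t => Num.max t 0)); last exact: continuous_pos_part.
  by apply: cvgB; [exact: cvg_id|exact: cvg_cst].
move=> t; apply: cvgB; last by apply: cvgM; [exact: cvg_cst|exact: H].
apply: cvgD; first by apply: cvgM; [exact: cvg_cst|exact: continuous_pos_part].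
by apply: cvgM; [exact: cvg_cst|exact: H].
Qed.

Let pos_part_cases (t : R) : (0 <= t /\ Num.max t 0 = t) \/ (t <= 0 /\ Num.max t 0 = 0).
Proof. by have [t0|t0] := leP 0 t; [left|right; split => //; exact: ltW]. Qed.

Lemma smooth_step_slope_bound (t : R) : -2 <= smooth_step_slope t <= 0.
Proof.
rewrite /smooth_step_slope.
have [[c0 ->]|[c0 ->]] := pos_part_cases t; have [[c1 ->]|[c1 ->]] := pos_part_cases (t - 1 / 2);
 have [[c2 ->]|[c2 ->]] := pos_part_cases (t - 1); lra.
Qed.

Lemma smooth_step_le0 (t : R) : t <= 0 -> smooth_step t = 1.
Proof.
move=> t0; rewrite /smooth_step.
have [[c0 ->]|[c0 ->]] := pos_part_cases t; have [[c1 ->]|[c1 ->]] := pos_part_cases (t - 1 / 2);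
 have [[c2 ->]|[c2 ->]] := pos_part_cases (t - 1); (try lra); rewrite expr0n/= ?mulr0 ?subr0 ?addr0//.
by rewrite (_ : t = 0) ?expr0n/= ?mulr0 ?subr0//; lra.
Qed.

Lemma smooth_step_ge1 (t : R) : 1 <= t -> smooth_step t = 0.
Proof.
move=> t1; rewrite /smooth_step.
have [[c0 ->]|[c0 ->]] := pos_part_cases t; last lra.
have [[c1 ->]|[c1 ->]] := pos_part_cases (t - 1 / 2); last lra.
have [[c2 ->]|[c2 ->]] := pos_part_cases (t - 1); first by field.
by rewrite (_ : t = 1) ?expr0n/=; [field|lra].
Qed.

Lemma smooth_step_bound (t : R) : 0 <= smooth_step t <= 1.
Proof.
have [t0|t0] := leP t 0; first by rewrite smooth_step_le0// ler01 lexx.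
have [t1|t1] := leP 1 t; first by rewrite smooth_step_ge1// ler01 lexx.
rewrite /smooth_step.
have -> : Num.max t 0 = t by apply/max_idPl; exact: ltW.
have -> : Num.max (t - 1) 0 = 0 by apply/max_idPr; lra.
have [[c1 ->]|[c1 ->]] := pos_part_cases (t - 1 / 2).
  have -> : 1 - 2 * t ^+ 2 + 4 * (t - 1 / 2) ^+ 2 - 2 * 0 ^+ 2 = 2 * (1 - t) ^+ 2 by field.
  rewrite mulr_ge0 ?sqr_ge0//=.
  have : (1 - t) ^+ 2 <= (1 / 2) ^+ 2 by rewrite lerXn2r ?nnegrE//; lra.
  lra.
have -> : 1 - 2 * t ^+ 2 + 4 * 0 ^+ 2 - 2 * 0 ^+ 2 = 1 - 2 * t ^+ 2 by rewrite expr0n/=; ring.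
have : t ^+ 2 <= (1 / 2) ^+ 2 by rewrite lerXn2r ?nnegrE//; lra.
have := sqr_ge0 t; lra.
Qed.

Let shift_derive (z e x : R) : is_derive x 1 (fun x => (x - z) / e) e^-1.
Proof. by rderive; ring. Qed.

Lemma smooth_step_scale_derive (z e x : R) :
  is_derive x 1 (fun x => smooth_step ((x - z) / e)) (smooth_step_slope ((x - z) / e) / e).
Proof. exact: (rderive_comp (shift_derive z e x)) (smooth_step_derive _). Qed.

(** The spline is symmetric about the middle of its window, so it fills half of it; this half enters
    the final constant. *)
Lemma integral_smooth_step (z e : R) : 0 < e ->
  (\int[leb]_(x in `[z, (z + e)%R]) (smooth_step ((x - z) / e))%:E = (e / 2)%:E)%E.
Proof.
move=> e0.
pose G (t : R) := t - 2 / 3 * Num.max t 0 ^+ 3 + 4 / 3 * Num.max (t - 1 / 2) 0 ^+ 3 - 2 / 3 * Num.max (t - 1) 0 ^+ 3.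
have dG (t : R) : is_derive t 1 G (smooth_step t).
  have H0 := rderive_pos_part 1 t.
  have H1 := rderive_shift_pos_part 1 (1 / 2) t; have H2 := rderive_shift_pos_part 1 1 t.
  by rewrite /G /smooth_step; rderive; field.
pose F x := e * G ((x - z) / e).
have dF (x : R) : is_derive x 1 F (smooth_step ((x - z) / e)).
  have D := rderive_comp (shift_derive z e x) (dG _).
  by rewrite /F; rderive; field; rewrite gt_eqF.
have cF (x : R) : {for x, continuous F} by exact: rderive_continuous (dF x).
have cs (x : R) : {for x, continuous (fun x : R => smooth_step ((x - z) / e))}.
  exact: rderive_continuous (smooth_step_scale_derive z e x).
rewrite (continuous_FTC2 (F := F)) ?ltrDl//.
- rewrite -EFinB; congr EFin; rewrite /F subrr mul0r (_ : z + e - z = e) ?divff ?gt_eqF// /G; last by ring.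
  rewrite !maxxx subrr maxxx (_ : Num.max (0 - 1 / 2) 0 = 0 :> R); last by apply/max_idPr; lra.
  rewrite (_ : Num.max (0 - 1) 0 = 0 :> R); last by apply/max_idPr; lra.
  rewrite (_ : Num.max 1 0 = 1 :> R); last by apply/max_idPl.
  rewrite (_ : 1 - 1 / 2 = 1 / 2 :> R); last by field.
  rewrite (_ : Num.max (1 / 2) 0 = 1 / 2 :> R); last by apply/max_idPl; lra.
  by rewrite !expr0n/= expr1n; field.
- by apply: continuous_subspaceT => x; exact: cs.
- split.
  + by move=> x _; have [] := dF x.
  + exact: cvg_at_right_filter (cF z).
  + exact: cvg_at_left_filter (cF (z + e)).
- by move=> x _; exact: rderive1E (dF x).
Qed.

End smooth_step.

(** * From smooth steps to distribution functions *)

Section kolmogorov_bound.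
Context {R : realType}.
Notation leb := (@lebesgue_measure R).
Local Notation mR := (measurableTypeR R).
Local Notation mass1 a := (\int[leb]_(x in `]0%R, +oo[) (gamma_pdf a 1 x)%:E = 1)%E.

(** For dl > 0 the choice e = 2 sqrt(M dl) / M makes both terms equal to sqrt(M dl); for dl = 0 a
    positive c is refuted by e = c / M, which gives c <= c / 2. *)
Lemma le_two_sqrt (c M dl : R) : 0 < M -> 0 <= dl ->
  (forall e : R, 0 < e -> c <= M * e / 2 + 2 * dl / e) -> c <= 2 * Num.sqrt (M * dl).
Proof.
move=> M0; rewrite le_eqVlt => /predU1P[<-|dl0] H.
  rewrite mulr0 sqrtr0 mulr0 leNgt; apply/negP => c0.
  have := H (c / M) (divr_gt0 c0 M0); rewrite mulr0 mul0r addr0 [M * _]mulrC divfK ?gt_eqF//; lra.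
pose s := Num.sqrt (M * dl); have s0 : 0 < s by rewrite sqrtr_gt0 mulr_gt0.
have s2 : s * s = M * dl by rewrite -expr2 sqr_sqrtr// mulr_ge0// ltW.
have e0 : 0 < 2 * s / M by rewrite divr_gt0// mulr_gt0.
have := H _ e0; have -> : 2 * dl / (2 * s / M) = s.
  have sn0 : s != 0 by rewrite gt_eqF.
  by rewrite -[RHS](mulfK sn0) s2; field; rewrite sn0 gt_eqF.
have -> : M * (2 * s / M) / 2 = s by field; rewrite gt_eqF.
by rewrite -/s; lra.
Qed.

Lemma integral_indic_comp {d} {T : measurableType d} (P : {measure set T -> \bar R}) (X : T -> mR)
    (A : set mR) : measurable_fun setT X -> measurable A ->
  (\int[P]_w (\1_A (X w) : R)%:E = P (X @^-1` A))%E.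
Proof.
move=> mX mA; rewrite -[X @^-1` A]setIT -integral_indic//.
by rewrite -[X in measurable X]setTI; exact: mX.
Qed.

Lemma integral_smooth_step_compl (z e : R) : 0 < e ->
  (\int[leb]_(x in `[(z - e)%R, z]) (1 - smooth_step ((x - (z - e)) / e))%:E = (e / 2)%:E)%E.
Proof.
move=> e0; have := integral_smooth_step (z - e) e0; rewrite subrK => H.
have m : measurable_fun `[(z - e)%R, z] (fun x : mR => smooth_step ((x - (z - e)) / e)).
  apply: measurable_funTS; apply: continuous_measurable_fun => x.
  exact: rderive_continuous (smooth_step_scale_derive _ _ _).
have E : (\int[leb]_(x in `[(z - e)%R, z]) ((1 - smooth_step ((x - (z - e)) / e))%:E +
    (smooth_step ((x - (z - e)) / e))%:E) = e%:E)%E.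
  rewrite (eq_integral (cst 1%E)); last by move=> x _; rewrite -EFinD subrK.
  have := lebesgue_measure_itv `[(z - e)%R, z]; rewrite /= lte_fin ltrBlDr ltrDl e0 => L.
  rewrite integral_cst// mul1e [LHS]L -EFinB; congr EFin; ring.
move: E; rewrite ge0_integralD//.
- rewrite H => E; have F : (\int[leb]_(x in `[(z - e)%R, z]) (1 - smooth_step ((x - (z - e)) / e))%:E)%E \is a fin_num.
    have : ((\int[leb]_(x in `[(z - e)%R, z]) (1 - smooth_step ((x - (z - e)) / e))%:E + (e / 2)%:E)%E \is a fin_num) by rewrite E.
    by rewrite fin_numD => /andP[].
  move: E; rewrite -(fineK F) -EFinD => -[E]; congr EFin; lra.
- by move=> x _; rewrite lee_fin subr_ge0; have /andP[] := smooth_step_bound ((x - (z - e)) / e).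
- by apply/measurable_EFinP; apply: measurable_funB => //; exact: m.
- by move=> x _; rewrite lee_fin; have /andP[] := smooth_step_bound ((x - (z - e)) / e).
- by apply/measurable_EFinP; exact: m.
Qed.

Variables (d1 d2 : measure_display) (T1 : measurableType d1) (T2 : measurableType d2).
Variables (P1 : probability T1 R) (P2 : probability T2 R).
Variables (X : T1 -> mR) (Y : T1 -> R) (U : {RV P2 >-> R}).
Variables (I : finType) (i0 : I) (al be : I -> R) (a b : R).
Hypothesis mX : measurable_fun setT X.
Hypothesis X0 : forall w, 0 <= X w.
Hypothesis al0 : forall i, 0 < al i.
Hypothesis be0 : forall i, 0 < be i.
Hypothesis HL : forall t : R, 0 <= t ->
  (\int[P1]_w (expR (- (t * X w)))%:E = (gamma_laplace al be t)%:E)%E.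
Hypothesis mean_be : \sum_i al i * be i = a.
Hypothesis var_be : \sum_i al i * be i * be i = a.
Hypothesis b0 : 0 < b.
Hypothesis hU : forall A : set R, measurable A -> distribution P2 U A = gamma_prob a b A.

Let a0 : 0 < a := gamma_shape_gt0 i0 al0 be0 mean_be.
Let m1 := gamma_mass1 b0 hU.
Let V (w : T2) : mR := U w / b.

Let mV : measurable_fun setT V.
Proof.
have mU : measurable_fun setT (U : T2 -> R) by [].
exact: measurable_funM.
Qed.

Let meanX : \int[P1]_w X w = a.
Proof.
have := weighted_laplace mX X0 be0 HL (lexx 0).
rewrite (_ : gamma_laplace al be 0 = 1); last first.
  apply/EFin_inj; rewrite -HL// (eq_integral (cst 1%E)).
    by rewrite integral_cst// mul1e; exact: probability_setT.
  by move=> w _; rewrite mul0r oppr0 expR0.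
rewrite mul1r (_ : \sum_i _ = a); last first.
  by rewrite -mean_be; apply: eq_bigr => i _; rewrite mulr0 addr0 divr1.
move=> E; rewrite /Rintegral (_ : (\int[P1]_w (X w)%:E)%E = a%:E)// -E.
by apply: eq_integral => w _; rewrite mul0r oppr0 expR0 mulr1.
Qed.

Let mean_id : gamma_mean a id = a.
Proof.
rewrite /gamma_mean /Rintegral.
rewrite (_ : (\int[leb]_x (id x * gamma_pdf a 1 x)%:E)%E = (\int[leb]_(x in `]0%R, +oo[) (x * gamma_pdf a 1 x)%:E)%E).
  by rewrite gamma_density_mean.
rewrite [RHS]integral_mkcond; apply: eq_integral => x _; rewrite patchE.
case: ifPn => //; rewrite notin_setE/= in_itv/= andbT => /negP; rewrite -leNgt.
by move=> /gamma_pdf_le0 ->; rewrite mulr0.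
Qed.

Let mhs (h h' : R -> R) : (forall x : R, 0 < x -> is_derive x 1 h (h' x)) ->
  measurable_fun setT (halfline_patch h : mR -> mR).
Proof.
move=> dh; apply: measurable_halfline => x x0; exact: rderive_continuous (dh x x0).
Qed.

Let halfline_patch_bound (h : R -> R) (x : R) : (forall x : R, 0 < x -> 0 <= h x <= 1) ->
  0 <= halfline_patch h x <= 1.
Proof.
move=> h1; have [x0|x0] := ltP 0 x; first by rewrite halfline_patchE// h1.
by rewrite halfline_patch0// lexx ler01.
Qed.

(* [h / k] is corrected by the identity, on which both expectations agree, so that its slope,
   which lies in [-2, 0], is recentred to [-1, 1]. *)
Let expect_diff_decreasing (h h' : R -> R) (k dl : R) : 0 < k ->
  (forall x : R, 0 < x -> is_derive x 1 h (h' x)) ->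
  (forall x : R, 0 < x -> {for x, continuous h'}) ->
  (forall x : R, 0 < x -> - (2 * k) <= h' x <= 0) ->
  (forall x : R, 0 < x -> 0 <= h x <= 1) ->
  (forall i, `|be i - 1| * be i <= dl) ->
  `|\int[P1]_w halfline_patch h (X w) - \int[P2]_w halfline_patch h (V w)| <= 2 * dl * k.
Proof.
move=> k0 dh ch' h'k h1 dlP.
pose g (x : R) := h x / k + x; pose g' (x : R) := h' x / k + 1.
have dg (x : R) : 0 < x -> is_derive x 1 g (g' x).
  by move=> x0; have := dh x x0 => ?; rewrite /g /g'; rderive; ring.
have cg' (x : R) : 0 < x -> {for x, continuous g'}.
  move=> x0; apply: cvgD; last exact: cvg_cst.
  by apply: cvgM; [exact: ch'|exact: cvg_cst].
have g'1 (x : R) : 0 < x -> `|g' x| <= 1.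
  move=> x0; have /andP[l u] := h'k x x0; rewrite ler_norml /g'.
  have : - 2 <= h' x / k by rewrite ler_pdivlMr//; lra.
  have : h' x / k <= 0 by rewrite ler_pdivrMr// mul0r.
  lra.
have [_ D1] := expect_diff_order1 mX X0 i0 al0 be0 HL mean_be var_be m1 dg cg' g'1 dlP.
have [_ D2] := gamma_law_mean a0 b0 hU dg (fun x => linear_growth_sqr (x := x) dg g'1).
have did (x : R) : 0 < x -> is_derive x 1 id (1:R) by move=> _; exact: rderive_id.
have id1 (x : R) : 0 < x -> `|(1:R)| <= 1 by rewrite normr1.
have [i2 D3] := gamma_law_mean a0 b0 hU did (fun x => linear_growth_sqr (x := x) did id1).
have hb (d : measure_display) (T : measurableType d) (P : probability T R) (Z : T -> mR) :
    measurable_fun setT Z -> P.-integrable setT (fun w => (halfline_patch h (Z w) / k)%:E).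
  move=> mZ; apply: (@bounded_integrable _ _ _ P (fun w => halfline_patch h (Z w) / k) k^-1).
    by apply: measurable_funM => //; apply: measurableT_comp mZ; exact: mhs dh.
  move=> w; have /andP[l u] := halfline_patch_bound (Z w) h1.
  by rewrite ger0_norm ?divr_ge0 ?(ltW k0)// ler_piMl// invr_ge0 ltW.
have iX := gamma_sum_integrable mX X0 be0 HL.
have E1 : \int[P1]_w halfline_patch g (X w) = \int[P1]_w (halfline_patch h (X w) / k) + a.
  rewrite -meanX -RintegralD//; last exact: hb.
  apply: eq_Rintegral => w _; have := X0 w; rewrite le_eqVlt => /predU1P[<-|x0].
    by rewrite !halfline_patch0// mul0r addr0.
  by rewrite !halfline_patchE.
have E2 : \int[P2]_w halfline_patch g (V w) = \int[P2]_w (halfline_patch h (V w) / k) + a.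
  rewrite -[in RHS]mean_id -D3 -RintegralD//; last exact: hb.
  apply: eq_Rintegral => w _; have [x0|x0] := ltP 0 (V w); first by rewrite !halfline_patchE.
  by rewrite !halfline_patch0// mul0r addr0.
have hb1 (d : measure_display) (T : measurableType d) (P : probability T R) (Z : T -> mR) :
    measurable_fun setT Z -> \int[P]_w (halfline_patch h (Z w) / k) = (\int[P]_w halfline_patch h (Z w)) / k.
  move=> mZ; rewrite RintegralZr//; apply: (@bounded_integrable _ _ _ P (fun w => halfline_patch h (Z w)) 1).
    by apply: measurableT_comp mZ; exact: mhs dh.
  by move=> w; have /andP[l u] := halfline_patch_bound (Z w) h1; rewrite ger0_norm.
move: D1; rewrite -D2 E1 E2 !hb1// opprD addrACA subrr addr0 -mulrBl normrM.
by rewrite (gtr0_norm (_ : 0 < k^-1)) ?invr_gt0// ler_pdivrMr.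
Qed.

Section step_estimates.
Variables (a1 : 1 < a) (dl e : R).
Hypothesis dlP : forall i, `|be i - 1| * be i <= dl.
Hypothesis e0 : 0 < e.

Let st (z x : R) := smooth_step ((x - z) / e).
Let M := (Num.sqrt (2 * pi * (a - 1)) * r_const a)^-1.

Let st1 z x : 0 <= st z x <= 1. Proof. exact: smooth_step_bound. Qed.
Let st_le (z x : R) : x <= z -> st z x = 1.
Proof. by move=> xz; rewrite /st smooth_step_le0// mulr_le0_ge0 ?subr_le0// invr_ge0 ltW. Qed.
Let st_ge (z x : R) : z + e <= x -> st z x = 0.
Proof. by move=> xz; rewrite /st smooth_step_ge1// ler_pdivlMr// mul1r lerBrDl. Qed.

Let dst (z x : R) : is_derive x 1 (st z) (smooth_step_slope ((x - z) / e) / e).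
Proof. exact: smooth_step_scale_derive. Qed.

Let mst z : measurable_fun setT (st z : mR -> mR).
Proof. by apply: continuous_measurable_fun => x; exact: rderive_continuous (dst z x). Qed.

Let mhst z : measurable_fun setT (halfline_patch (st z) : mR -> mR).
Proof. exact: (mhs (fun x _ => dst z x)). Qed.

Let hst1 z x : 0 <= halfline_patch (st z) x <= 1.
Proof. by apply: halfline_patch_bound => y _; exact: st1. Qed.

Let step_diff z :
  `|\int[P1]_w halfline_patch (st z) (X w) - \int[P2]_w halfline_patch (st z) (V w)| <= 2 * dl / e.
Proof.
apply: (@expect_diff_decreasing (st z) (fun x => smooth_step_slope ((x - z) / e) / e)
  e^-1 dl _ (fun x _ => dst z x) _ _ (fun x _ => st1 z x) dlP).
- by rewrite invr_gt0.
- move=> x _; apply: cvgM; last exact: cvg_cst.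
  apply: (continuous_comp (f := fun x : R => (x - z) / e)); last exact: continuous_smooth_step_slope.
  by apply: cvgM; [apply: cvgB; [exact: cvg_id|exact: cvg_cst]|exact: cvg_cst].
- move=> x _; have /andP[l u] := smooth_step_slope_bound ((x - z) / e).
  by rewrite -mulNr ler_pM2r ?invr_gt0// l/= mulr_le0_ge0// invr_ge0 ltW.
Qed.

Let step_integrable d (T : measurableType d) (P : probability T R) (Z : T -> mR) z :
  measurable_fun setT Z -> P.-integrable setT (fun w => (halfline_patch (st z) (Z w))%:E).
Proof.
move=> mZ; apply: (@bounded_integrable _ _ _ P (fun w => halfline_patch (st z) (Z w)) 1).
  exact: (measurableT_comp (mhst z) mZ).
by move=> w; have /andP[l u] := hst1 z (Z w); rewrite ger0_norm.
Qed.

Let step_int d (T : measurableType d) (P : probability T R) (Z : T -> mR) z :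
  measurable_fun setT Z ->
  (\int[P]_w (halfline_patch (st z) (Z w))%:E = (\int[P]_w halfline_patch (st z) (Z w))%:E)%E.
Proof. by move=> mZ; rewrite fineK//; apply: integrable_fin_num => //; exact: step_integrable. Qed.

Let le z : set mR := `]-oo, z]%classic.
Let mle z : measurable (le z). Proof. exact: measurable_itv. Qed.
Let leE z x : \1_(le z) x = (x <= z)%R%:R :> R.
Proof. by rewrite indicE mem_setE in_itv. Qed.

(** [halfline_patch] is 0 at 0, where the indicator may be 1; the null event X = 0 makes up for the
    difference. *)
Let prob_le_step z :
  (P1 (X @^-1` le z) <= (\int[P1]_w halfline_patch (st z) (X w))%:E)%E.
Proof.
rewrite -(integral_indic_comp P1 mX (mle z)) -step_int//.
have m0 := measurable_set1 (0 : R).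
rewrite -[leRHS]add0e -(gamma_null0 mX al0 be0 HL i0) -(integral_indic_comp P1 mX m0).
rewrite -ge0_integralD//.
- apply: ge0_le_integral => //.
  + by apply/measurable_EFinP; apply: measurableT_comp mX; exact: measurable_indic.
  + apply/measurable_EFinP; apply: measurable_funD.
      by apply: measurableT_comp mX; exact: measurable_indic.
    exact: (measurableT_comp (mhst z) mX).
  + move=> w _; rewrite -EFinD lee_fin leE; have /andP[l _] := hst1 z (X w).
    case: (leP (X w) z) => xz; last by rewrite addr_ge0.
    have := X0 w; rewrite le_eqVlt => /predU1P[<-|x0].
      by rewrite indicE mem_set// lerDl halfline_patch0.
    by rewrite halfline_patchE// st_le// lerDr.
- by apply/measurable_EFinP; apply: measurableT_comp mX; exact: measurable_indic.
- by move=> w _; rewrite lee_fin; have /andP[] := hst1 z (X w).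
- by apply/measurable_EFinP; exact: (measurableT_comp (mhst z) mX).
Qed.

Let step_le_prob z :
  ((\int[P1]_w halfline_patch (st (z - e)) (X w))%:E <= P1 (X @^-1` le z))%E.
Proof.
rewrite -(integral_indic_comp P1 mX (mle z)) -step_int//.
apply: ge0_le_integral => //.
- by move=> w _; rewrite lee_fin; have /andP[] := hst1 (z - e) (X w).
- by apply/measurable_EFinP; exact: (measurableT_comp (mhst (z - e)) mX).
- by apply/measurable_EFinP; apply: measurableT_comp mX; exact: measurable_indic.
- move=> w _; rewrite lee_fin leE; have /andP[l u] := hst1 (z - e) (X w).
  case: (leP (X w) z) => xz //.
  have [x0|x0] := ltP 0 (X w); last by rewrite halfline_patch0.
  by rewrite halfline_patchE// st_ge// subrK ltW.
Qed.

Let gamma_law_int (phi : mR -> R) : measurable_fun setT phi -> (forall y, 0 <= phi y) ->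
  (\int[P2]_w (phi (V w))%:E = \int[leb]_x (gamma_pdf a 1 x * phi x)%:E)%E.
Proof.
move=> mphi phi0; rewrite (ge0_gamma_law b0 hU mphi phi0).
by apply: eq_integral => w _; rewrite mul1r.
Qed.

Let patch_pdf (h : R -> R) x : gamma_pdf a 1 x * halfline_patch h x = gamma_pdf a 1 x * h x.
Proof.
have [x0|x0] := ltP 0 x; first by rewrite halfline_patchE.
by rewrite gamma_pdf_le0// !mul0r.
Qed.

Let window_int (s : mR -> R) (z t : R) : measurable_fun setT s -> (forall x, 0 <= s x) ->
  (\int[leb]_(x in `[z, t]) (s x)%:E = (e / 2)%:E)%E ->
  (\int[leb]_x (M * (s x * \1_(`[z, t]%classic : set mR) x))%:E = (M * e / 2)%:E)%E.
Proof.
move=> ms s0 H; rewrite -mulrA EFinM -H -ge0_integralZl_EFin//.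
- rewrite [RHS]integral_mkcond; apply: eq_integral => x _; rewrite patchE indicE.
  by case: ifP => _; rewrite ?mulr1 ?EFinM ?mulr0 ?mule0.
- by move=> x _; rewrite lee_fin.
- by apply/measurable_EFinP; exact: measurable_funTS.
- by rewrite invr_ge0 mulr_ge0 ?sqrtr_ge0 ?expR_ge0.
Qed.

Let mindic (A : set mR) : measurable A -> measurable_fun setT (\1_A : mR -> mR).
Proof. by move=> mA; exact: measurable_indic. Qed.

Let ge0_p x : 0 <= gamma_pdf a 1 x := gamma_pdf_ge0 m1 x.
Let pM x : gamma_pdf a 1 x <= M := gamma_pdf_le x a1 m1.
Let M0 : 0 <= M := le_trans (ge0_p 0) (pM 0).
Let mp : measurable_fun setT (gamma_pdf a 1 : mR -> mR) := measurable_gamma_pdfT a 1.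

(** The density is at most M, so passing from f1 to f2 costs M times the integral of the gap [s]
    over the window, that is M e / 2. *)
Let integral_le_window (f1 f2 s : mR -> R) (z t : R) :
  measurable_fun setT f1 -> measurable_fun setT f2 -> measurable_fun setT s ->
  (forall x, 0 <= f1 x) -> (forall x, 0 <= f2 x) -> (forall x, 0 <= s x) ->
  (\int[leb]_(x in `[z, t]) (s x)%:E = (e / 2)%:E)%E ->
  (forall x, gamma_pdf a 1 x * f1 x <=
     gamma_pdf a 1 x * f2 x + M * (s x * \1_(`[z, t]%classic : set mR) x)) ->
  (\int[P2]_w (f1 (V w))%:E <= \int[P2]_w (f2 (V w))%:E + (M * e / 2)%:E)%E.
Proof.
move=> mf1 mf2 ms f10 f20 s0 H f12.
have mw : measurable_fun setT (fun x : mR => M * (s x * \1_(`[z, t]%classic : set mR) x)).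
  by apply: measurable_funM => //; apply: measurable_funM => //; apply: mindic; exact: measurable_itv.
have w0 x : 0 <= M * (s x * \1_(`[z, t]%classic : set mR) x).
  by rewrite mulr_ge0// mulr_ge0// indicE.
rewrite !gamma_law_int// -(window_int ms s0 H) -ge0_integralD//.
- apply: ge0_le_integral => //.
  + by move=> x _; rewrite lee_fin mulr_ge0.
  + by apply/measurable_EFinP; exact: measurable_funM.
  + apply/measurable_EFinP; apply: measurable_funD => //; exact: measurable_funM.
  + by move=> x _; rewrite -EFinD lee_fin.
- by move=> x _; rewrite lee_fin mulr_ge0.
- by apply/measurable_EFinP; exact: measurable_funM.
- by move=> x _; rewrite lee_fin.
- exact/measurable_EFinP.
Qed.

Let gamma_step_le z :
  ((\int[P2]_w halfline_patch (st z) (V w))%:E <= P2 (V @^-1` le z) + (M * e / 2)%:E)%E.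
Proof.
rewrite -(integral_indic_comp P2 mV (mle z)) -step_int//.
apply: (integral_le_window (mhst z) (mindic (mle z)) (mst z) _ _ _ (integral_smooth_step z e0)).
- by move=> x; have /andP[] := hst1 z x.
- by move=> x; rewrite leE.
- by move=> x; have /andP[] := st1 z x.
- move=> x; rewrite patch_pdf leE; have /andP[l u] := st1 z x.
  have Mi : 0 <= M * (st z x * \1_(`[z, (z + e)%R]%classic : set mR) x).
    by rewrite mulr_ge0// mulr_ge0// indicE.
  have [xz|xz] := leP x z; first by rewrite mulr1 ler_wpDr// ler_piMr.
  rewrite mulr0 add0r; have [xe|xe] := leP x (z + e).
    by rewrite indicE mem_set ?mulr1 ?ler_wpM2r//= in_itv/= xe ltW.
  by rewrite [X in X <= _](_ : _ = 0)// st_ge ?mulr0// ltW.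
Qed.

Let gamma_le_step z :
  (P2 (V @^-1` le z) <= (\int[P2]_w halfline_patch (st (z - e)) (V w))%:E + (M * e / 2)%:E)%E.
Proof.
rewrite -(integral_indic_comp P2 mV (mle z)) -step_int//.
have ms : measurable_fun setT (fun x : mR => 1 - st (z - e) x) by apply: measurable_funB; [exact: measurable_cst|exact: mst].
apply: (integral_le_window (mindic (mle z)) (mhst (z - e)) ms _ _ _ (integral_smooth_step_compl z e0)).
- by move=> x; rewrite leE.
- by move=> x; have /andP[] := hst1 (z - e) x.
- by move=> x; rewrite subr_ge0; have /andP[] := st1 (z - e) x.
- move=> x; rewrite patch_pdf leE; have /andP[l u] := st1 (z - e) x.
  have c0 : 0 <= 1 - st (z - e) x by rewrite subr_ge0.
  have Mi : 0 <= M * ((1 - st (z - e) x) * \1_(`[(z - e)%R, z]%classic : set mR) x).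
    by rewrite mulr_ge0// mulr_ge0// indicE.
  have [xz|xz] := leP x z; last by rewrite mulr0 addr_ge0// mulr_ge0.
  rewrite mulr1; have [xe|xe] := leP x (z - e); first by rewrite [X in _ <= _ * X + _]st_le// mulr1 ler_wpDr.
  rewrite indicE mem_set/=; last by rewrite in_itv/= xz andbT ltW.
  apply: (@le_trans _ _ (gamma_pdf a 1 x * st (z - e) x + gamma_pdf a 1 x * (1 - st (z - e) x))).
    by rewrite -mulrDr addrC subrK mulr1.
  by rewrite mulr1 lerD2l ler_wpM2r.
Qed.

(** Steps falling just after z and just before z enclose the indicator of ]-oo, z]. Each comparison
    costs M e / 2 on the Gamma side and 2 dl / e between the two laws. *)
Lemma cdf_diff_window z :
  (`|P1 (X @^-1` `]-oo, z]%classic) - P2 (V @^-1` `]-oo, z]%classic)| <=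
   (M * e / 2 + 2 * dl / e)%:E)%E.
Proof.
have u1 := prob_le_step z; have l1 := step_le_prob z; have u2 := gamma_step_le z; have l2 := gamma_le_step z.
move: u1 l1 u2 l2 (step_diff z) (step_diff (z - e)); rewrite /le.
have f1 : P1 (X @^-1` `]-oo, z]%classic) \is a fin_num.
  by apply: fin_num_measure; rewrite -[X in measurable X]setTI; apply: mX.
have f2 : P2 (V @^-1` `]-oo, z]%classic) \is a fin_num.
  by apply: fin_num_measure; rewrite -[X in measurable X]setTI; apply: mV.
rewrite -(fineK f1) -(fineK f2) -!EFinB -!EFinD abse_EFin !lee_fin !ler_norml.
by move=> ? ? ? ? /andP[? ?] /andP[? ?]; apply/andP; split; lra.
Qed.

End step_estimates.

Lemma dist_Kol_gamma (dl : R) : 1 < a -> measurable_fun setT (Y : T1 -> mR) ->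
  (forall w, 0 < Y w -> X w = Y w / b) -> (forall w, Y w <= 0 -> X w <= 0) ->
  (forall i, `|be i - 1| * be i <= dl) ->
  (dist_Kol P1 P2 Y U <=
   (2 * Num.sqrt ((Num.sqrt (2 * pi * (a - 1)) * r_const a)^-1 * dl))%:E)%E.
Proof.
move=> a1 mY XY XY0 dlP; apply: ge_ereal_sup => _ [z _ <-].
have c0 : 0 <= 2 * Num.sqrt ((Num.sqrt (2 * pi * (a - 1)) * r_const a)^-1 * dl).
  by rewrite mulr_ge0 ?sqrtr_ge0.
have [z0|z0] := leP 0 z.
  have -> : [set w | (Y w <= z)%R] = X @^-1` `]-oo, (z / b)%R]%classic.
    apply/seteqP; split => w /=; rewrite in_itv/=.
      have [Y0|Y0] := leP (Y w) 0; first by move=> _; apply: le_trans (XY0 w Y0) _; rewrite divr_ge0// ltW.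
      by rewrite XY// ler_pM2r ?invr_gt0.
    have [Y0 _|Y0] := leP (Y w) 0; first exact: le_trans Y0 z0.
    by rewrite XY// ler_pM2r ?invr_gt0.
  have -> : [set w | (U w <= z)%R] = V @^-1` `]-oo, (z / b)%R]%classic.
    by apply/seteqP; split => w /=; rewrite in_itv/= /V ler_pM2r ?invr_gt0.
  have fe e : 0 < e -> _ := @cdf_diff_window a1 dl e dlP ^~ (z / b).
  move: fe; case: (`|_ - _|%E) => [c| |] fe.
  - rewrite lee_fin; apply: le_two_sqrt => [||e e0].
    + by rewrite invr_gt0 mulr_gt0 ?expR_gt0// sqrtr_gt0 !mulr_gt0 ?pi_gt0 ?subr_gt0.
    + by apply: le_trans (dlP i0); rewrite mulr_ge0// ltW.
    + by rewrite -lee_fin; exact: fe.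
  - by have := fe 1 ltr01.
  - exact: leNye.
(* For z < 0 both distribution functions vanish: Y <= z forces X = 0, a null event, and the Gamma
   density is 0 there. *)
have -> : P1 [set w | (Y w <= z)%R] = 0%E.
  apply: (subset_measure0 _ _ _ (gamma_null0 mX al0 be0 HL i0)).
  - have -> : [set w | (Y w <= z)%R] = setT `&` Y @^-1` `]-oo, z]%classic.
      by rewrite setTI; apply/seteqP; split => w /=; rewrite in_itv.
    by apply: mY => //; exact: measurable_itv.
  - by rewrite -[X in measurable X]setTI; apply: mX.
  - by move=> w /= Yz; apply/eqP; rewrite eq_le X0 XY0// (le_trans Yz)// ltW.
have -> : P2 [set w | (U w <= z)%R] = 0%E.
  have -> : [set w | (U w <= z)%R] = U @^-1` `]-oo, z]%classic.
    by apply/seteqP; split => w /=; rewrite in_itv.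
  have /= E := hU (measurable_itv `]-oo, z]); rewrite /distribution/= /pushforward in E; rewrite E.
  apply: integral0_eq => x /=; rewrite in_itv/= => xz.
  by rewrite /gamma_pdf ltNge (le_trans xz) ?(ltW z0).
by rewrite sube0 abse0 lee_fin.
Qed.

End kolmogorov_bound.

(** * The three bounds for the trace *)

Theorem corollary3p7 (R : realType) (K d : nat) (hK : (0 < K)%N)
    (hd : (0 < d)%N) (n : 'I_K -> nat) (hn : forall k, (0 < n k)%N)
    (Sigma : 'I_K -> 'M[R]_d) (hSigma : forall k, posdefmx (Sigma k))
    (lambda : 'I_K -> 'I_d -> R)
    (hlambda : forall k,
       char_poly (Sigma k) = \prod_(l < d) ('X - (lambda k l)%:P))
    (d1 : measure_display) (T1 : measurableType d1) (P1 : probability T1 R)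
    (W : 'I_K -> {RV P1 >-> 'M[R]_d})
    (hW : forall k,
       wishart (n k) ((n k)%:R^-1 *: Sigma k) (distribution P1 (W k)))
    (hindep : mutual_independence P1 W)
    (d2 : measure_display) (T2 : measurableType d2) (P2 : probability T2 R)
    (U : {RV P2 >-> R}) :
  let Wn : T1 -> R := fun w => \tr (\sum_(k < K) W k w) in
  let mu : R := \sum_(k < K) \tr (Sigma k) in
  let nu : R := (\sum_(k < K) \tr (Sigma k)) ^+ 2 /
    \sum_(k < K) ((n k)%:R^-1 * \tr (Sigma k *m Sigma k)) in
  (* The terms are nonnegative, so the seed 0 of the maxima is harmless. *)
  let Delta : nat -> R := fun r =>
    \big[Num.max/0]_(k < K) \big[Num.max/0]_(l < d)
      (`|lambda k l / (n k)%:R / (mu / nu) - 1| * (lambda k l / (n k)%:R) ^+ r)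
  in
  (forall A : set R, measurable A ->
     distribution P2 U A = gamma_prob (nu / 2) (2 * mu / nu) A) ->
  [/\ (dist1 P1 P2 Wn U <= (4 * Delta 1%N)%:E)%E,
      (dist2 P1 P2 Wn U <= (8 * Delta 2%N)%:E +
         (2 * mu)%:E * e_const (nu / 2) * (Delta 1%N)%:E)%E &
      2 < nu ->
      (dist_Kol P1 P2 Wn U <=
         (2 * Num.sqrt (nu * Delta 1%N /
            (mu * Num.sqrt (2 * pi * (nu / 2 - 1)) * r_const (nu / 2))))%:E)%E].
Proof.
move=> Wn mu nu Delta hU.
have mu0 : 0 < mu := mu_gt0 hK hd hSigma hlambda.
have nu0 : 0 < nu := nu_gt0 hK hd hn hSigma hlambda.
have b0 : 0 < 2 * mu / nu by rewrite divr_gt0// mulr_gt0.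
have m0 : 0 < mu / nu by rewrite divr_gt0.
pose i0 : 'I_K * 'I_d := (Ordinal hK, Ordinal hd).
pose be := wishart_scale n Sigma lambda.
have be0 i : 0 < be i by exact: wishart_scale_gt0.
have al0 (i : 'I_K * 'I_d) : 0 < wishart_shape n i :> R by exact: wishart_shape_gt0.
(* [be i] times mu / nu is lambda / n, whence the power of mu / nu; the rescaling by b = 2 mu / nu
   undoes it below. *)
have DeltaP r i : `|be i - 1| * be i ^+ r <= Delta r / (mu / nu) ^+ r.
  rewrite ler_pdivlMr ?exprn_gt0// -mulrA -exprMn divfK ?gt_eqF//.
  have := le_bigmax 0 (fun k => \big[Num.max/0]_(l < d)
    (`|lambda k l / (n k)%:R / (mu / nu) - 1| * (lambda k l / (n k)%:R) ^+ r)) i.1.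
  apply: le_trans.
  exact: (le_bigmax 0 (fun l => `|lambda i.1 l / (n i.1)%:R / (mu / nu) - 1| * (lambda i.1 l / (n i.1)%:R) ^+ r)).
have Delta1P i : `|be i - 1| * be i <= Delta 1%N / (mu / nu) by exact: (DeltaP 1%N).
pose X : T1 -> measurableTypeR R := scaled_trace n Sigma W.
have mX : measurable_fun setT X := measurable_scaled_trace n Sigma W.
have X0 := scaled_trace_ge0 n Sigma W.
have HL := scaled_trace_laplace hK hd hn hSigma hlambda hW hindep.
have mean := wishart_mean hK hd hn hSigma hlambda.
have var := wishart_var hK hd hn hSigma hlambda.
have XY w : 0 < Wn w -> scaled_trace n Sigma W w = Wn w / (2 * mu / nu).
  by move=> w0; apply/max_idPl; rewrite divr_ge0// ltW.
have XY0 w : Wn w <= 0 -> scaled_trace n Sigma W w <= 0.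
  by move=> w0; rewrite /scaled_trace (max_idPr _)// mulr_le0_ge0// invr_ge0 ltW.
split.
- apply: le_trans (dist1_gamma i0 mX X0 al0 be0 HL mean var b0 XY XY0 hU Delta1P) _.
  rewrite lee_fin le_eqVlt; apply/orP; left; apply/eqP; field.
  by rewrite !gt_eqF.
- apply: le_trans (dist2_gamma i0 mX X0 al0 be0 HL mean var b0 XY XY0 hU Delta1P (DeltaP 2%N)) _.
  rewrite muleAC [X in (_ <= _ + X)%E]muleAC -!EFinM.
  have -> : (2 * mu / nu) ^+ 2 * (2 * (Delta 2%N / (mu / nu) ^+ 2)) = 8 * Delta 2%N.
    by field; rewrite !gt_eqF.
  have -> : (2 * mu / nu) ^+ 2 * (nu / 2) * (Delta 1%N / (mu / nu)) = 2 * mu * Delta 1%N.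
    by field; rewrite !gt_eqF.
  by [].
- move=> nu2; have a1 : 1 < nu / 2 by lra.
  have mY := measurable_trace_sum W.
  apply: le_trans (dist_Kol_gamma i0 mX X0 al0 be0 HL mean var b0 hU a1 mY XY XY0 Delta1P) _.
  rewrite lee_fin le_eqVlt; apply/orP; left; apply/eqP; congr (2 * Num.sqrt _).
  rewrite -/mu -/nu.
  have s0 : 0 < Num.sqrt (2 * pi * (nu / 2 - 1)) by rewrite sqrtr_gt0 !mulr_gt0 ?pi_gt0// subr_gt0.
  have r0 : 0 < r_const (nu / 2) by exact: expR_gt0.
  by field; rewrite !gt_eqF.
Qed.
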